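(* Assume Condition (L), that $\alpha$ satisfies $\alpha>d$ and $\alpha\ge d(\tau+\frac12)$, that $\mathscr G$ satisfies Condition (G) with some $0<\gamma\le1$, that $D\le A_1N^{d/(2\alpha+d)}$ for some $A_1<\infty$, and that $\theta_\star\in\tilde H^\alpha\cap\Theta$ satisfies $\|\mathscr G(\theta_\star)-\mathscr G(\theta_{\star,D})\|_{L^2_\lambda}\le\delta_N/(2(2(U_{\mathscr G}+1)))$. Data are $(Y_i,X_i)_{i=1}^N\sim P^N_{\theta_\star}$. (i) For every $c>0$ there exist $\bar C,\bar c$ such that any maximiser $\hat\theta_{\rm MAP}$ over $E_D$ of $$\theta\mapsto -\frac{1}{2N}\sum_{i=1}^N|Y_i-\mathscr G(\theta)(X_i)|_V^2-\frac{\delta_N^2}{2}\|\theta\|_{\tilde H^\alpha}^2$$ satisfies $$P^N_{\theta_\star}\big(\|\hat\theta_{\rm MAP}-\theta_{\star,D}\|_{L^2_\zeta}\le\bar C\delta_N^\gamma,\ \|\hat\theta_{\rm MAP}\|_{\tilde H^\alpha}\le\bar C\big)\ge 1-\bar ce^{-cN\delta_N^2}.$$ (ii) Let $u'=2(U_{\mathscr G}^2+1)$. For every $b>0$ one can choose $\bar C$ (and $\bar c$) large enough, together with some $\bar b>0$ and some large enough $K>0$, such that $$P^N_{\theta_\star}\Big(\big\{\Pi\big(\theta\in E_D:\|\theta-\theta_{\star,D}\|_{L^2_\zeta}\le\bar C\delta_N^\gamma,\ \|\theta\|_{\tilde H^\alpha}\le\bar C\,\big|\,(Y_i,X_i)_{i=1}^N\big)\ge1-e^{-bN\delta_N^2}\big\}\cap\mathcal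 C_{N,K}\Big)\ge 1-\bar ce^{-\bar bN\delta_N^2}.$$ Here $$\mathcal C_{N,K}=\Big\{\int_{E_D}e^{\ell_N(\theta)-\ell_N(\theta_\star)}d\Pi(\theta)\ge\Pi(B_N)e^{-KN\delta_N^2}\Big\},$$ and $B_N$ may be taken to be any measurable subset of $\{\theta\in E_D:\|\mathscr G(\theta)-\mathscr G(\theta_\star)\|_{L^2_\lambda}\le\delta_N/u'\}$.
   Context: Setting. $(\mathcal Z,\zeta)$ is a measure space and $W$ is a real vector space of dimension $d_W$ with a fixed basis. $L^2_\zeta(\mathcal Z,W)$ denotes $W$-valued fields $f=(f_1,\dots,f_{d_W})$ with $f_i\in L^2_\zeta(\mathcal Z,\mathbb R)$, with inner product $\sum_i\langle f_i,g_i\rangle_{L^2_\zeta}$. $(e_n)_{n\in\mathbb N_0}\subset L^2_\zeta(\mathcal Z,\mathbb R)\cap L^\infty(\mathcal Z)$ is orthonormal, and $0<\lambda_0\le\lambda_1\le\dots\to\infty$. For $s\ge0$, $\tilde H^s=\tilde H^s(\mathcal Z,W)$ is the space of $f\in L^2_\zeta(\mathcal Z,W)$ with $\|f\|_{\tilde H^s}^2=\sum_{i=1}^{d_W}\sum_{n}\lambda_n^s\langle f_i,e_n\rangle_{L^2_\zeta}^2<\infty$. For $D$ a positive integer multiple of $d_W$, put $D_W=D/d_W$. $E_D$ is the $D$-dimensional space of $W$-valued fields each of whose coordinates lies in $\mathrm{span}\{e_n:0\le n<D_W\}$. It is identified with $\mathbb R^D$ via the coefficients $\langle f_i,e_n\rangle$,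 so that the Euclidean norm $\|\cdot\|_{E_D}$ equals the $L^2_\zeta$-norm. Condition (L): there are $\tau\ge0$, $d\in\mathbb N$ and $b_1,b_2>0$ such that $\max_{0\le n\le D_W}\|e_n\|_\infty\lesssim D^\tau$ for all $D$, and $b_1n^{2/d}\le\lambda_n\le b_2n^{2/d}$ for $n\in\mathbb N$. Moreover $\Theta$ is a measurable linear subspace with $\bigcup_DE_D\subset\Theta\subset L^\infty(\mathcal Z,W)$. Model. $(\mathcal X,\lambda)$ is a probability space and $V$ a real inner product space of dimension $d_V$. $\mathscr G:\Theta\to L^2_\lambda(\mathcal X,V)$ is measurable and $(x,\theta)\mapsto\mathscr G(\theta)(x)$ is jointly measurable. Data $(Y_i,X_i)_{i=1}^N$ are generated with $X_i$ i.i.d. $\sim\lambda$ and $Y_i=\mathscr G(\theta)(X_i)+\varepsilon_i$, where the $\varepsilon_i$ are i.i.d. $N(0,I_V)$ and independent of the $X_i$; the law is $P^N_\theta$. We write $\ell_N(\theta)=-\frac12\sum_{i=1}^N|Y_i-\mathscr G(\theta)(X_i)|_V^2$. Prior and posterior. For $\alpha>0$ set $\delta_N=N^{-\alpha/(2\alpha+d)}$. The prior $\Pi$ on $E_D\cong\mathbb R^D$ is the centred Gaussian under which the coefficients $\langle\theta_i,e_n\rangle$ are independent $N(0,\lambda_n^{-\alpha}/(N\delta_N^2))$. The posterior is $\Pi(B\mid(Y_i,X_i)_{i=1}^N)=\int_Be^{\ell_N}d\Pi/\int_{E_D}e^{\ell_N}d\Pi$. For $\theta_\star\in\Theta$, $\theta_{\star,D}$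 denotes its $L^2_\zeta$-orthogonal projection onto $E_D$. Condition (G): a) $\sup_{\theta\in\Theta,x\in\mathcal X}|\mathscr G(\theta)(x)|_V\le U_{\mathscr G}$ for some $U_{\mathscr G}\ge1$. b) For some $C_{\mathscr G}\ge1$ and all $\theta,\theta'\in\Theta$: $\|\mathscr G(\theta)-\mathscr G(\theta')\|_{L^2_\lambda}\le C_{\mathscr G}\|\theta-\theta'\|_{L^2_\zeta}$ and $\|\mathscr G(\theta)-\mathscr G(\theta')\|_\infty\le C_{\mathscr G}\|\theta-\theta'\|_\infty$. c) There is $\gamma\in(0,1]$ such that for every $M$ there is $L'$ with, for all $D$ and all sufficiently small $\delta>0$, $\sup\{\|\theta-\theta'\|_{L^2_\zeta}:\theta,\theta'\in E_D,\ \|\theta\|_{\tilde H^\alpha}+\|\theta'\|_{\tilde H^\alpha}\le M,\ \|\mathscr G(\theta)-\mathscr G(\theta')\|_{L^2_\lambda}\le\delta\}\le L'\delta^\gamma$. *)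

(* Defs.v *)
From HB Require Import structures.
From mathcomp Require Import all_boot all_order all_algebra.
From mathcomp Require Import all_classical all_reals all_analysis.
Set Implicit Arguments.
Unset Strict Implicit.
Unset Printing Implicit Defensive.
Import Order.TTheory GRing.Theory Num.Theory.
Import numFieldNormedType.Exports.
Local Open Scope classical_set_scope.
Local Open Scope ring_scope.

Section Defs.
Context {R : realType}.

(* Elements of W (resp. V) are represented by their coordinate tuples
   in the fixed basis of W (resp. an orthonormal basis of V). *)
Definition sqdist n (u v : n.-tuple R) : R :=
  \sum_(j < n) (tnth u j - tnth v j) ^+ 2.
Definition tnorm n (u : n.-tuple R) : R := Num.sqrt (\sum_(j < n) tnth u j ^+ 2).
Definition tdist n (u v : n.-tuple R) : R := Num.sqrt (sqdist u v).

Definition fadd (Z : Type) dW (f g : Z -> dW.-tuple R) : Z -> dW.-tuple R :=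
  fun z => [tuple tnth (f z) i + tnth (g z) i | i < dW].
Definition fscale (Z : Type) dW (a : R) (f : Z -> dW.-tuple R) : Z -> dW.-tuple R :=
  fun z => [tuple a * tnth (f z) i | i < dW].
Definition fcoord (Z : Type) dW (f : Z -> dW.-tuple R) (i : 'I_dW) : Z -> R :=
  fun z => tnth (f z) i.

(* coefficient space of E_D, D = dW * DW : coefficients <theta_i, e_n>,
   i < dW, n < DW (this is R^D, with its Borel = product sigma-algebra) *)
Definition Coef dW DW := dW.-tuple (DW.-tuple R).
Definition coord dW DW (c : Coef dW DW) (i : 'I_dW) (n : 'I_DW) : R :=
  tnth (tnth c i) n.

Definition fieldOf (Z : Type) (e : nat -> Z -> R) dW DW (c : Coef dW DW)
  : Z -> dW.-tuple R :=
  fun z => [tuple \sum_(n < DW) coord c i n * e n z | i < dW].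

Section Measure.
Context {dZ : measure_display} {Z : measurableType dZ}
  (zeta : {measure set Z -> \bar R}).

Definition ip (f g : Z -> R) : R := fine (\int[zeta]_z (f z * g z)%:E)%E.

Definition L2sqdist dW (f g : Z -> dW.-tuple R) : \bar R :=
  (\sum_(i < dW) \int[zeta]_z ((tnth (f z) i - tnth (g z) i) ^+ 2)%:E)%E.
Definition L2dist dW (f g : Z -> dW.-tuple R) : \bar R := sqrte (L2sqdist f g).

Definition inL2 dW (f : Z -> dW.-tuple R) : Prop :=
  forall i : 'I_dW, measurable_fun setT (fcoord f i) /\
    (\int[zeta]_z ((fcoord f i z) ^+ 2)%:E < +oo)%E.

Definition Hsq (e : nat -> Z -> R) (lam : nat -> R) (s : R) dW
    (f : Z -> dW.-tuple R) : \bar R :=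
  (\sum_(i < dW) \sum_(0 <= n <oo) ((lam n) `^ s * (ip (fcoord f i) (e n)) ^+ 2)%:E)%E.
Definition Hnorm e lam s dW (f : Z -> dW.-tuple R) : \bar R :=
  sqrte (Hsq e lam s f).

Definition projCoef (e : nat -> Z -> R) dW DW (f : Z -> dW.-tuple R) : Coef dW DW :=
  [tuple [tuple ip (fcoord f i) (e n) | n < DW] | i < dW].
End Measure.

Definition supdist (Z : Type) n (f g : Z -> n.-tuple R) : \bar R :=
  ereal_sup (range (fun z => (tdist (f z) (g z))%:E)).

Definition L2Xdist {dX} {X : measurableType dX} (lamX : {measure set X -> \bar R})
    dV (g h : X -> dV.-tuple R) : \bar R :=
  sqrte (\int[lamX]_x (sqdist (g x) (h x))%:E)%E.

Definition mutual_indep {d} {O : measurableType d} (P : probability O R)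
    (I : finType) (F : I -> set (set O)) : Prop :=
  forall (J : {set I}) (A : I -> set O), (forall i, i \in J -> F i (A i)) ->
    P (\bigcap_(i in [set i | i \in J]) A i) = (\prod_(i in J) fine (P (A i)))%:E.

Definition preim_sys {O : Type} {d'} {T : measurableType d'} (f : O -> T)
  : set (set O) := [set f @^-1` B | B in measurable].

Definition deltaN (alpha : R) (d N : nat) : R :=
  (N%:R) `^ (- (alpha / (2 * alpha + d%:R))).

Definition data_model {d} {O : measurableType d} (P : probability O R)
    {dX} {X : measurableType dX} (lamX : probability X R) (N dV : nat)
    (Xs : 'I_N -> O -> X) (eps : 'I_N -> 'I_dV -> O -> R) : Prop :=
  [/\ forall i, measurable_fun setT (Xs i),
      forall i j, measurable_fun setT (eps i j),
      forall i A, measurable A -> P (Xs i @^-1` A) = lamX A,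
      forall i j A, measurable A -> P (eps i j @^-1` A) = normal_prob 0 1 A &
      mutual_indep P (fun k : ('I_N + 'I_N * 'I_dV)%type =>
        match k with
        | inl i => preim_sys (Xs i)
        | inr ij => preim_sys (eps ij.1 ij.2)
        end)].

Definition dataOf {O : Type} {X : Type} {Z : Type} dW (N dV : nat)
    (G : (Z -> dW.-tuple R) -> X -> dV.-tuple R) (theta : Z -> dW.-tuple R)
    (Xs : 'I_N -> O -> X) (eps : 'I_N -> 'I_dV -> O -> R) (w : O)
  : N.-tuple (dV.-tuple R * X) :=
  [tuple ([tuple tnth (G theta (Xs i w)) j + eps i j w | j < dV], Xs i w) | i < N].

Definition loglik {X Z : Type} dW (N dV : nat)
    (G : (Z -> dW.-tuple R) -> X -> dV.-tuple R)
    (y : N.-tuple (dV.-tuple R * X)) (theta : Z -> dW.-tuple R) : R :=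
  - 2^-1 * \sum_(i < N) sqdist (tnth y i).1 (G theta (tnth y i).2).

Definition Jmap {dZ} {Z : measurableType dZ} (zeta : {measure set Z -> \bar R})
    (e : nat -> Z -> R) (lam : nat -> R) (alpha : R) (d : nat) {X : Type}
    dW DW (N dV : nat) (G : (Z -> dW.-tuple R) -> X -> dV.-tuple R)
    (y : N.-tuple (dV.-tuple R * X)) (c : Coef dW DW) : \bar R :=
  ((- (N%:R * 2)^-1 * \sum_(i < N) sqdist (tnth y i).1 (G (fieldOf e c) (tnth y i).2))%:E
   - ((deltaN alpha d N) ^+ 2 / 2)%:E * Hsq zeta e lam alpha (fieldOf e c))%E.

Definition gauss_prior (lam : nat -> R) (alpha : R) (d N : nat) dW DW
    (Pi : probability (Coef dW DW) R) : Prop :=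
  mutual_indep Pi (fun k : ('I_dW * 'I_DW)%type =>
     preim_sys (fun c : Coef dW DW => coord c k.1 k.2)) /\
  forall (i : 'I_dW) (n : 'I_DW) (A : set R), measurable A ->
    Pi ((fun c : Coef dW DW => coord c i n) @^-1` A) =
    normal_prob 0 (Num.sqrt (lam n `^ (- alpha) / (N%:R * (deltaN alpha d N) ^+ 2))) A.

Definition post dW DW (Pi : probability (Coef dW DW) R) (ellf : Coef dW DW -> R)
    (A : set (Coef dW DW)) : R :=
  fine (\int[Pi]_(c in A) (expR (ellf c))%:E)%E /
  fine (\int[Pi]_c (expR (ellf c))%:E)%E.

End Defs.

(* Main.v *)
(** Put T = N delta_N^2, so that the dimension of E_D is O(T).  For a fixed g, the likelihood
    ratio to the truth at exponent 1/2 has expectation at most exp(- c N risk(g)), and scaled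
    increments between nearby parameters have exponential moments controlled by their squared
    L^2 and sup-norm distances.  Chaining these bounds along dyadic refinements of a lattice
    of mesh delta_N / sqrt D, at exponents 2^l, with a union bound weighted by a Gaussian
    weight in the Sobolev norm, gives outside an event of probability exp(- K0 T), for
    all theta in E_D at once,
      l_N(theta) - l_N(theta_star) <= - c N risk(theta) + T (C + |theta|_{H^alpha}^2 / 8).
    For the MAP estimator, compare with the objective at the projection theta_{star,D}.  For
    the posterior, bound the evidence from below through a Gaussian small-ball estimate and
    integrate the display, whose Sobolev term is paid for by the Gaussian exponential moment of
    T |theta|_{H^alpha}^2 / 4.  In both cases the risk is O(delta_N^2) and the Sobolev norm is
    O(1), and Condition (G) c) turns this into the L^2 rate. *)

(* Between levels [l] and [l.+1] the forward map moves by [O(2^-l delta_N)] in L^2 and by [O(2^-l)]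
   in sup norm, so at exponent [2^l] the moment bounds do not depend on [l]. Refining the lattice
   once multiplies the points by about [2^D], a cost [O(T)] per level; dividing by the exponent
   leaves a total of order [sum l 2^-l T]. One term does not shrink: the drift of every increment
   contains the risk of the coarser point. It receives a small free coefficient, chosen so that the
   whole chain consumes half of the gain of level 0. The Gaussian weights leave a product of factors
   [1 + 1 / (sqrt (s T lambda_n^alpha) mesh)]. As [delta_N^-1 = T^(alpha/d)], the eigenvalue bound
   makes factor [n] of order [(T/n)^(alpha/d)]: unbounded singly, [exp(O(T))] in product. With
   another [s] the same product is the price of the prior small ball. The coefficient 1/8 must stay
   below what pays for it, the 1/2 of the MAP penalty and the 1/4 of the prior moment; the surplus
   is what bounds the Sobolev norm. *)
Require Import Defs.
From HB Require Import structures.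
From mathcomp Require Import all_boot all_order all_algebra.
From mathcomp Require Import all_classical all_reals all_analysis.
From mathcomp Require Import measurable_realfun.
From mathcomp Require Import ring lra.
Set Implicit Arguments.
Unset Strict Implicit.
Unset Printing Implicit Defensive.
Import Order.TTheory GRing.Theory Num.Theory.
Import numFieldNormedType.Exports.
Local Open Scope classical_set_scope.
Local Open Scope ring_scope.

(** * Independence and Gaussian integrals *)

Section Independence.
Context d (O : measurableType d) (R : realType) (P : probability O R).

(** Intersections, rather than the union of the [F i]: a generating class closed under intersection,
    as uniqueness of measures requires. *)
Definition cylinders (I : finType) (F : I -> set (set O)) (J : {set I}) : set (set O) :=
  [set (\bigcap_(i in [set i | i \in J]) A i) | A in
    [set A : I -> set O | forall i, i \in J -> F i (A i)]].

(** Measurability for the joint sigma-algebra of the indices in [J], phrased through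
    [g_sigma_algebraType] so that the closure properties of measurable functions apply verbatim. *)
Definition cyl_measurable (I : finType) (F : I -> set (set O)) (J : {set I})
    d' (T : measurableType d') (f : O -> T) :=
  measurable_fun [set: g_sigma_algebraType (cylinders F J)] (f : g_sigma_algebraType (cylinders F J) -> T).

Variables (I : finType) (F : I -> set (set O)).
Hypothesis Fm : forall i, F i `<=` measurable.
Hypothesis Fs : forall i, sigma_algebra setT (F i).
Hypothesis ind : mutual_indep P F.

Lemma indep_setT i : F i setT.
Proof. by case: (Fs i) => F0 FC _; rewrite -(setD0 setT); exact: FC. Qed.

Lemma indep_setI i A B : F i A -> F i B -> F i (A `&` B).
Proof.
move=> FA FB.
have := @measurableI _ (g_sigma_algebraType (F i)) A B.
by rewrite /measurable/= sigma_algebra_id//; apply.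
Qed.

Lemma cylinders_measurable J : cylinders F J `<=` measurable.
Proof.
move=> _ [A AF <-]; apply: fin_bigcap_measurable; first exact: finite_finset.
by move=> i iJ; apply: (Fm (i := i)); exact: AF.
Qed.

Lemma cylinders_setI J : setI_closed (cylinders F J).
Proof.
move=> _ _ [A AF <-] [B BF <-]; exists (fun i => A i `&` B i).
  by move=> i iJ; apply: indep_setI; [exact: AF|exact: BF].
by rewrite bigcapI.
Qed.

Lemma cylinders_setT J : cylinders F J setT.
Proof.
exists (fun=> setT); first by move=> i _; exact: indep_setT.
by apply/seteqP; split => // x _ i _.
Qed.

Lemma cylindersS (J K : {set I}) : J \subset K -> cylinders F J `<=` cylinders F K.
Proof.
move=> /fintype.subsetP JK _ [A AF <-]; exists (fun i => if i \in J then A i else setT).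
  by move=> i iK; case: ifPn => [/AF//|_]; exact: indep_setT.
apply/seteqP; split => x h i /= iJ; first by have := h i (JK _ iJ); rewrite iJ.
by case: ifPn => // iJ'; exact: h.
Qed.

Lemma cyl_measurableS (J K : {set I}) d' (T : measurableType d') (f : O -> T) :
  J \subset K -> cyl_measurable F J f -> cyl_measurable F K f.
Proof.
move=> JK mf _ B mB; rewrite setTI.
have /= := mf measurableT B mB; rewrite setTI.
by apply: sub_smallest2r; [exact: smallest_sigma_algebra|exact: cylindersS].
Qed.

Lemma cyl_measurable_fun J d' (T : measurableType d') (f : O -> T) :
  cyl_measurable F J f -> measurable_fun setT f.
Proof.
move=> mf _ B mB; rewrite setTI.
have /= := mf measurableT B mB; rewrite setTI.
apply: smallest_sub; first exact: sigma_algebra_measurable.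
exact: cylinders_measurable.
Qed.

Lemma cyl_measurable_gen (J : {set I}) k d' (T : measurableType d') (f : O -> T) : k \in J ->
  (forall B, measurable B -> F k (f @^-1` B)) -> cyl_measurable F J f.
Proof.
move=> kJ mf _ B mB; rewrite setTI; apply: sub_sigma_algebra.
exists (fun i => if i == k then f @^-1` B else setT).
  by move=> i iJ; case: eqP => [->|_]; [exact: mf|exact: indep_setT].
apply/seteqP; split => x /=; first by move=> /(_ k kJ); rewrite eqxx.
by move=> Bx i _; case: eqP.
Qed.

(** Both sides are finite measures in [A], a restriction and a rescaling of [P]. They agree on
    cylinders by mutual independence over [J] and over [k |: J], hence on the generated
    sigma-algebra. *)
Lemma indep_gen (J : {set I}) k A C : k \notin J ->
  <<s cylinders F J >> A -> F k C -> (P (A `&` C) = P A * P C)%E.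
Proof.
move=> kJ sA FC.
have mC : measurable C by apply: (Fm (i := k)).
have m0 : (0 <= fine (P C))%R by rewrite fine_ge0.
pose m1 := mrestr P mC.
pose m2 := mscale (NngNum m0) P.
suff : m1 A = m2 A.
  by rewrite /m1 /m2 /mrestr /mscale/= fineK ?fin_num_measure// muleC.
apply: (g_sigma_algebra_measure_unique (cylinders F J) _ (fun=> setT)) => //.
- exact: cylinders_measurable.
- by move=> _; exact: cylinders_setT.
- by rewrite bigcup_const//; exists 0%N.
- exact: cylinders_setI.
- move=> _ [B BF <-]; rewrite /m1 /m2 /mrestr /mscale/=.
  have := ind BF => PB.
  pose B' i := if i == k then C else B i.
  have B'F i : i \in k |: J -> F i (B' i).
    by rewrite /B' !inE; case: eqP => [->//|_ /= iJ]; exact: BF.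
  have := ind B'F.
  have Bk : B' k = C by rewrite /B' eqxx.
  rewrite big_setU1//= EFinM Bk => PB'.
  transitivity (P (\bigcap_(i in [set i | i \in k |: J]) B' i)).
    congr (P _); apply/seteqP; split => x /=.
      move=> [h Cx] i; rewrite /B'; case: eqP => //= ik; rewrite !inE => /orP[/eqP//|iJ].
      exact: h.
    move=> h; split; last by have := h k; rewrite /B' eqxx; apply; rewrite /= !inE eqxx.
    move=> i /= iJ; have := h i; rewrite /B' /= !inE iJ orbT => /(_ isT).
    by case: eqP => // ik; move: kJ; rewrite -ik iJ.
  rewrite [LHS]PB'; congr (_ * _)%E.
  rewrite [RHS]PB; congr (_%:E); apply: eq_bigr => i iJ; rewrite /B'.
  by case: eqP => // ik; move: kJ; rewrite -ik iJ.
- move=> _; rewrite /= /mrestr setTI.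
  by apply: (le_lt_trans (probability_le1 P mC)); rewrite ltry.
Qed.

(** Independence makes the law of [(f, g)] the product of the two laws; Tonelli on that product
    gives the iterated integral. *)
Lemma indep_expect (d1 d2 : measure_display) (T1 : measurableType d1) (T2 : measurableType d2)
   (f : O -> T1) (g : O -> T2) (mf : measurable_fun setT f) (mg : measurable_fun setT g)
   (h : T1 * T2 -> \bar R) :
  (forall A B, measurable A -> measurable B ->
     P (f @^-1` A `&` g @^-1` B) = P (f @^-1` A) * P (g @^-1` B))%E ->
  measurable_fun [set: (T1 * T2)%type] h -> (forall x, 0 <= h x)%E ->
  (\int[P]_w h (f w, g w) = \int[P]_w \int[P]_v h (f w, g v))%E.
Proof.
move=> fg mh h0.
pose mF := HB.pack_for {mfun O >-> T1} f (isMeasurableFun.Build _ _ _ _ f mf).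
pose mG := HB.pack_for {mfun O >-> T2} g (isMeasurableFun.Build _ _ _ _ g mg).
have mfg : measurable_fun setT (fun w => (f w, g w)) by exact: measurable_fun_pair.
pose mFG := HB.pack_for {mfun O >-> (T1 * T2)%type} (fun w => (f w, g w))
   (isMeasurableFun.Build _ _ _ _ (fun w => (f w, g w)) mfg).
pose P1 : probability T1 R := distribution P mF.
pose P2 : probability T2 R := distribution P mG.
pose P3 : probability (T1 * T2)%type R := distribution P mFG.
have PE : forall X, measurable X -> (P1 \x P2)%E X = P3 X.
  by apply: product_measure_unique => A B mA mB; exact: fg.
transitivity (\int[P3]_x h x)%E.
  by rewrite /P3 /distribution ge0_integral_pushforward//.
transitivity (\int[(P1 \x P2)%E]_x h x)%E.
  by apply: eq_measure_integral => A mA _; apply/esym; exact: PE.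
rewrite fubini_tonelli1//.
rewrite /P1 /distribution ge0_integral_pushforward//=.
- apply: eq_integral => w _; rewrite /fubini_F /P2 /distribution ge0_integral_pushforward//.
  by apply: measurableT_comp => //; exact: measurable_fun_pair.
- exact: measurable_fun_fubini_tonelli_F.
- by move=> x _; apply: integral_ge0.
Qed.

Lemma indep_mul (J : {set I}) k (U V : O -> R) : k \notin J ->
  cyl_measurable F J U -> (forall B, measurable B -> F k (V @^-1` B)) ->
  (forall w, 0 <= U w) -> (forall w, 0 <= V w) ->
  (\int[P]_w (U w * V w)%:E = (\int[P]_w (U w)%:E) * (\int[P]_w (V w)%:E))%E.
Proof.
move=> kJ mU mV U0 V0.
have mU' := cyl_measurable_fun mU.
have mV' : measurable_fun setT V.
  by move=> _ B mB; rewrite setTI; apply: (Fm (i := k)); exact: mV.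
(* The absolute value makes the integrand nonnegative on the whole product space, not only on the
   range of [(U, V)]. *)
have := @indep_expect _ _ _ _ U V mU' mV' (fun x => (`|x.1 * x.2|)%:E).
move=> /(_ _ _ _)/wrap[]//.
- move=> A B mA mB; apply: (@indep_gen J k) => //; last exact: mV.
  by have /= := mU measurableT A mA; rewrite setTI.
- apply/measurable_EFinP; apply: measurableT_comp => //.
  by apply: measurable_funM; [exact: measurable_fst|exact: measurable_snd].
move=> h.
under eq_integral do rewrite -[X in X%:E]ger0_norm ?mulr_ge0//.
rewrite [LHS]h /=.
under eq_integral.
  move=> w _; under eq_integral do rewrite normrM !ger0_norm// EFinM.
  rewrite ge0_integralZl_EFin//; last 2 first.
  - by move=> v _; rewrite lee_fin.
  - exact/measurable_EFinP.
  over.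
rewrite /= ge0_integralZr//; first exact/measurable_EFinP.
- by move=> w _; rewrite lee_fin.
- by apply: integral_ge0 => w _; rewrite lee_fin.
Qed.

Lemma indep_prod (V : I -> O -> R) (s : seq I) : uniq s ->
  (forall k B, measurable B -> F k (V k @^-1` B)) ->
  (forall k w, 0 <= V k w) ->
  (\int[P]_w (\prod_(k <- s) V k w)%:E = \prod_(k <- s) \int[P]_w (V k w)%:E)%E.
Proof.
move=> us mV V0; elim: s us => [_|k s IH /= /andP[ks us]].
  rewrite big_nil; under eq_integral do rewrite big_nil.
  by rewrite integral_cst// mul1e; exact: probability_setT.
rewrite big_cons -IH//.
under eq_integral do rewrite big_cons mulrC.
rewrite muleC; apply: (@indep_mul [set x in s] k) => //.
- by rewrite inE.
- apply: measurable_prod => a sa.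
  by apply: (@cyl_measurable_gen _ a) => //; [rewrite inE|exact: mV].
- exact: mV.
- by move=> w; apply: prodr_ge0.
Qed.

End Independence.

(** * Exponential moments of the normal law *)

Section NormalIntegrals.
Context {R : realType}.
Local Notation mu := (@lebesgue_measure R).

(** The change of variables goes through the Radon-Nikodym derivative, which equals [normal_pdf]
    almost everywhere because both integrate to [normal_prob] on every measurable set. *)
Lemma integral_normal_prob (m s : R) (f : R -> \bar R) :
  measurable_fun setT f -> (forall x, 0 <= f x)%E ->
  (\int[normal_prob m s]_x f x = \int[mu]_x (f x * (normal_pdf m s x)%:E))%E.
Proof.
move=> mf f0; have dom := @normal_prob_dominates R m s.
rewrite -(Radon_Nikodym_SigmaFinite.change_of_variables dom)//.
apply: ae_eq_integral => //.
- apply: emeasurable_funM => //; apply: (measurable_int mu).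
  exact: Radon_Nikodym_SigmaFinite.f_integrable.
- apply: emeasurable_funM => //; apply/measurable_EFinP.
  exact: measurable_normal_pdf.
- apply: ae_eqe_mul2l; apply: integral_ae_eq => //.
  + exact: Radon_Nikodym_SigmaFinite.f_integrable.
  + by apply/measurable_EFinP; exact: measurable_normal_pdf.
  + by move=> E _ mE; rewrite -Radon_Nikodym_SigmaFinite.f_integral.
Qed.

Lemma normal_mgf (y : R) :
  (\int[normal_prob 0 1]_z (expR (z * y))%:E = (expR (y ^+ 2 / 2))%:E)%E.
Proof.
rewrite integral_normal_prob; last 2 first.
- apply/measurable_EFinP; apply: measurableT_comp => //.
  by apply: measurable_funM => //; exact: measurable_cst.
- by move=> x; rewrite lee_fin expR_ge0.
under eq_integral => x _.
  (* Completing the square: the tilted density is that of the normal law with mean [y]. *)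
  rewrite -EFinM (_ : expR (x * y) * _ = expR (y ^+ 2 / 2) * normal_pdf y 1 x); last first.
    rewrite !normal_pdfE ?oner_eq0// /normal_fun mulrCA [RHS]mulrCA -!expRD.
    by congr (_ * expR _); field.
  rewrite EFinM.
  over.
rewrite ge0_integralZl_EFin//=.
- by rewrite integral_normal_pdf mule1.
- by move=> x _; rewrite lee_fin normal_pdf_ge0.
- by apply/measurable_EFinP; exact: measurable_normal_pdf.
Qed.

(** At [a * s ^+ 2 = 1/4] the tilted density is, up to the factor [sqrt 2], the normal density of
    variance [2 * s ^+ 2]. *)
Lemma normal_sqr_mgf (a s : R) : 0 < s -> a * s ^+ 2 = 4^-1 ->
  (\int[normal_prob 0 s]_z (expR (a * z ^+ 2))%:E = (Num.sqrt 2)%:E)%E.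
Proof.
move=> s0 as4.
rewrite integral_normal_prob; last 2 first.
- apply/measurable_EFinP; apply: measurableT_comp => //.
  by apply: measurable_funM => //; exact: measurable_funX.
- by move=> x; rewrite lee_fin expR_ge0.
have s2 : 0 < Num.sqrt 2 :> R by rewrite sqrtr_gt0.
have s22 : Num.sqrt 2 ^+ 2 = 2 :> R by rewrite sqr_sqrtr.
under eq_integral => x _.
  rewrite -EFinM (_ : expR (a * x ^+ 2) * _ = Num.sqrt 2 * normal_pdf 0 (Num.sqrt 2 * s) x); last first.
    rewrite !normal_pdfE ?gt_eqF ?mulr_gt0// /normal_fun mulrCA [RHS]mulrA; congr (_ * _).
      rewrite /normal_peak exprMn s22.
      have -> : 2 * s ^+ 2 * pi *+ 2 = 2 * (s ^+ 2 * pi *+ 2) by rewrite -mulrA mulrnAr.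
      rewrite sqrtrM//.
      by rewrite invfM mulrA divff ?mul1r// gt_eqF.
    rewrite -expRD; congr expR; rewrite subr0 exprMn s22.
    have -> : a = (4 * s ^+ 2)^-1.
      by apply: (mulIf (x := s ^+ 2)); rewrite ?expf_neq0 ?gt_eqF// as4 invfM mulrVK ?unitfE ?expf_neq0 ?gt_eqF.
    by field; rewrite gt_eqF.
  rewrite EFinM.
  over.
rewrite ge0_integralZl_EFin//=.
- by rewrite integral_normal_pdf mule1.
- by move=> x _; rewrite lee_fin normal_pdf_ge0.
- by apply/measurable_EFinP; exact: measurable_normal_pdf.
Qed.

End NormalIntegrals.

Lemma ge0_integral_law d (O : measurableType d) d' (T : measurableType d') (R : realType)
    (P : {measure set O -> \bar R}) (f : O -> T) (Q : {measure set T -> \bar R})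
    (h : T -> \bar R) : measurable_fun setT f ->
  (forall A, measurable A -> P (f @^-1` A) = Q A) ->
  measurable_fun setT h -> (forall x, 0 <= h x)%E ->
  (\int[P]_w h (f w) = \int[Q]_x h x)%E.
Proof.
move=> mf law mh h0.
transitivity (\int[pushforward P f]_x h x)%E.
  by rewrite ge0_integral_pushforward.
by apply: eq_measure_integral => A mA _; exact: law.
Qed.

Section GaussPeel.
Context d (O : measurableType d) (R : realType) (P : probability O R).
Variables (I : finType) (F : I -> set (set O)).
Hypothesis Fm : forall i, F i `<=` measurable.
Hypothesis Fs : forall i, sigma_algebra setT (F i).
Hypothesis ind : mutual_indep P F.

(* Integrating out one noise variable [eta] that is independent of the rest replaces
   [expR (eta * v)] by [expR (v ^+ 2 / 2)]. *)
Lemma gauss_peel (J : {set I}) k (U v eta : O -> R) : k \notin J ->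
  cyl_measurable F J U -> cyl_measurable F J v ->
  (forall B, measurable B -> F k (eta @^-1` B)) ->
  (forall A, measurable A -> P (eta @^-1` A) = normal_prob 0 1 A) ->
  (forall w, 0 <= U w) ->
  (\int[P]_w (U w * expR (eta w * v w))%:E
   = \int[P]_w (U w * expR (v w ^+ 2 / 2))%:E)%E.
Proof.
move=> kJ mU mv meta law U0.
have meta' : measurable_fun setT eta.
  by move=> _ B mB; rewrite setTI; apply: (Fm (i := k)); exact: meta.
have mUv : cyl_measurable F J (fun w => (U w, v w)) by exact: measurable_fun_pair.
have mUv' := cyl_measurable_fun Fm mUv.
pose h (x : (R * R) * R) := (`|x.1.1| * expR (x.2 * x.1.2))%:E.
have mh : measurable_fun setT h.
  apply/measurable_EFinP; apply: measurable_funM.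
    apply: measurableT_comp => //.
    exact: (measurableT_comp measurable_fst measurable_fst).
  apply: measurableT_comp => //; apply: measurable_funM; first exact: measurable_snd.
  exact: (measurableT_comp measurable_snd measurable_fst).
have := @indep_expect _ _ _ P _ _ _ _ _ eta mUv' meta' h.
move=> /(_ _ mh _)/wrap[].
- move=> A B mA mB; apply: (@indep_gen _ _ _ _ _ _ Fm Fs ind J k) => //; last exact: meta.
  by have /= := mUv measurableT A mA; rewrite setTI.
- by move=> x; rewrite lee_fin mulr_ge0// expR_ge0.
rewrite /h/= => H.
transitivity (\int[P]_w (`|U w| * expR (eta w * v w))%:E)%E.
  by apply: eq_integral => w _; rewrite ger0_norm.
rewrite H; apply: eq_integral => w _.
under eq_integral do rewrite EFinM.
rewrite ge0_integralZl_EFin//=; last first.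
  apply/measurable_EFinP; apply: measurableT_comp => //.
  by apply: measurable_funM => //; exact: measurable_cst.
rewrite EFinM ger0_norm//; congr (_ * _)%E.
transitivity (\int[normal_prob 0 1]_z (expR (z * v w))%:E)%E; last exact: normal_mgf.
apply: (@ge0_integral_law _ _ _ (measurableTypeR R) _ P eta (normal_prob 0 1) (fun z => (expR (z * v w))%:E)) => //.
apply/measurable_EFinP; apply: measurableT_comp => //.
by apply: measurable_funM => //; exact: measurable_cst.
Qed.

End GaussPeel.

Lemma preim_sys_sigma (O : Type) d' (T : measurableType d') (f : O -> T) :
  sigma_algebra setT (preim_sys f).
Proof.
have -> : preim_sys f = preimage_set_system setT f measurable.
  apply/seteqP; split => A [B mB <-]; exists B => //; by rewrite setTI.
by apply: sigma_algebra_preimage; exact: sigma_algebra_measurable.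
Qed.

Lemma preim_sys_measurable d (O : measurableType d) d' (T : measurableType d') (f : O -> T) :
  measurable_fun setT f -> preim_sys f `<=` measurable.
Proof. by move=> mf _ [B mB <-]; rewrite -[X in measurable X]setTI; exact: mf. Qed.

(** * Moment generating function of the regression data *)

Section DataModel.
Context d (O : measurableType d) (R : realType) (P : probability O R)
  dX (X : measurableType dX) (lamX : probability X R) (N dV : nat)
  (Xs : 'I_N -> O -> X) (eps : 'I_N -> 'I_dV -> O -> R).
Hypothesis dm : data_model P lamX Xs eps.

Let F := fun k : ('I_N + 'I_N * 'I_dV)%type =>
        match k with
        | inl i => preim_sys (Xs i)
        | inr ij => preim_sys (eps ij.1 ij.2)
        end.

Let mXs i : measurable_fun setT (Xs i). Proof. by case: dm. Qed.
Let meps i j : measurable_fun setT (eps i j). Proof. by case: dm. Qed.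
Let Fm i : F i `<=` measurable.
Proof. by case: i => [i|ij]; exact: preim_sys_measurable. Qed.
Let Fs i : sigma_algebra setT (F i).
Proof. by case: i => [i|ij]; exact: preim_sys_sigma. Qed.
Let ind : mutual_indep P F. Proof. by case: dm. Qed.

Variables (u : 'I_dV -> X -> R) (q : X -> R).
Hypotheses (mu : forall j, measurable_fun setT (u j)) (mq : measurable_fun setT q).

Let cyl_measurable_X (J : {set ('I_N + 'I_N * 'I_dV)%type}) i (h : X -> R) : inl i \in J ->
  measurable_fun setT h -> cyl_measurable F J (fun w => h (Xs i w)).
Proof.
move=> iJ mh; apply: (measurableT_comp mh).
by apply: (cyl_measurable_gen Fs iJ) => B mB; exists B.
Qed.

Let J0 : {set ('I_N + 'I_N * 'I_dV)%type} := [set k | if k is inl _ then true else false].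

(** The noise variables are integrated out one at a time. Each leaves a factor depending on the
    design only, which joins [W]; hence the general weight [W], measurable for the design indices
    [J0]. *)
Lemma peel_noise (s : seq ('I_N * 'I_dV)) (W : O -> R) : uniq s ->
  cyl_measurable F J0 W -> (forall w, 0 <= W w) ->
  (\int[P]_w (W w * \prod_(a <- s) expR (eps a.1 a.2 w * u a.2 (Xs a.1 w)))%:E
  = \int[P]_w (W w * \prod_(a <- s) expR (u a.2 (Xs a.1 w) ^+ 2 / 2))%:E)%E.
Proof.
elim: s W => [|a s IH] W /=.
  by move=> _ _ _; apply: eq_integral => w _; rewrite !big_nil.
move=> /andP[sa us] mW W0.
transitivity (\int[P]_w ((W w * \prod_(b <- s) expR (eps b.1 b.2 w * u b.2 (Xs b.1 w)))
    * expR (eps a.1 a.2 w * u a.2 (Xs a.1 w)))%:E)%E.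
  by apply: eq_integral => w _; rewrite big_cons; congr (_%:E); ring.
pose J : {set ('I_N + 'I_N * 'I_dV)%type} := ~: [set inr a].
have J0J : J0 \subset J.
  by apply/fintype.subsetP => -[i|b]; rewrite !inE.
rewrite (@gauss_peel _ _ _ P _ F Fm Fs ind J (inr a)
  (fun w => W w * \prod_(b <- s) expR (eps b.1 b.2 w * u b.2 (Xs b.1 w)))
  (fun w => u a.2 (Xs a.1 w)) (eps a.1 a.2))//; first last.
- by move=> w; apply: mulr_ge0 => //; apply: prodr_ge0 => b _; exact: expR_ge0.
- by case: dm => _ _ _ + _; apply.
- by move=> B mB; exists B.
- by apply: cyl_measurable_X => //; rewrite !inE.
- apply: measurable_funM; first exact: cyl_measurableS mW.
  apply: measurable_prod => b sb; apply: measurableT_comp => //.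
  apply: measurable_funM; last by apply: cyl_measurable_X => //; rewrite !inE.
  apply: (cyl_measurable_gen Fs (k := inr b)); last by move=> B mB; exists B.
  by rewrite !inE; apply: contra sa => /eqP[<-].
- by rewrite !inE eqxx.
transitivity (\int[P]_w ((W w * expR (u a.2 (Xs a.1 w) ^+ 2 / 2)) *
    \prod_(b <- s) expR (eps b.1 b.2 w * u b.2 (Xs b.1 w)))%:E)%E.
  by apply: eq_integral => w _; congr (_%:E); ring.
rewrite IH//.
- by apply: eq_integral => w _; rewrite big_cons; congr (_%:E); ring.
- apply: measurable_funM => //; apply: measurableT_comp => //.
  apply: measurable_funM; last exact: measurable_cst.
  by apply: measurable_funX; apply: cyl_measurable_X => //; rewrite inE.
- by move=> w; rewrite mulr_ge0// expR_ge0.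
Qed.

(** Once the noise is integrated out, the integrand is a product of functions of the separate
    [Xs i], which are independent with law [lamX]. *)
Lemma data_mgf :
  (\int[P]_w (expR (\sum_(i < N) (\sum_(j < dV) eps i j w * u j (Xs i w) + q (Xs i w))))%:E
  = (\int[lamX]_x (expR (2^-1 * \sum_(j < dV) u j x ^+ 2 + q x))%:E) ^+ N)%E.
Proof.
pose Q x := expR (2^-1 * \sum_(j < dV) u j x ^+ 2 + q x).
have mQ : measurable_fun setT Q.
  apply: measurableT_comp => //; apply: measurable_funD => //.
  apply: measurable_funM; first exact: measurable_cst.
  by apply: measurable_sum => j; exact: measurable_funX.
pose s := enum {: 'I_N * 'I_dV}.
have prodE (H : 'I_N -> 'I_dV -> R) :
    \prod_(a <- s) expR (H a.1 a.2) = expR (\sum_(i < N) \sum_(j < dV) H i j).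
  rewrite /s big_enum/= expR_sum.
  under [RHS]eq_bigr do rewrite expR_sum.
  by rewrite pair_big.
transitivity (\int[P]_w (expR (\sum_(i < N) q (Xs i w)) *
   \prod_(a <- s) expR (eps a.1 a.2 w * u a.2 (Xs a.1 w)))%:E)%E.
  apply: eq_integral => w _; rewrite (prodE (fun i j => eps i j w * u j (Xs i w))).
  by rewrite -expRD big_split/= addrC.
rewrite peel_noise ?enum_uniq//; last first.
  apply: measurableT_comp => //; apply: measurable_sum => i.
  by apply: cyl_measurable_X => //; rewrite inE.
(* [indep_prod] asks for a factor at every index of the family; the constant 1 serves at the noise
   indices, its preimages being [setT] or [set0]. *)
pose V (k : 'I_N + 'I_N * 'I_dV) w : R := if k is inl i then Q (Xs i w) else 1.
transitivity (\int[P]_w (\prod_(k <- map inl (enum 'I_N)) V k w)%:E)%E.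
  apply: eq_integral => w _.
  rewrite (prodE (fun i j => u j (Xs i w) ^+ 2 / 2)) -expRD -big_split/=.
  rewrite big_map big_enum/= /V /Q -expR_sum; congr ((expR _)%:E).
  by apply: eq_bigr => i _; rewrite addrC mulrC mulr_suml.
rewrite (@indep_prod _ _ _ P _ F)//.
- have cstE (x : \bar R) n : (\prod_(i < n) x = x ^+ n)%E.
    by elim: n => [|n IH]; rewrite ?big_ord0 ?expe0// big_ord_recl IH expeS.
  rewrite big_map big_enum/= -cstE.
  apply: eq_bigr => i _; rewrite /V.
  rewrite (@ge0_integral_law _ _ _ _ _ P (Xs i) lamX (EFin \o Q))//.
  + by case: dm => _ _ + _ _; apply.
  + exact/measurable_EFinP.
  + by move=> x; rewrite lee_fin expR_ge0.
- by rewrite map_inj_uniq ?enum_uniq// => a b [].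
- move=> [i|ij] B mB /=.
  + exists (Q @^-1` B) => //; rewrite -[X in measurable X]setTI; exact: mQ.
  + have [B1|B1] := pselect (B 1).
      by rewrite (_ : _ @^-1` _ = setT);
        [exact: (indep_setT Fs (inr ij))|apply/seteqP; split].
    rewrite (_ : _ @^-1` _ = set0); last by apply/seteqP; split.
    by case: (Fs (inr ij)).
- by move=> [i|ij] w; rewrite /V/= ?expR_ge0.
Qed.

End DataModel.

Section Bounds.
Context {R : realType}.

Lemma expR_le1Dabs (B z : R) : `|z| <= B -> expR z <= 1 + expR B * `|z|.
Proof.
move=> zB; have [z0|z0] := leP z 0.
  apply: (@le_trans _ _ 1); first by rewrite -expR0 ler_expR.
  by rewrite lerDl mulr_ge0// expR_ge0.
have zz : `|z| = z by rewrite gtr0_norm.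
rewrite zz in zB *.
apply: (@le_trans _ _ (1 + expR z * z)); last first.
  by rewrite lerD2l ler_wpM2r ?ler_expR// ltW.
have h := expR_ge1Dx (- z).
have e0 := expR_gt0 z.
have : expR z * (1 - z) <= 1 by rewrite -ler_pdivlMl// mulr1 -expRN.
by rewrite mulrBr mulr1 lerBlDr.
Qed.

(** The bound is linear in [y], so it can be integrated; [1 - x <= expR (- x)] afterwards restores
    an exponential, now of the mean of [y]. *)
Lemma expRN_le (M y : R) : 0 <= y -> y <= M -> expR (- y) <= 1 - y / (1 + M).
Proof.
move=> y0 yM.
have y1 : 0 < 1 + y by rewrite ltr_wpDr.
have M1 : 0 < 1 + M by rewrite ltr_wpDr// (le_trans y0).
rewrite expRN; apply: (@le_trans _ _ (1 + y)^-1).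
  by rewrite lef_pV2 ?posrE ?expR_gt0// expR_ge1Dx.
have -> : (1 + y)^-1 = 1 - y / (1 + y) by field; rewrite gt_eqF.
by rewrite lerD2l lerN2 ler_wpM2l// lef_pV2 ?posrE// lerD2l.
Qed.

Lemma integral_fine d (T : measurableType d) (mu : probability T R) (f : T -> R) (M : R) :
  measurable_fun setT f -> (forall x, 0 <= f x) -> (forall x, f x <= M) ->
  (\int[mu]_x (f x)%:E = (fine (\int[mu]_x (f x)%:E))%:E)%E.
Proof.
move=> mf f0 fM; rewrite fineK// ge0_fin_numE; last first.
  by apply: integral_ge0 => x _; rewrite lee_fin.
apply: (@le_lt_trans _ _ (\int[mu]_x M%:E)%E).
  apply: ge0_le_integral => //.
  - by move=> x _; rewrite lee_fin.
  - exact/measurable_EFinP.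
  - by move=> x _; rewrite lee_fin.
by rewrite integral_cst//= probability_setT mule1 ltry.
Qed.

Lemma chernoff d (O : measurableType d) (P : probability O R) (Y : O -> R) (M x : R) :
  measurable_fun setT Y -> (\int[P]_w (expR (Y w))%:E <= (expR M)%:E)%E ->
  (P [set w | (M + x <= Y w)%R] <= (expR (- x))%:E)%E.
Proof.
move=> mY hM.
have mA : measurable [set w | M + x <= Y w].
  rewrite (_ : [set w | _] = setT `&` Y @^-1` `[M + x, +oo[%classic).
    exact: mY.
  by rewrite setTI; apply/seteqP; split => w /=; rewrite in_itv/= andbT.
have mE : measurable_fun setT (fun w => (expR (Y w))%:E).
  by apply/measurable_EFinP; exact: measurableT_comp.
rewrite -[X in P X]setIT -integral_indic//.
apply: (@le_trans _ _ (\int[P]_w ((expR (- (M + x)))%:E * (expR (Y w))%:E))%E).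
  apply: ge0_le_integral => //=.
  - exact/measurable_EFinP/measurable_indic.
  - by apply: emeasurable_funM => //; exact: measurable_cst.
  - move=> w _; rewrite -EFinM lee_fin -expRD indicE.
    case: (boolP (w \in _)) => [|_]; last by rewrite expR_ge0.
    by rewrite inE /= => h; rewrite -expR0 ler_expR addrC subr_ge0.
rewrite ge0_integralZl_EFin ?expR_ge0//.
apply: (@le_trans _ _ ((expR (- (M + x)))%:E * (expR M)%:E)%E).
  by rewrite lee_pmul2l// lte_fin expR_gt0.
by rewrite -EFinM lee_fin -expRD opprD addrAC addNr add0r.
Qed.

End Bounds.

(** * Exponential moments of log-likelihood ratios *)

Section LogLik.
Context d (O : measurableType d) (R : realType) (P : probability O R)
  dX (X : measurableType dX) (lamX : probability X R) (N dV : nat)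
  (Xs : 'I_N -> O -> X) (eps : 'I_N -> 'I_dV -> O -> R).

(** The log-likelihood as a function of design and noise under the truth [fs]; [loglik_dataOf]
    identifies it with [loglik] on the generated data. *)
Definition loglik_at (fs g : X -> dV.-tuple R) (w : O) : R :=
  - 2^-1 * \sum_(i < N) \sum_(j < dV)
    (tnth (fs (Xs i w)) j + eps i j w - tnth (g (Xs i w)) j) ^+ 2.

Definition measurable_field (g : X -> dV.-tuple R) :=
  forall j, measurable_fun setT (fun x => tnth (g x) j).

Definition bounded_field (U : R) (g : X -> dV.-tuple R) :=
  forall x, \sum_(j < dV) tnth (g x) j ^+ 2 <= U ^+ 2.

Definition predrisk (g h : X -> dV.-tuple R) : R :=
  fine (\int[lamX]_x (sqdist (g x) (h x))%:E)%E.

Lemma sqdist_ge0 n (a b : n.-tuple R) : 0 <= sqdist a b.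
Proof. by apply: sumr_ge0 => j _; exact: sqr_ge0. Qed.

Lemma sqdistC n (a b : n.-tuple R) : sqdist a b = sqdist b a.
Proof. by apply: eq_bigr => j _; ring. Qed.

Lemma sqdist_tri n (a b c : n.-tuple R) : sqdist a c <= 2 * sqdist a b + 2 * sqdist b c.
Proof.
rewrite /sqdist !mulr_sumr -big_split/=; apply: ler_sum => j _.
rewrite -subr_ge0.
have -> : 2 * (tnth a j - tnth b j) ^+ 2 + 2 * (tnth b j - tnth c j) ^+ 2 -
  (tnth a j - tnth c j) ^+ 2 = (tnth a j - 2 * tnth b j + tnth c j) ^+ 2 by ring.
exact: sqr_ge0.
Qed.

Lemma sqdist_bounded U g h x : bounded_field U g -> bounded_field U h -> sqdist (g x) (h x) <= 4 * U ^+ 2.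
Proof.
move=> /(_ x) bg /(_ x) bh.
have -> : 4 * U ^+ 2 = 2 * U ^+ 2 + 2 * U ^+ 2 by ring.
apply: (@le_trans _ _ (2 * (\sum_(j < dV) tnth (g x) j ^+ 2) +
  2 * (\sum_(j < dV) tnth (h x) j ^+ 2))); last by apply: lerD; rewrite ler_pM2l.
rewrite /sqdist !mulr_sumr -big_split/=; apply: ler_sum => j _.
rewrite -subr_ge0 (_ : _ - _ = (tnth (g x) j + tnth (h x) j) ^+ 2); last by ring.
exact: sqr_ge0.
Qed.

Lemma measurable_sqdist g h : measurable_field g -> measurable_field h ->
  measurable_fun setT (fun x => sqdist (g x) (h x)).
Proof.
move=> mg mh; apply: measurable_sum => j.
by apply: measurable_funX; exact: measurable_funB.
Qed.

Lemma predriskE U g h : measurable_field g -> measurable_field h -> bounded_field U g -> bounded_field U h ->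
  (\int[lamX]_x (sqdist (g x) (h x))%:E = (predrisk g h)%:E)%E.
Proof.
move=> mg mh bg bh; rewrite /predrisk; apply: (@integral_fine _ _ _ _ _ (4 * U ^+ 2)).
- exact: measurable_sqdist.
- by move=> x; exact: sqdist_ge0.
- by move=> x; exact: sqdist_bounded.
Qed.

Lemma predrisk_ge0 g h : 0 <= predrisk g h.
Proof.
by rewrite fine_ge0//; apply: integral_ge0 => x _; rewrite lee_fin sqdist_ge0.
Qed.

Lemma predriskC g h : predrisk g h = predrisk h g.
Proof. by congr fine; apply: eq_integral => x _; rewrite sqdistC. Qed.

Lemma predrisk_tri U g h k : measurable_field g -> measurable_field h -> measurable_field k ->
  bounded_field U g -> bounded_field U h -> bounded_field U k ->
  predrisk g k <= 2 * predrisk g h + 2 * predrisk h k.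
Proof.
move=> mg mh mk bg bh bk; rewrite -lee_fin EFinD !EFinM.
rewrite -!(@predriskE U)// -!ge0_integralZl_EFin//; first last.
- by apply/measurable_EFinP; exact: measurable_sqdist.
- by move=> x _; rewrite lee_fin sqdist_ge0.
- by apply/measurable_EFinP; exact: measurable_sqdist.
- by move=> x _; rewrite lee_fin sqdist_ge0.
rewrite -ge0_integralD//; first last.
- by apply: emeasurable_funM; [exact: measurable_cst|apply/measurable_EFinP; exact: measurable_sqdist].
- by move=> x _; rewrite -EFinM lee_fin mulr_ge0// sqdist_ge0.
- by apply: emeasurable_funM; [exact: measurable_cst|apply/measurable_EFinP; exact: measurable_sqdist].
- by move=> x _; rewrite -EFinM lee_fin mulr_ge0// sqdist_ge0.
apply: ge0_le_integral => //.
- by move=> x _; rewrite lee_fin sqdist_ge0.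
- by apply/measurable_EFinP; exact: measurable_sqdist.
- apply: emeasurable_funD; (apply: emeasurable_funM; [exact: measurable_cst|apply/measurable_EFinP; exact: measurable_sqdist]).
- by move=> x _; rewrite -!EFinM -EFinD lee_fin sqdist_tri.
Qed.

Hypothesis dm : data_model P lamX Xs eps.

Lemma measurable_loglik_at fs g : measurable_field fs -> measurable_field g ->
  measurable_fun setT (loglik_at fs g).
Proof.
case: dm => mXs meps _ _ _ mfs mg.
apply: measurable_funM; first exact: measurable_cst.
apply: measurable_sum => i; apply: measurable_sum => j.
apply: measurable_funX; apply: measurable_funB.
  apply: measurable_funD; last exact: meps.
  exact: (measurableT_comp (mfs j) (mXs i)).
exact: (measurableT_comp (mg j) (mXs i)).
Qed.

(** [expR z <= 1 + expR B * |z|] reduces one observation to the mean of [h], and [1 + x <= expR x]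
    makes the result multiplicative in [N]. The uniform bound [B] and the pointwise bound [h] are
    kept apart because only the mean of [h] has to be small. *)
Lemma data_mgf_le (u : 'I_dV -> X -> R) (q h : X -> R) (B H : R) :
  (forall j, measurable_fun setT (u j)) -> measurable_fun setT q ->
  measurable_fun setT h ->
  (forall x, `|2^-1 * \sum_(j < dV) u j x ^+ 2 + q x| <= B) ->
  (forall x, `|2^-1 * \sum_(j < dV) u j x ^+ 2 + q x| <= h x) ->
  (\int[lamX]_x (h x)%:E <= H%:E)%E ->
  (\int[P]_w (expR (\sum_(i < N) (\sum_(j < dV) eps i j w * u j (Xs i w) + q (Xs i w))))%:E
    <= (expR (N%:R * (expR B * H)))%:E)%E.
Proof.
move=> mu mq mh hB hh hH; rewrite (data_mgf dm mu mq).
have mZ : measurable_fun setT (fun x => 2^-1 * \sum_(j < dV) u j x ^+ 2 + q x).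
  apply: measurable_funD => //; apply: measurable_funM; first exact: measurable_cst.
  by apply: measurable_sum => j; exact: measurable_funX.
rewrite expRM_natl EFin_expe.
suff : (\int[lamX]_x (expR (2^-1 * \sum_(j < dV) u j x ^+ 2 + q x))%:E
    <= (expR (expR B * H))%:E)%E.
  move=> le1; elim: N => [|n IH]; first by rewrite !expe0.
  rewrite !expeS; apply: lee_pmul => //.
  - by apply: integral_ge0 => x _; rewrite lee_fin expR_ge0.
  - by apply: expe_ge0; apply: integral_ge0 => x _; rewrite lee_fin expR_ge0.
apply: (@le_trans _ _ (\int[lamX]_x (1 + (expR B)%:E * (h x)%:E))%E).
  apply: ge0_le_integral => //.
  - by apply/measurable_EFinP; exact: measurableT_comp.
  - apply: emeasurable_funD; first exact: measurable_cst.
    by apply: emeasurable_funM; [exact: measurable_cst|exact/measurable_EFinP].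
  - move=> x _; rewrite -EFinM -EFinD lee_fin.
    apply: (le_trans (expR_le1Dabs (hB x))).
    by rewrite lerD2l ler_wpM2l ?expR_ge0// hh.
have h0 x : 0 <= h x by apply: le_trans (hh x).
rewrite ge0_integralD//; first last.
- by apply: emeasurable_funM; [exact: measurable_cst|exact/measurable_EFinP].
- by move=> x _; rewrite -EFinM lee_fin mulr_ge0// expR_ge0.
rewrite integral_cst//= probability_setT mule1.
rewrite ge0_integralZl_EFin ?expR_ge0//; last 2 first.
- by move=> x _; rewrite lee_fin.
- exact/measurable_EFinP.
apply: (@le_trans _ _ (1 + (expR B)%:E * H%:E)%E).
  by rewrite leeD2l// lee_pmul2l// lte_fin expR_gt0.
by rewrite -EFinM -EFinD lee_fin expR_ge1Dx.
Qed.

Variables (U : R) (fs : X -> dV.-tuple R).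
Hypotheses (mfs : measurable_field fs) (bfs : bounded_field U fs).

(* With [a := g - fs], the noise contributes [|a|^2 / 8] and the drift [- |a|^2 / 4] at
   exponent [1/2], so the expectation is that of [expR (- |a|^2 / 8)]. *)
Lemma mgf_loglik_gain g : measurable_field g -> bounded_field U g ->
  (\int[P]_w (expR (2^-1 * (loglik_at fs g w - loglik_at fs fs w)))%:E <=
   (expR (- (N%:R * (predrisk g fs / (8 * (1 + U ^+ 2 / 2))))))%:E)%E.
Proof.
move=> mg bg.
pose u (j : 'I_dV) x := 2^-1 * (tnth (g x) j - tnth (fs x) j).
pose q x := - 4^-1 * sqdist (g x) (fs x).
have mu j : measurable_fun setT (u j).
  by apply: measurable_funM; [exact: measurable_cst|exact: measurable_funB].
have mq : measurable_fun setT q.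
  by apply: measurable_funM; [exact: measurable_cst|exact: measurable_sqdist].
have -> : (\int[P]_w (expR (2^-1 * (loglik_at fs g w - loglik_at fs fs w)))%:E =
  \int[P]_w (expR (\sum_(i < N) (\sum_(j < dV) eps i j w * u j (Xs i w) + q (Xs i w))))%:E)%E.
  apply: eq_integral => w _; congr ((expR _)%:E).
  rewrite /loglik_at -mulrBr -sumrB !mulr_sumr; apply: eq_bigr => i _.
  rewrite /q /sqdist mulr_sumr -big_split/= -sumrB !mulr_sumr; apply: eq_bigr => j _.
  by rewrite /u; field.
rewrite (data_mgf dm mu mq) -mulrN expRM_natl EFin_expe.
suff : (\int[lamX]_x (expR (2^-1 * \sum_(j < dV) u j x ^+ 2 + q x))%:E
    <= (expR (- (predrisk g fs / (8 * (1 + U ^+ 2 / 2)))))%:E)%E.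
  move=> le1; elim: N => [|n IH]; first by rewrite !expe0.
  rewrite !expeS; apply: lee_pmul => //.
  - by apply: integral_ge0 => x _; rewrite lee_fin expR_ge0.
  - by apply: expe_ge0; apply: integral_ge0 => x _; rewrite lee_fin expR_ge0.
set k := (8 * (1 + U ^+ 2 / 2))^-1.
have U2 : 0 <= U ^+ 2 by exact: sqr_ge0.
have k0 : 0 < k by rewrite invr_gt0 mulr_gt0// ltr_wpDr// divr_ge0.
have E x : expR (2^-1 * \sum_(j < dV) u j x ^+ 2 + q x) = expR (- (sqdist (g x) (fs x) / 8)).
  congr expR; rewrite /q /sqdist !mulr_sumr -big_split/= mulr_suml -sumrN.
  by apply: eq_bigr => j _; rewrite /u; field.
(* [expRN_le] is used with [y = sqdist / 8], and [sqdist <= 4 * U ^+ 2] allows [M = U ^+ 2 / 2];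
   this is the origin of the constant [8 * (1 + U ^+ 2 / 2)]. *)
have S1 x : expR (2^-1 * \sum_(j < dV) u j x ^+ 2 + q x) + k * sqdist (g x) (fs x) <= 1.
  have := @expRN_le R (U ^+ 2 / 2) (sqdist (g x) (fs x) / 8).
  move=> /(_ _ _)/wrap[]; first by rewrite divr_ge0// sqdist_ge0.
    rewrite ler_pdivrMr//; apply: (le_trans (sqdist_bounded x bg bfs)).
    by rewrite le_eqVlt; apply/orP; left; apply/eqP; field.
  rewrite -E -lerBrDr; congr (_ <= _); congr (1 - _).
  by rewrite /k; field; rewrite gt_eqF// ltr_wpDr.
have mS := measurable_sqdist mg mfs.
have mE : measurable_fun setT (fun x => expR (2^-1 * \sum_(j < dV) u j x ^+ 2 + q x)).
  apply: measurableT_comp => //; apply: measurable_funD => //.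
  apply: measurable_funM; first exact: measurable_cst.
  by apply: measurable_sum => j; exact: measurable_funX.
have : (\int[lamX]_x (expR (2^-1 * \sum_(j < dV) u j x ^+ 2 + q x))%:E + (k * predrisk g fs)%:E <= 1%:E)%E.
  rewrite EFinM -(predriskE mg mfs bg bfs) -ge0_integralZl_EFin//; last 3 first.
  - by move=> x _; rewrite lee_fin sqdist_ge0.
  - exact/measurable_EFinP.
  - exact: ltW.
  rewrite -ge0_integralD//; last 3 first.
  - exact/measurable_EFinP.
  - by move=> x _; rewrite -EFinM lee_fin mulr_ge0 ?(ltW k0)// sqdist_ge0.
  - by apply: emeasurable_funM; [exact: measurable_cst|exact/measurable_EFinP].
  apply: (@le_trans _ _ (\int[lamX]_x 1%:E)%E); last first.
    by rewrite integral_cst//= probability_setT mule1.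
  apply: ge0_le_integral => //.
  - by move=> x _; rewrite -EFinM -EFinD lee_fin addr_ge0 ?expR_ge0// mulr_ge0 ?(ltW k0)// sqdist_ge0.
  - apply: emeasurable_funD; first exact/measurable_EFinP.
    by apply: emeasurable_funM; [exact: measurable_cst|exact/measurable_EFinP].
  - by move=> x _; rewrite -EFinM -EFinD lee_fin.
rewrite -leeBrDr// => /le_trans; apply.
rewrite -EFinB lee_fin mulrC; exact: expR_ge1Dx.
Qed.

(* The cross term [t * <g - g', g' - fs>] is split by AM-GM with a free parameter [A]: taking
   [A] large makes the drift [predrisk g' fs / (2 * A)] small enough to be absorbed by the
   gain at the coarsest level. *)
Lemma mgf_loglik_increment (t S A : R) g g' : measurable_field g -> bounded_field U g ->
  measurable_field g' -> bounded_field U g' -> 1 <= t -> 0 < A ->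
  (forall x, t ^+ 2 * sqdist (g x) (g' x) <= S ^+ 2) ->
  (\int[P]_w (expR (t * (loglik_at fs g w - loglik_at fs g' w)))%:E <=
   (expR (N%:R * (expR (S ^+ 2 + 2 * U ^+ 2) *
      ((1 + A) / 2 * (t ^+ 2 * predrisk g g') + predrisk g' fs / (2 * A)))))%:E)%E.
Proof.
move=> mg bg mg' bg' t1 A0 tS.
have t0 : 0 < t by apply: lt_le_trans t1.
pose u (j : 'I_dV) x := t * (tnth (g x) j - tnth (g' x) j).
pose q x := - (t / 2) * (sqdist (g x) (fs x) - sqdist (g' x) (fs x)).
have mu j : measurable_fun setT (u j).
  by apply: measurable_funM; [exact: measurable_cst|exact: measurable_funB].
have mq : measurable_fun setT q.
  by apply: measurable_funM; [exact: measurable_cst|apply: measurable_funB; exact: measurable_sqdist].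
have -> : (\int[P]_w (expR (t * (loglik_at fs g w - loglik_at fs g' w)))%:E =
  \int[P]_w (expR (\sum_(i < N) (\sum_(j < dV) eps i j w * u j (Xs i w) + q (Xs i w))))%:E)%E.
  apply: eq_integral => w _; congr ((expR _)%:E).
  rewrite /loglik_at -mulrBr -sumrB !mulr_sumr; apply: eq_bigr => i _.
  rewrite /q /sqdist -!sumrB !mulr_sumr -big_split/=; apply: eq_bigr => j _.
  by rewrite /u; field.
pose h (A : R) x := (1 + A) / 2 * (t ^+ 2 * sqdist (g x) (g' x)) + sqdist (g' x) (fs x) / (2 * A).
(* Proved for every [A'] because it is used twice: [A' = 1] gives the uniform bound
   [S ^+ 2 + 2 * U ^+ 2], and [A' = A] gives the bound that is integrated. *)
have hh A' x : 0 < A' -> `|2^-1 * \sum_(j < dV) u j x ^+ 2 + q x| <= h A' x.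
  move=> A'0.
  have -> : h A' x = \sum_(j < dV) ((1 + A') / 2 * (t ^+ 2 * (tnth (g x) j - tnth (g' x) j) ^+ 2)
      + (tnth (g' x) j - tnth (fs x) j) ^+ 2 / (2 * A')).
    by rewrite /h /sqdist big_split/= mulr_suml !mulr_sumr.
  rewrite /q /sqdist -sumrB !mulr_sumr -big_split/=.
  apply: (le_trans (ler_norm_sum _ _ _)); apply: ler_sum => j _.
  rewrite /u; set a := tnth (g x) j; set b := tnth (g' x) j; set c := tnth (fs x) j.
  have tt : t <= t ^+ 2 by rewrite expr2 ler_peMr// ltW.
  have -> : 2^-1 * (t * (a - b)) ^+ 2 + - (t / 2) * ((a - c) ^+ 2 - (b - c) ^+ 2) =
    (t ^+ 2 - t) / 2 * (a - b) ^+ 2 - (t * (a - b)) * (b - c) by field.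
  have sq1 : 0 <= (A' * (t * (a - b)) - (b - c)) ^+ 2 / (2 * A').
    by rewrite divr_ge0 ?sqr_ge0// mulr_ge0// ltW.
  have sq2 : 0 <= (A' * (t * (a - b)) + (b - c)) ^+ 2 / (2 * A').
    by rewrite divr_ge0 ?sqr_ge0// mulr_ge0// ltW.
  have E1 : (A' * (t * (a - b)) - (b - c)) ^+ 2 / (2 * A') =
     A' / 2 * (t ^+ 2 * (a - b) ^+ 2) + (b - c) ^+ 2 / (2 * A') - (t * (a - b)) * (b - c).
    by field; rewrite gt_eqF.
  have E2 : (A' * (t * (a - b)) + (b - c)) ^+ 2 / (2 * A') =
     A' / 2 * (t ^+ 2 * (a - b) ^+ 2) + (b - c) ^+ 2 / (2 * A') + (t * (a - b)) * (b - c).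
    by field; rewrite gt_eqF.
  rewrite E1 in sq1; rewrite E2 in sq2.
  have p1 : 0 <= (t ^+ 2 - t) / 2 * (a - b) ^+ 2.
    by rewrite mulr_ge0 ?sqr_ge0// divr_ge0// subr_ge0.
  have p2 : (t ^+ 2 - t) / 2 * (a - b) ^+ 2 <= 2^-1 * (t ^+ 2 * (a - b) ^+ 2).
    rewrite [leRHS]mulrA ler_wpM2r ?sqr_ge0// mulrC ler_pM2l//.
    by rewrite lerBlDr lerDl ltW.
  set X1 := t ^+ 2 * (a - b) ^+ 2 in sq1 sq2 p2 *.
  set X2 := (b - c) ^+ 2 / (2 * A') in sq1 sq2 *.
  set X3 := (t ^+ 2 - t) / 2 * (a - b) ^+ 2 in p1 p2 *.
  set X4 := t * (a - b) * (b - c) in sq1 sq2 *.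
  have -> : (1 + A') / 2 * X1 = 2^-1 * X1 + A' / 2 * X1 by field.
  set X5 := A' / 2 * X1 in sq1 sq2 *.
  by rewrite ler_norml; apply/andP; split; lra.
apply: (@data_mgf_le _ _ (h A)) => //.
- apply: measurable_funD.
    apply: measurable_funM; first exact: measurable_cst.
    apply: measurable_funM; first exact: measurable_cst.
    exact: measurable_sqdist.
  apply: measurable_funM; last exact: measurable_cst.
  exact: measurable_sqdist.
- move=> x; apply: (le_trans (hh 1 x ltr01)); rewrite /h.
  have := tS x; have := sqdist_bounded x bg' bfs.
  set X1 := t ^+ 2 * _; set X2 := sqdist _ _; set X3 := U ^+ 2; set X4 := S ^+ 2.
  by move=> ? ?; lra.
- by move=> x; exact: hh.
have c1 : 0 <= (1 + A) / 2 * t ^+ 2.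
  by rewrite mulr_ge0 ?sqr_ge0// divr_ge0// addr_ge0// ltW.
have c2 : 0 <= (2 * A)^-1 by rewrite invr_ge0 mulr_ge0// ltW.
have hE x : (h A x)%:E = (((1 + A) / 2 * t ^+ 2)%:E * (sqdist (g x) (g' x))%:E +
    ((2 * A)^-1)%:E * (sqdist (g' x) (fs x))%:E)%E.
  by rewrite /h mulrA [X in _ + X]mulrC EFinD (EFinM _ (sqdist _ _)) (EFinM _ (sqdist _ (fs x))).
under eq_integral => x _ do rewrite hE.
have mI (k : R) a b : measurable_field a -> measurable_field b ->
    measurable_fun setT (fun x : X => k%:E * (sqdist (a x) (b x))%:E)%E.
  move=> ma mb; apply: emeasurable_funM; first exact: measurable_cst.
  by apply/measurable_EFinP; exact: measurable_sqdist.
rewrite ge0_integralD//.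
- rewrite !ge0_integralZl_EFin//.
  + rewrite (predriskE mg mg' bg bg') (predriskE mg' mfs bg' bfs) -!EFinM -EFinD lee_fin.
    by rewrite mulrA [X in _ + X]mulrC.
  + by move=> x _; rewrite lee_fin sqdist_ge0.
  + by apply/measurable_EFinP; exact: measurable_sqdist.
  + by move=> x _; rewrite lee_fin sqdist_ge0.
  + by apply/measurable_EFinP; exact: measurable_sqdist.
- by move=> x _; rewrite -EFinM lee_fin mulr_ge0// sqdist_ge0.
- exact: mI.
- by move=> x _; rewrite -EFinM lee_fin mulr_ge0// sqdist_ge0.
- exact: mI.
Qed.

(** For the inverse likelihood ratio the drift no longer offsets the noise: each contributes half of
    the squared distance, and the total is at most [4 * U ^+ 2]. *)
Lemma mgf_loglik_loss g : measurable_field g -> bounded_field U g ->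
  (\int[P]_w (expR (loglik_at fs fs w - loglik_at fs g w))%:E <=
   (expR (N%:R * (expR (4 * U ^+ 2) * predrisk g fs)))%:E)%E.
Proof.
move=> mg bg.
pose u (j : 'I_dV) x := tnth (fs x) j - tnth (g x) j.
pose q x := 2^-1 * sqdist (g x) (fs x).
have mu j : measurable_fun setT (u j) by exact: measurable_funB.
have mq : measurable_fun setT q.
  by apply: measurable_funM; [exact: measurable_cst|exact: measurable_sqdist].
have -> : (\int[P]_w (expR (loglik_at fs fs w - loglik_at fs g w))%:E =
  \int[P]_w (expR (\sum_(i < N) (\sum_(j < dV) eps i j w * u j (Xs i w) + q (Xs i w))))%:E)%E.
  apply: eq_integral => w _; congr ((expR _)%:E).
  rewrite /loglik_at -mulrBr -sumrB !mulr_sumr; apply: eq_bigr => i _.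
  rewrite /q /sqdist mulr_sumr -big_split/= -sumrB !mulr_sumr; apply: eq_bigr => j _.
  by rewrite /u; field.
have E x : 2^-1 * \sum_(j < dV) u j x ^+ 2 + q x = sqdist (g x) (fs x).
  rewrite /q /sqdist !mulr_sumr -big_split/=.
  by apply: eq_bigr => j _; rewrite /u; field.
apply: (@data_mgf_le _ _ (fun x => sqdist (g x) (fs x))) => //.
- exact: measurable_sqdist.
- by move=> x; rewrite E ger0_norm ?sqdist_ge0// sqdist_bounded.
- by move=> x; rewrite E ger0_norm ?sqdist_ge0.
- by rewrite (predriskE mg mfs bg bfs).
Qed.

End LogLik.

Section MeasureBounds.
Context d (O : measurableType d) (R : realType) (P : {measure set O -> \bar R}).

Lemma measure_bigsetU_le (J : Type) (r : seq J) (A : J -> set O) :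
  (forall j, measurable (A j)) ->
  (P (\big[setU/set0]_(j <- r) A j) <= \sum_(j <- r) P (A j))%E.
Proof.
move=> mA; elim: r => [|j r IH]; first by rewrite !big_nil measure0.
rewrite !big_cons; apply: (le_trans (measureU2 _ (mA j) _)).
  by apply: bigsetU_measurable.
by rewrite leeD2l.
Qed.

Lemma measure_bigcup_nd_le (F : nat -> set O) (c : \bar R) :
  (forall n, measurable (F n)) -> (forall n m, (n <= m)%N -> F n `<=` F m) ->
  (forall n, (P (F n) <= c)%E) -> (P (\bigcup_n F n) <= c)%E.
Proof.
move=> mF nd Fc.
have ndF : nondecreasing_seq F by move=> n m nm; apply/subsetPset; exact: nd.
have mU : measurable (\bigcup_n F n) by exact: bigcupT_measurable.
have h := nondecreasing_cvg_mu (mu := P) mF mU ndF.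
rewrite -(cvg_lim _ h)//; apply: lime_le; last by apply: nearW => n; exact: Fc.
by apply/cvg_ex; exists (P (\bigcup_n F n)).
Qed.

End MeasureBounds.

(** * Chaining over dyadic lattices *)

Section Lattice.
Context {R : realType}.

Lemma geometric_sum_le (q : R) B : 0 <= q -> q < 1 ->
  \sum_(j < B) q ^+ j <= (1 - q)^-1.
Proof.
move=> q0 q1; have q1' : 0 < 1 - q by rewrite subr_gt0.
suff -> : \sum_(j < B) q ^+ j = (1 - q ^+ B) / (1 - q).
  by rewrite ler_pdivrMr// mulVf ?gt_eqF// gerBl exprn_ge0.
elim: B => [|B IH]; first by rewrite big_ord0 expr0 subrr mul0r.
by rewrite big_ord_recr/= IH exprS; field; rewrite gt_eqF.
Qed.

(** [(r * j)^2 >= r * j - 1/4] reduces the sum to a geometric one, [expR r >= 1 + r] bounds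
    [1 / (1 - expR (- r))] by [1 + 1 / r], and the factor 2 covers [expR (1/4)]. *)
Lemma gauss_lattice_sum_le (r : R) B : 0 < r ->
  \sum_(j < B) expR (- (r * j%:R) ^+ 2) <= 2 * (1 + r^-1).
Proof.
move=> r0.
have e4 : expR (4^-1) <= 2 :> R.
  have := expR_ge1Dx (- (4^-1) : R); rewrite expRN => h.
  rewrite -[leLHS]invrK -[leRHS]invrK lef_pV2 ?posrE ?invr_gt0 ?expR_gt0//.
  by apply: le_trans h; lra.
have q1 : expR (- r) < 1 by rewrite expR_lt1 oppr_lt0.
have r1 : 0 < 1 + r by rewrite addr_gt0.
apply: (@le_trans _ _ (\sum_(j < B) 2 * expR (- r) ^+ j)).
  apply: ler_sum => j _; rewrite -expRM_natl.
  apply: (@le_trans _ _ (expR 4^-1 * expR (j%:R * - r))); last first.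
    by rewrite ler_wpM2r// expR_ge0.
  rewrite -expRD ler_expR.
  have := sqr_ge0 (r * j%:R - 2^-1).
  have -> : (r * j%:R - 2^-1) ^+ 2 = (r * j%:R) ^+ 2 - r * j%:R + 4^-1 by field.
  by rewrite mulrN (mulrC j%:R); lra.
rewrite -mulr_sumr ler_pM2l//.
apply: (le_trans (geometric_sum_le _ (expR_ge0 _) q1)).
have -> : 1 + r^-1 = (r / (1 + r))^-1 by field; rewrite !gt_eqF.
rewrite lef_pV2 ?posrE ?divr_gt0 ?subr_gt0//.
have -> : r / (1 + r) = 1 - (1 + r)^-1 by field; rewrite gt_eqF.
rewrite lerD2l lerN2 expRN lef_pV2 ?posrE ?expR_gt0//.
exact: expR_ge1Dx.
Qed.

Lemma expr2_le_expR n : 2 ^+ n <= expR n%:R :> R.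
Proof.
elim: n => [|n IH]; first by rewrite expr0 expR0.
rewrite exprS -(natr1 n) expRD [leRHS]mulrC.
apply: ler_pM => //; apply: le_trans (expR_ge1Dx _).
by rewrite (_ : 1 + _ = 2).
Qed.

(** Truncation commutes with dyadic coarsening; therefore the roundings of one coefficient vector at
    successive levels are linked by [parent]. *)
Lemma truncn_half (y : R) : 0 <= y -> Num.truncn y = (Num.truncn (2 * y))./2.
Proof.
move=> y0; have y20 : 0 <= 2 * y by rewrite mulr_ge0.
set j := Num.truncn (2 * y).
have /andP[h1 h2] := truncn_itv y20; rewrite -/j in h1 h2.
apply: truncn_def.
have hj : (j = odd j + (j./2).*2)%N by rewrite odd_double_half.
have hj' : j%:R = (odd j)%:R + 2 * (j./2)%:R :> R.
  by rewrite {1}hj natrD -muln2 natrM mulrC.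
rewrite -(natr1 j) in h2; rewrite -natr1.
have o0 : 0 <= (odd j)%:R :> R by [].
have o1 : (odd j)%:R <= 1 :> R by case: (odd j); rewrite ?lexx.
by apply/andP; split; lra.
Qed.

Lemma half_dist (eta : R) j : 0 <= eta -> `|eta / 2 * j%:R - eta * (j./2)%:R| <= eta / 2.
Proof.
move=> e0; have hj : (j = odd j + (j./2).*2)%N by rewrite odd_double_half.
have hj' : j%:R = (odd j)%:R + 2 * (j./2)%:R :> R.
  by rewrite {1}hj natrD -muln2 natrM mulrC.
rewrite hj' (_ : _ - _ = eta / 2 * (odd j)%:R); last by field.
rewrite ger0_norm ?mulr_ge0 ?divr_ge0//.
by apply: ler_piMr; [rewrite divr_ge0|case: (odd j)].
Qed.

Variables dW DW : nat.
Local Notation I := ('I_dW * 'I_DW)%type.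

Definition mkcoef (f : I -> R) : Coef dW DW :=
  [tuple [tuple f (i, n) | n < DW] | i < dW].

Definition ccoord (c : Coef dW DW) (k : I) : R := Defs.coord c k.1 k.2.

Lemma mkcoefE f k : ccoord (mkcoef f) k = f k.
Proof. by case: k => i n; rewrite /ccoord /Defs.coord !tnth_mktuple. Qed.

(** A squared distance: by orthonormality of the basis it is the squared L^2 distance of the
    corresponding fields (see [L2distE]). *)
Definition cdist (c c' : Coef dW DW) : R := \sum_(k : I) (ccoord c k - ccoord c' k) ^+ 2.

Lemma cdist_ge0 c c' : 0 <= cdist c c'.
Proof. by apply: sumr_ge0 => k _; exact: sqr_ge0. Qed.

Lemma cdistC c c' : cdist c c' = cdist c' c.
Proof. by apply: eq_bigr => k _; ring. Qed.

Definition lattice_pt (eta : R) (m : I -> bool * nat) : Coef dW DW :=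
  mkcoef (fun k => (-1) ^+ (m k).1 * (eta * (m k).2%:R)).

(* Lattice points are coded by (sign, magnitude) and rounded towards zero, so that rounding
   does not increase any weighted norm and the level-[l] rounding is the halved
   level-[l.+1] one. *)
Definition rounding (eta : R) (c : Coef dW DW) (k : I) : bool * nat :=
  (ccoord c k < 0, Num.truncn (`|ccoord c k| / eta)).

Definition parent (m : I -> bool * nat) (k : I) : bool * nat := ((m k).1, (m k).2./2).

Lemma parent_rounding eta c : 0 < eta -> parent (rounding (eta / 2) c) =1 rounding eta c.
Proof.
move=> e0 k; rewrite /parent /rounding/=; congr (_, _).
rewrite [RHS]truncn_half ?divr_ge0// ?ltW//; congr (_./2); congr Num.truncn.
by field; rewrite gt_eqF.
Qed.

Lemma eq_lattice_pt eta m m' : m =1 m' -> lattice_pt eta m = lattice_pt eta m'.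
Proof.
move=> mm; rewrite /lattice_pt; congr mkcoef; apply/funext => k.
by rewrite mm.
Qed.

Lemma rounding_dist eta c k : 0 < eta ->
  `|ccoord c k - ccoord (lattice_pt eta (rounding eta c)) k| <= eta.
Proof.
move=> e0; rewrite mkcoefE /rounding/=.
have := @truncn_itv R (`|ccoord c k| / eta) _.
move=> /(_ _)/wrap[|/andP[]]; first by rewrite divr_ge0// ltW.
set j := Num.truncn _; rewrite ler_pdivlMr// ltr_pdivrMr// -natr1 mulrDl mul1r => h1 h2.
rewrite (mulrC eta); case: ltP => c0 /=.
  rewrite (ltr0_norm c0) in h1 h2; rewrite expr1 mulN1r opprK ler_norml.
  by apply/andP; split; lra.
rewrite (ger0_norm c0) in h1 h2; rewrite expr0 mul1r ler_norml.
by apply/andP; split; lra.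
Qed.

Lemma rounding_sqr eta c k : 0 < eta ->
  ccoord (lattice_pt eta (rounding eta c)) k ^+ 2 <= ccoord c k ^+ 2.
Proof.
move=> e0; rewrite mkcoefE /rounding/=.
have := @truncn_itv R (`|ccoord c k| / eta) _.
move=> /(_ _)/wrap[|/andP[]]; first by rewrite divr_ge0// ltW.
set j := Num.truncn _; rewrite ler_pdivlMr// => h1 _.
rewrite exprMn -signr_odd sqrr_sign mul1r -[leRHS]real_normK ?num_real//.
by rewrite ler_sqr ?nnegrE// mulrC// mulr_ge0// ltW.
Qed.

Lemma cdist_le c c' (e : R) : 0 <= e ->
  (forall k, `|ccoord c k - ccoord c' k| <= e) ->
  cdist c c' <= (dW * DW)%:R * e ^+ 2.
Proof.
move=> e0 h; rewrite /cdist.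
apply: (@le_trans _ _ (\sum_(k : I) e ^+ 2)).
  apply: ler_sum => k _; rewrite -real_normK ?num_real//.
  by rewrite ler_sqr ?nnegrE.
by rewrite sumr_const card_prod !card_ord mulr_natl.
Qed.

Lemma parent_dist eta m k : 0 <= eta ->
  `|ccoord (lattice_pt (eta / 2) m) k - ccoord (lattice_pt eta (parent m)) k| <= eta / 2.
Proof.
move=> e0; rewrite !mkcoefE /parent/= -mulrBr normrM normr_sign mul1r.
exact: half_dist.
Qed.

End Lattice.

(** * Union bound over the lattices and the uniform likelihood bound *)

Section Chaining.
Context d (O : measurableType d) (R : realType) (P : probability O R)
  dX (X : measurableType dX) (lamX : probability X R) (N dV : nat)
  (Xs : 'I_N -> O -> X) (eps : 'I_N -> 'I_dV -> O -> R).
Hypothesis dm : data_model P lamX Xs eps.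
Variables (dW DW : nat) (g : @Coef R dW DW -> X -> dV.-tuple R) (fs : X -> dV.-tuple R).
Variables (U S CG del T A1 Ce s K0 : R) (a : 'I_dW * 'I_DW -> R).
Hypotheses (U0 : 0 <= U) (S0 : 0 <= S).
Hypotheses (mfs : measurable_field fs) (bfs : bounded_field U fs).
Hypotheses (mg : forall c, measurable_field (g c)) (bg : forall c, bounded_field U (g c)).
Hypothesis g_lip : forall c c', predrisk lamX (g c) (g c') <= CG ^+ 2 * cdist c c'.
Hypothesis g_sup : forall c c' x,
  del ^+ 2 * sqdist (g c x) (g c' x) <= S ^+ 2 * cdist c c'.
Hypotheses (del0 : 0 < del) (TE : T = N%:R * del ^+ 2) (T1 : 1 <= T).
Hypotheses (a0 : forall k, 0 < a k) (s0 : 0 < s) (D0 : (0 < dW * DW)%N).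
Hypotheses (DA : (dW * DW)%:R <= A1 * T) (Ce0 : 0 <= Ce) (K00 : 0 <= K0).

(** Normalised so that a lattice cell in dimension [dW * DW] has L^2 diameter [del]. *)
Definition mesh : R := del / Num.sqrt (dW * DW)%:R.
Definition wnorm2 (c : @Coef R dW DW) : R := \sum_(k : 'I_dW * 'I_DW) a k * ccoord c k ^+ 2.

Hypothesis entropy :
  \prod_(k : 'I_dW * 'I_DW) (1 + (Num.sqrt (s * T * a k) * mesh)^-1) <= expR (Ce * T).

Definition level_mesh l : R := mesh / 2 ^+ l.
(** [2 * A1] pays for the powers of 2 in the count of lattice points, [Ce] for the entropy product
    and [1] for summability over levels; [K0] is the exponent left for the probability. *)
Definition chain_const : R := 2 * A1 + Ce + 1 + K0.
Definition gain_rate : R := (1 + U ^+ 2 / 2)^-1.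
Definition incr_weight : R := expR (S ^+ 2 + 2 * U ^+ 2).
(** The free parameter [A] of [mgf_loglik_increment]. With this value the drifts of all levels
    together cost [gain_rate / 16] times [N%:R * risk c], half of the [gain_rate / 8] obtained in
    [good_base]. *)
Definition incr_balance : R := 32 * incr_weight / gain_rate.
(** In order: moving the level-0 risk back to [c]; the level penalties, 2 at level 0 and 6 along the
    chain; the increments; the remainder [T] of [loglik_limit]. *)
Definition unif_const : R := gain_rate / 4 * CG ^+ 2 + 8 * chain_const +
  2 * incr_weight * ((1 + incr_balance) / 2 + incr_balance^-1) * CG ^+ 2 + 1.

Notation node l m := (@lattice_pt R dW DW (level_mesh l) m).
Notation risk c := (predrisk lamX (g c) fs).
Notation ll h := (loglik_at Xs eps fs h).

(* The Gaussian part of the penalty makes the union bound over the infinite lattice summable;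
   this takes the place of an entropy bound on Sobolev ellipsoids and of a peeling
   argument. *)
Definition penal l m : R := s * T * wnorm2 (node l m) + l.+1%:R * chain_const * T.

(** Each threshold is the logarithm of the matching moment bound plus [penal], so that Chernoff's
    inequality gives probability at most [expR (- penal l m)]. The step from level [l'] to [l'.+1]
    is taken at exponent [2 ^+ l']. *)
Definition bad_node l (m : 'I_dW * 'I_DW -> bool * nat) : set O :=
  match l with
  | 0%N => [set w | - (N%:R * (risk (node 0%N m) / (8 * (1 + U ^+ 2 / 2)))) + penal 0%N m
              <= 2^-1 * (ll (g (node 0%N m)) w - ll fs w)]
  | l'.+1 => [set w | N%:R * (incr_weight * ((1 + incr_balance) / 2 *
       ((2 ^+ l') ^+ 2 * predrisk lamX (g (node l'.+1 m)) (g (node l' (parent m))))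
         + risk (node l' (parent m)) / (2 * incr_balance))) + penal l'.+1 m
       <= 2 ^+ l' * (ll (g (node l'.+1 m)) w - ll (g (node l' (parent m))) w)]
  end.

Lemma mesh_gt0 : 0 < mesh.
Proof. by rewrite divr_gt0// sqrtr_gt0 ltr0n. Qed.

Lemma mesh_sqr : (dW * DW)%:R * mesh ^+ 2 = del ^+ 2.
Proof.
rewrite /mesh expr_div_n sqr_sqrtr// mulrC divfK//.
by rewrite pnatr_eq0 -lt0n.
Qed.

Lemma level_mesh_gt0 l : 0 < level_mesh l.
Proof. by rewrite divr_gt0 ?mesh_gt0// exprn_gt0. Qed.

Lemma level_meshS l : level_mesh l.+1 = level_mesh l / 2.
Proof. by rewrite /level_mesh exprSr invfM mulrA. Qed.

Lemma gain_rate_gt0 : 0 < gain_rate.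
Proof. by rewrite invr_gt0 ltr_wpDr// divr_ge0// sqr_ge0. Qed.

Lemma incr_weight_gt0 : 0 < incr_weight. Proof. exact: expR_gt0. Qed.

Lemma incr_balance_gt0 : 0 < incr_balance.
Proof. by rewrite divr_gt0 ?gain_rate_gt0// mulr_gt0 ?incr_weight_gt0. Qed.

Lemma T_gt0 : 0 < T. Proof. exact: lt_le_trans T1. Qed.

Lemma A1_ge0 : 0 <= A1.
Proof. by rewrite -(pmulr_lge0 _ T_gt0); apply: le_trans DA. Qed.

Lemma wnorm2_ge0 c : 0 <= wnorm2 c.
Proof. by apply: sumr_ge0 => k _; rewrite mulr_ge0 ?sqr_ge0// ltW. Qed.

Lemma cdist_parent l m : cdist (node l.+1 m) (node l (parent m)) <= del ^+ 2 / (2 ^+ l) ^+ 2.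
Proof.
apply: le_trans (cdist_le (e := level_mesh l / 2) _ _) _.
- by rewrite divr_ge0// ltW// level_mesh_gt0.
- move=> k; rewrite level_meshS; apply: parent_dist.
  by rewrite ltW// level_mesh_gt0.
have := mesh_sqr; rewrite /level_mesh => <-.
rewrite -[leRHS]mulrA -expr_div_n ler_wpM2l// [leLHS]expr_div_n ler_pdivrMr ?exprn_gt0//.
by rewrite ler_peMr ?sqr_ge0// exprn_ege1// ?ler1n.
Qed.

Lemma cdist_rounding l c : cdist c (node l (rounding (level_mesh l) c)) <= del ^+ 2 / (2 ^+ l) ^+ 2.
Proof.
apply: le_trans (cdist_le (e := level_mesh l) _ _) _.
- by rewrite ltW// level_mesh_gt0.
- by move=> k; apply: rounding_dist; rewrite level_mesh_gt0.
by have := mesh_sqr; rewrite /level_mesh => <-; rewrite expr_div_n mulrA.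
Qed.

Lemma measurable_bad_node l m : measurable (bad_node l m).
Proof.
have mle (x : R) (f : O -> R) : measurable_fun setT f -> measurable [set w | x <= f w].
  move=> mf; rewrite (_ : [set w | _] = setT `&` f @^-1` `[x, +oo[%classic).
    exact: mf.
  by rewrite setTI; apply/seteqP; split => w /=; rewrite in_itv/= andbT.
have mdiff h h' (t : R) : measurable_field h -> measurable_field h' ->
    measurable_fun setT (fun w => t * (ll h w - ll h' w)).
  move=> mh mh'; apply: measurable_funM; first exact: measurable_cst.
  by apply: measurable_funB; apply: (measurable_loglik_at dm).
by case: l => [|l]; apply: mle; apply: mdiff.
Qed.

Lemma bad_node_prob l m : (P (bad_node l m) <= (expR (- penal l m))%:E)%E.
Proof.
have mdiff h h' (t : R) : measurable_field h -> measurable_field h' ->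
    measurable_fun setT (fun w => t * (ll h w - ll h' w)).
  move=> mh mh'; apply: measurable_funM; first exact: measurable_cst.
  by apply: measurable_funB; apply: (measurable_loglik_at dm).
case: l => [|l]; apply: chernoff.
- exact: mdiff.
- exact: (mgf_loglik_gain dm).
- exact: mdiff.
- apply: (mgf_loglik_increment dm) => //.
  + by rewrite exprn_ege1// ?ler1n.
  + exact: incr_balance_gt0.
  + move=> x; have h := g_sup (node l.+1 m) (node l (parent m)) x.
    have d2 : 0 < del ^+ 2 by rewrite exprn_gt0.
    rewrite -(ler_pM2l d2) mulrCA.
    have t2 : 0 < (2 ^+ l) ^+ 2 :> R by rewrite !exprn_gt0.
    apply: (@le_trans _ _ ((2 ^+ l) ^+ 2 * (S ^+ 2 * (del ^+ 2 / (2 ^+ l) ^+ 2)))).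
      rewrite ler_pM2l//; apply: (le_trans h); apply: ler_wpM2l; first exact: sqr_ge0.
      exact: cdist_parent.
    rewrite le_eqVlt; apply/orP; left; apply/eqP; field.
    by rewrite expf_neq0// ?pnatr_eq0.
Qed.

Definition box B (m : {ffun 'I_dW * 'I_DW -> bool * 'I_B}) (k : 'I_dW * 'I_DW) : bool * nat :=
  ((m k).1, nat_of_ord (m k).2).

(** The Gaussian penalty is additive over coordinates, so the sum over lattice points is a product
    of one-dimensional sums. The product is [expR] of [O(l T)], which the linear growth of [penal]
    in [l] dominates. *)
Lemma level_sum l B :
  \sum_(m : {ffun 'I_dW * 'I_DW -> bool * 'I_B}) expR (- penal l (box m))
    <= 2 ^- l.+1 * expR (- (K0 * T)).
Proof.
pose r k := Num.sqrt (s * T * a k) * mesh.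
have r0 k : 0 < r k.
  by rewrite mulr_gt0 ?mesh_gt0// sqrtr_gt0 !mulr_gt0// T_gt0.
have rE k (j : nat) : s * T * (a k * (level_mesh l * j%:R) ^+ 2) = (r k / 2 ^+ l * j%:R) ^+ 2.
  rewrite /r /level_mesh !exprMn sqr_sqrtr; last by rewrite !mulr_ge0// ltW// ?T_gt0.
  by ring.
have -> : \sum_(m : {ffun 'I_dW * 'I_DW -> bool * 'I_B}) expR (- penal l (box m)) =
  expR (- (l.+1%:R * chain_const * T)) *
  \prod_(k : 'I_dW * 'I_DW) \sum_(z : bool * 'I_B) expR (- (r k / 2 ^+ l * z.2%:R) ^+ 2).
  rewrite bigA_distr_bigA/= mulr_sumr; apply: eq_bigr => m _.
  rewrite -expR_sum -expRD; congr expR.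
  rewrite /penal opprD addrC; congr (_ + _).
  rewrite /wnorm2 mulr_sumr -sumrN; apply: eq_bigr => k _.
  rewrite mkcoefE /box/= exprMn -signr_odd sqrr_sign mul1r rE.
  by [].
(* One factor 2 counts the signs, one comes from [gauss_lattice_sum_le], and [2 ^+ l] from the finer
   mesh. *)
have bound k : \sum_(z : bool * 'I_B) expR (- (r k / 2 ^+ l * z.2%:R) ^+ 2) <=
   2 ^+ (l + 2) * (1 + (r k)^-1).
  rewrite -(pair_bigA _ (fun (b : bool) (j : 'I_B) => expR (- (r k / 2 ^+ l * j%:R) ^+ 2)))/=.
  rewrite big_bool/= -mulr2n -[leLHS]mulr_natl.
  have t0 : 0 < 2 ^+ l :> R by rewrite exprn_gt0.
  have t1 : 1 <= 2 ^+ l :> R by rewrite exprn_ege1// ?ler1n.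
  apply: (@le_trans _ _ (2 * (2 * (1 + (r k / 2 ^+ l)^-1)))).
    by rewrite ler_pM2l//; apply: gauss_lattice_sum_le; rewrite divr_gt0.
  have -> : 2 ^+ (l + 2) * (1 + (r k)^-1) = 2 * (2 * (2 ^+ l + (r k / 2 ^+ l)^-1)).
    by rewrite exprD invf_div; ring.
  by rewrite !ler_pM2l// lerD2r.
have b0 k : 0 <= \sum_(z : bool * 'I_B) expR (- (r k / 2 ^+ l * z.2%:R) ^+ 2).
  by apply: sumr_ge0 => z _; exact: expR_ge0.
have prodb : \prod_(k : 'I_dW * 'I_DW) \sum_(z : bool * 'I_B) expR (- (r k / 2 ^+ l * z.2%:R) ^+ 2)
   <= expR ((l + 2)%:R * (A1 * T)) * expR (Ce * T).
  apply: (@le_trans _ _ (\prod_(k : 'I_dW * 'I_DW) (2 ^+ (l + 2) * (1 + (r k)^-1)))).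
    by apply: ler_prod => k _; rewrite b0 bound.
  rewrite big_split/=; apply: ler_pM => //.
  - by apply: prodr_ge0 => k _; rewrite exprn_ge0.
  - by apply: prodr_ge0 => k _; rewrite addr_ge0// invr_ge0 ltW.
  - rewrite prodr_const card_prod !card_ord -exprM.
    apply: (le_trans (expr2_le_expR _)); rewrite ler_expR natrM.
    by rewrite ler_wpM2l.
apply: (@le_trans _ _ (expR (- (l.+1%:R * chain_const * T)) * (expR ((l + 2)%:R * (A1 * T)) * expR (Ce * T)))).
  by rewrite ler_wpM2l// expR_ge0.
rewrite -!expRD.
apply: (@le_trans _ _ (expR (- l.+1%:R) * expR (- (K0 * T)))); last first.
  rewrite ler_wpM2r ?expR_ge0// expRN lef_pV2 ?posrE ?expR_gt0 ?exprn_gt0//.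
  exact: expr2_le_expR.
rewrite -expRD ler_expR natrD -natr1 /chain_const.
have l0 : 0 <= l%:R :> R by [].
have TT := T_gt0; have AA := A1_ge0.
have p1 : 0 <= l%:R * A1 * T by rewrite !mulr_ge0// ltW.
have p2 : 0 <= l%:R * Ce * T by rewrite !mulr_ge0// ltW.
have p3 : 0 <= l%:R * K0 * T by rewrite !mulr_ge0// ltW.
have p4 : 0 <= l%:R * (T - 1) by rewrite mulr_ge0// subr_ge0.
have p5 := T1.
rewrite -subr_ge0.
have -> : - (l%:R + 1) + - (K0 * T) -
   (- ((l%:R + 1) * (2 * A1 + Ce + 1 + K0) * T) + ((l%:R + 2) * (A1 * T) + Ce * T)) =
   l%:R * A1 * T + l%:R * Ce * T + l%:R * K0 * T + l%:R * (T - 1) + (T - 1) by ring.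
have p6 : 0 <= T - 1 by rewrite subr_ge0.
apply: addr_ge0 => //; apply: addr_ge0 => //.
by apply: addr_ge0 => //; exact: addr_ge0.
Qed.

(** Levels and magnitudes are both cut at [B], which keeps the union bound a finite sum; as [B]
    grows these events increase to [bad_event]. *)
Definition bad_box B : set O := \big[setU/set0]_(l < B)
  \big[setU/set0]_(m : {ffun 'I_dW * 'I_DW -> bool * 'I_B}) bad_node l (box m).

Definition bad_event : set O := \bigcup_B bad_box B.

Lemma bad_boxP B w : bad_box B w <->
  exists2 l, (l < B)%N & exists2 m, (forall k, (m k).2 < B)%N & bad_node l m w.
Proof.
rewrite /bad_box -bigcup_seq; split.
  move=> [l _ /=]; rewrite -bigcup_seq => -[m _ h].
  exists (val l); first exact: ltn_ord.
  exists (box m); last exact: h.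
  by move=> k; exact: ltn_ord.
move=> [l lB [m mB h]]; exists (Ordinal lB) => /=; first by rewrite mem_index_enum.
rewrite -bigcup_seq.
exists [ffun k => ((m k).1, Ordinal (mB k))] => /=; first by rewrite mem_index_enum.
rewrite (_ : box _ = m)//; apply/funext => k.
by rewrite /box ffunE/=; case: (m k).
Qed.

Lemma measurable_bad_box B : measurable (bad_box B).
Proof.
apply: bigsetU_measurable => l _; apply: bigsetU_measurable => m _.
exact: measurable_bad_node.
Qed.

Lemma measurable_bad_event : measurable bad_event.
Proof. by apply: bigcupT_measurable => B; exact: measurable_bad_box. Qed.

Lemma bad_event_prob : (P bad_event <= (expR (- (K0 * T)))%:E)%E.
Proof.
apply: measure_bigcup_nd_le.
- exact: measurable_bad_box.
- move=> n m nm w /bad_boxP[l ln [z zn h]]; apply/bad_boxP.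
  exists l; first exact: leq_trans nm.
  by exists z => // k; exact: leq_trans nm.
move=> B; apply: (le_trans (measure_bigsetU_le _ _ _)).
  by move=> l; apply: bigsetU_measurable => m _; exact: measurable_bad_node.
apply: (@le_trans _ _ (\sum_(l < B) (2 ^- l.+1 * expR (- (K0 * T)))%:E)%E).
  apply: lee_sum => l _; apply: (le_trans (measure_bigsetU_le _ _ _)).
    by move=> m; exact: measurable_bad_node.
  apply: (@le_trans _ _ (\sum_(m : {ffun 'I_dW * 'I_DW -> bool * 'I_B})
     (expR (- penal l (box m)))%:E)%E).
    by apply: lee_sum => m _; exact: bad_node_prob.
  by rewrite sumEFin lee_fin level_sum.
rewrite sumEFin lee_fin -mulr_suml -[leRHS]mul1r ler_wpM2r ?expR_ge0//.
have := @geometric_sum_le R 2^-1 B; rewrite invr_ge0 => /(_ _ _)/wrap[]//.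
  by rewrite invf_lt1// ltr1n.
move=> h; apply: (@le_trans _ _ (2^-1 * \sum_(j < B) (2^-1 : R) ^+ j)).
  by rewrite mulr_sumr; apply: ler_sum => j _; rewrite -exprVn exprS.
apply: (@le_trans _ _ (2^-1 * (1 - 2^-1)^-1)); first by rewrite ler_pM2l// invr_gt0.
by rewrite le_eqVlt; apply/orP; left; apply/eqP; field.
Qed.

Lemma not_bad_node w l m : ~ bad_event w -> ~ bad_node l m w.
Proof.
move=> nb h; apply: nb.
pose M := (\max_(k : 'I_dW * 'I_DW) (m k).2)%N.
exists (maxn l M).+1 => //; apply/bad_boxP; exists l; first by rewrite ltnS leq_maxl.
exists m => // k; rewrite ltnS; apply: leq_trans (leq_maxr _ _).
exact: (leq_bigmax k).
Qed.

Notation rounded l c := (node l (rounding (level_mesh l) c)).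

Lemma wnorm2_rounding l c : wnorm2 (rounded l c) <= wnorm2 c.
Proof.
apply: ler_sum => k _; apply: ler_wpM2l; first exact: ltW.
by apply: rounding_sqr; exact: level_mesh_gt0.
Qed.

Lemma risk_tri c c' : risk c <= 2 * risk c' + 2 * (CG ^+ 2 * cdist c c').
Proof.
apply: (le_trans (predrisk_tri lamX (mg c) (mg c') mfs (bg c) (bg c') bfs)).
by rewrite addrC lerD2l ler_pM2l.
Qed.

Lemma cdist_rounding_le l c : cdist c (rounded l c) <= del ^+ 2.
Proof.
apply: (le_trans (cdist_rounding l c)); rewrite ler_pdivrMr ?exprn_gt0//.
by rewrite ler_peMr ?sqr_ge0// exprn_ege1// exprn_ege1// ?ler1n.
Qed.

Lemma penal_rounding l c : penal l (rounding (level_mesh l) c) <=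
  s * T * wnorm2 c + l.+1%:R * chain_const * T.
Proof.
rewrite lerD2r ler_wpM2l//; last exact: wnorm2_rounding.
by rewrite mulr_ge0// ltW// T_gt0.
Qed.

(** Undoing the exponent 1/2 doubles gain and penalty at the rounded point. The triangle inequality
    then moves the risk to [c]: it halves the gain to [gain_rate / 8] and adds a multiple of
    [CG ^+ 2 * T], the price of a rounding by at most [del]. *)
Lemma good_base w c : ~ bad_event w ->
  ll (g (rounded 0%N c)) w - ll fs w <= - (gain_rate / 8 * (N%:R * risk c)) + gain_rate / 4 * (CG ^+ 2 * T)
    + 2 * (s * T * wnorm2 c + chain_const * T).
Proof.
move=> /(@not_bad_node _ 0%N (rounding (level_mesh 0) c))/= /negP.
rewrite -ltNge => h.
have h2 := penal_rounding 0 c; rewrite mul1r in h2.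
have h3 := risk_tri c (rounded 0%N c).
have h4 : N%:R * risk c <= 2 * (N%:R * risk (rounded 0%N c)) + 2 * (CG ^+ 2 * T).
  rewrite TE; apply: (@le_trans _ _ (N%:R * (2 * risk (rounded 0%N c) + 2 * (CG ^+ 2 * del ^+ 2)))).
    rewrite ler_wpM2l//; apply: (le_trans h3); rewrite lerD2l ler_pM2l//.
    by rewrite ler_wpM2l ?sqr_ge0// cdist_rounding_le.
  by rewrite le_eqVlt; apply/orP; left; apply/eqP; ring.
have E : N%:R * (risk (rounded 0%N c) / (8 * (1 + U ^+ 2 / 2))) = gain_rate / 8 * (N%:R * risk (rounded 0%N c)).
  by rewrite /gain_rate invfM; ring.
rewrite E in h.
have k0 := gain_rate_gt0.
have h5 : gain_rate / 8 * (N%:R * risk c) <= gain_rate / 8 * (2 * (N%:R * risk (rounded 0%N c)) + 2 * (CG ^+ 2 * T)).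
  by rewrite ler_wpM2l// divr_ge0// ltW.
move: h h2 h5; set L := ll _ _ - _.
set x := N%:R * risk (rounded 0%N c); set y := N%:R * risk c.
set z := CG ^+ 2 * T; set p := penal _ _; set q := _ + chain_const * T.
move=> h h2 h5.
have E1 : gain_rate / 8 * (2 * x + 2 * z) = 2 * (gain_rate / 8 * x) + gain_rate / 4 * z by field.
rewrite E1 in h5; lra.
Qed.

Definition chain_step c : R :=
  incr_weight * ((1 + incr_balance) / 2 * (CG ^+ 2 * T) + (N%:R * risk c + CG ^+ 2 * T) / incr_balance)
  + s * T * wnorm2 c.

Lemma good_step w c l : ~ bad_event w ->
  ll (g (rounded l.+1 c)) w - ll (g (rounded l c)) w <=
   2 ^- l * (chain_step c + l.+2%:R * (chain_const * T)).
Proof.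
move=> /(@not_bad_node _ l.+1 (rounding (level_mesh l.+1) c))/= /negP.
(* The roundings are nested, so the increment along the chain is exactly the one controlled by
   [bad_node] at level [l.+1]. *)
have -> : node l (parent (rounding (level_mesh l.+1) c)) = rounded l c.
  by apply: eq_lattice_pt; rewrite level_meshS; apply: parent_rounding; exact: level_mesh_gt0.
have cd : cdist (rounded l.+1 c) (rounded l c) <= del ^+ 2 / (2 ^+ l) ^+ 2.
  have <- : node l (parent (rounding (level_mesh l.+1) c)) = rounded l c.
    by apply: eq_lattice_pt; rewrite level_meshS; apply: parent_rounding; exact: level_mesh_gt0.
  exact: cdist_parent.
have t0 : 0 < 2 ^+ l :> R by rewrite exprn_gt0.
have t20 : 0 < (2 ^+ l) ^+ 2 :> R by rewrite exprn_gt0.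
rewrite -ltNge => h; rewrite -(ler_pM2l t0) [leRHS]mulrA mulfV ?gt_eqF// mul1r.
apply: (le_trans (ltW h)).
have h2 := penal_rounding l.+1 c.
have N0 : 0 <= N%:R :> R by [].
have i1 : (2 ^+ l) ^+ 2 * predrisk lamX (g (rounded l.+1 c)) (g (rounded l c)) <= CG ^+ 2 * del ^+ 2.
  apply: (@le_trans _ _ ((2 ^+ l) ^+ 2 * (CG ^+ 2 * (del ^+ 2 / (2 ^+ l) ^+ 2)))).
    rewrite ler_pM2l//; apply: (le_trans (g_lip _ _)).
    by rewrite ler_wpM2l ?sqr_ge0.
  by rewrite le_eqVlt; apply/orP; left; apply/eqP; field; rewrite expf_neq0// ?pnatr_eq0.
have i2 : risk (rounded l c) <= 2 * (risk c + CG ^+ 2 * del ^+ 2).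
  apply: (le_trans (risk_tri (rounded l c) c)); rewrite -mulrDr ler_pM2l// lerD2l.
  by rewrite cdistC ler_wpM2l ?sqr_ge0// cdist_rounding_le.
rewrite /chain_step -addrA lerD//; last by rewrite [X in _ + X]mulrA.
have A0 := incr_balance_gt0.
apply: (@le_trans _ _ (N%:R * (incr_weight * ((1 + incr_balance) / 2 * (CG ^+ 2 * del ^+ 2) +
   (2 * (risk c + CG ^+ 2 * del ^+ 2)) / (2 * incr_balance))))).
  rewrite ler_wpM2l// ler_wpM2l ?(ltW incr_weight_gt0)//; apply: lerD.
    by rewrite ler_wpM2l// divr_ge0// addr_ge0// ltW.
  by rewrite ler_wpM2r// invr_ge0 mulr_ge0// ltW.
rewrite TE le_eqVlt; apply/orP; left; apply/eqP; field.
by rewrite gt_eqF.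
Qed.

(** The coefficients are the exact partial sums of [2 ^- j] and [j.+2 * 2 ^- j] over [j < l]; in
    closed form the induction step is an identity. *)
Lemma good_chain w c l : ~ bad_event w ->
  ll (g (rounded l c)) w - ll (g (rounded 0%N c)) w <=
   2 * (1 - 2 ^- l) * chain_step c + (6 - (2 * l%:R + 6) * 2 ^- l) * (chain_const * T).
Proof.
move=> nb; elim: l => [|l IH].
  by rewrite expr0 le_eqVlt; apply/orP; left; apply/eqP; field.
have := good_step c l nb.
have t0 : 2 ^+ l != 0 :> R by rewrite gt_eqF// exprn_gt0.
set L0 := ll (g (rounded 0%N c)) w in IH *; set L1 := ll (g (rounded l c)) w in IH *.
set L2 := ll (g (rounded l.+1 c)) w; move=> h.
have -> : L2 - L0 = (L1 - L0) + (L2 - L1) by ring.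
apply: (le_trans (lerD IH h)).
rewrite exprS invfM -(natr1 l.+1) -(natr1 l) le_eqVlt; apply/orP; left; apply/eqP.
by field.
Qed.

(* The sup-norm bound on increments makes the level-[l] remainder [O(2 ^- l)], with a constant
   that may depend on the outcome [w]. *)
Lemma loglik_limit w c : exists l, ll (g c) w - ll (g (rounded l c)) w <= T.
Proof.
pose M := \sum_(i < N) \sum_(j < dV) S * (`|tnth (fs (Xs i w)) j + eps i j w| + U).
have M0 : 0 <= M by apply: sumr_ge0 => i _; apply: sumr_ge0 => j _; rewrite mulr_ge0// addr_ge0.
have bnd h x j : bounded_field U h -> `|tnth (h x) j| <= U.
  move=> /(_ x) bh; rewrite -ler_sqr ?nnegrE// real_normK ?num_real//.
  apply: le_trans bh; rewrite (bigD1 j)//= lerDl.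
  by apply: sumr_ge0 => k _; exact: sqr_ge0.
(* [M < l.+1 <= 2 ^+ l] and [1 <= T] put the remainder [M / 2 ^+ l] below [T]. *)
exists (Num.truncn M).
set l := Num.truncn M.
apply: (@le_trans _ _ (M / 2 ^+ l)); last first.
  apply: le_trans T1; rewrite ler_pdivrMr ?exprn_gt0// mul1r.
  have : M < l.+1%:R by exact: truncnS_gt.
  move=> /ltW/le_trans; apply; rewrite -natrX ler_nat; exact: ltn_expl.
rewrite /loglik_at -mulrBr -sumrB mulr_sumr mulr_suml; apply: ler_sum => i _.
rewrite -sumrB mulr_sumr mulr_suml; apply: ler_sum => j _.
set y := _ + eps i j w; set b := tnth (g c _) j; set b' := tnth (g (rounded l c) _) j.
have hb : `|b| <= U by exact: bnd.
have hb' : `|b'| <= U by exact: bnd.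
have t0 : 0 < 2 ^+ l :> R by rewrite exprn_gt0.
have hbb : `|b - b'| <= S / 2 ^+ l.
  rewrite -ler_sqr ?nnegrE ?divr_ge0 ?(ltW t0)// real_normK ?num_real//.
  have d2 : 0 < del ^+ 2 by rewrite exprn_gt0.
  rewrite -(ler_pM2l d2).
  apply: (@le_trans _ _ (del ^+ 2 * sqdist (g c (Xs i w)) (g (rounded l c) (Xs i w)))).
    rewrite ler_pM2l// /sqdist (bigD1 j)//= lerDl.
    by apply: sumr_ge0 => k _; exact: sqr_ge0.
  apply: (le_trans (g_sup _ _ _)); rewrite expr_div_n mulrCA.
  by rewrite ler_wpM2l ?sqr_ge0// cdist_rounding.
have -> : - 2^-1 * ((y - b) ^+ 2 - (y - b') ^+ 2) = 2^-1 * ((b - b') * (2 * y - b - b')) by field.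
apply: (@le_trans _ _ (2^-1 * (S / 2 ^+ l * (2 * `|y| + U + U)))).
  rewrite ler_pM2l//; apply: (le_trans (ler_norm _)); rewrite normrM.
  apply: ler_pM => //.
  apply: (le_trans (ler_normB _ _)); apply: lerD => //.
  apply: (le_trans (ler_normB _ _)); apply: lerD => //.
  by rewrite normrM ger0_norm.
by rewrite le_eqVlt; apply/orP; left; apply/eqP; field; rewrite expf_neq0// ?pnatr_eq0.
Qed.

(** The level supplied by [loglik_limit] depends on [w], but the chain bound is uniform in the
    level, so no constant depends on the outcome. *)
Theorem uniform_loglik_bound w c : ~ bad_event w ->
  ll (g c) w - ll fs w <= - (gain_rate / 16 * (N%:R * risk c)) + T * (unif_const + 4 * s * wnorm2 c).
Proof.
move=> nb; have [l hl] := loglik_limit w c.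
have h0 := good_base c nb; have h1 := good_chain c l nb.
have CT : 0 <= chain_const * T.
  by rewrite mulr_ge0// ?(ltW T_gt0)// /chain_const !addr_ge0// mulr_ge0// A1_ge0.
have A0 := incr_balance_gt0. have B0 := incr_weight_gt0. have k0 := gain_rate_gt0.
have r0 : 0 <= N%:R * risk c by rewrite mulr_ge0// predrisk_ge0.
have z0 : 0 <= CG ^+ 2 * T by rewrite mulr_ge0 ?sqr_ge0// ltW// T_gt0.
have E0 : 0 <= chain_step c.
  rewrite addr_ge0//; last by rewrite !mulr_ge0// ?wnorm2_ge0// ltW// T_gt0.
  rewrite mulr_ge0 ?(ltW B0)// addr_ge0//.
    by rewrite mulr_ge0// divr_ge0// addr_ge0// ltW.
  by rewrite divr_ge0 ?(ltW A0)// addr_ge0.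
have q0 : 0 < (2 ^+ l)^-1 :> R by rewrite invr_gt0 exprn_gt0.
have h2 : 2 * (1 - 2 ^- l) * chain_step c + (6 - (2 * l%:R + 6) * 2 ^- l) * (chain_const * T)
   <= 2 * chain_step c + 6 * (chain_const * T).
  apply: lerD; rewrite ler_wpM2r//.
    by rewrite -[leRHS]mulr1 ler_pM2l// lerBlDr lerDl ltW.
  by rewrite lerBlDr lerDl mulr_ge0 ?(ltW q0)// addr_ge0// mulr_ge0.
have h1' := le_trans h1 h2.
have -> : ll (g c) w - ll fs w = (ll (g c) w - ll (g (rounded l c)) w) +
   (ll (g (rounded l c)) w - ll (g (rounded 0%N c)) w) + (ll (g (rounded 0%N c)) w - ll fs w) by ring.
apply: (le_trans (lerD (lerD hl h1') h0)).
have EA : incr_weight * (N%:R * risk c / incr_balance) = gain_rate / 32 * (N%:R * risk c).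
  by rewrite /incr_balance; field; rewrite !gt_eqF.
have -> : chain_step c = gain_rate / 32 * (N%:R * risk c) +
   incr_weight * ((1 + incr_balance) / 2 + incr_balance^-1) * (CG ^+ 2 * T) + s * T * wnorm2 c.
  by rewrite -EA /chain_step; ring.
rewrite le_eqVlt; apply/orP; left; apply/eqP; rewrite /unif_const.
by field; rewrite gt_eqF.
Qed.

End Chaining.

(** * Gaussian prior and posterior mass *)

Section GaussianPrior.
Context {R : realType}.

Lemma pi_le8 : pi <= 8 :> R.
Proof. by have := @pihalf_lt2 R; lra. Qed.

(** The interval is shrunk to the half-width [v = t * s / (t + s)], which is below both [s] and [t]
    and has [v / s = 1 / (1 + s / t)], the shape of the entropy factors. There
    [x^2 <= 2 (x - b)^2 + 2 b^2] bounds the density below, the peak being at least [1 / (4 * s)]. *)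
Lemma normal_prob_ball_ge (s b t : R) : 0 < s -> 0 < t ->
  ((expR (- 2) * expR (- (b ^+ 2 / s ^+ 2)) / (1 + s / t))%:E
   <= normal_prob 0 s `[(b - t)%R, (b + t)%R])%E.
Proof.
move=> s0 t0; pose v := t * s / (t + s).
have ts0 : 0 < t + s by rewrite addr_gt0.
have v0 : 0 < v by rewrite divr_gt0// mulr_gt0.
have vt : v <= t by rewrite ler_pdivrMr// ler_pM2l// lerDr ltW.
have vs : v <= s by rewrite ler_pdivrMr// mulrC ler_pM2l// lerDl ltW.
have s20 : 0 < s ^+ 2 by rewrite exprn_gt0.
have peak : (4 * s)^-1 <= normal_peak s.
  rewrite lef_pV2 ?posrE ?mulr_gt0// ?sqrtr_gt0; last first.
    by rewrite mulrn_wgt0// mulr_gt0 ?pi_gt0.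
  rewrite -[leRHS]ger0_norm ?mulr_ge0// ?(ltW s0)// -sqrtr_sqr ler_sqrt ?sqr_ge0//.
  rewrite exprMn -[leLHS]mulr_natr -mulrA mulrC.
  by rewrite ler_wpM2r// ?(ltW s20)//; have := pi_le8; lra.
pose c := (4 * s)^-1 * expR (- 1 - b ^+ 2 / s ^+ 2).
have c0 : 0 <= c by rewrite mulr_ge0 ?expR_ge0// invr_ge0 mulr_ge0// ltW.
apply: (@le_trans _ _ (\int[lebesgue_measure]_(x in `[(b - v)%R, (b + v)%R]) c%:E)%E).
  rewrite integral_cst//= lebesgue_measure_itv/= lte_fin.
  have -> : b - v < b + v by lra.
  rewrite -EFinB -EFinM lee_fin.
  have -> : c * (b + v - (b - v)) = (2^-1 * expR (- 1)) * expR (- (b ^+ 2 / s ^+ 2)) / (1 + s / t).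
    rewrite /c expRD /v; field.
    by rewrite !gt_eqF// ?addr_gt0// addrC.
  have st : 0 < 1 + s / t by rewrite addr_gt0// divr_gt0.
  rewrite ler_pM2r ?invr_gt0// ler_wpM2r ?expR_ge0//.
  have -> : - 2 = - 1 - 1 :> R by lra.
  rewrite expRD ler_wpM2r ?expR_ge0// expRN lef_pV2 ?posrE ?expR_gt0//.
  by apply: le_trans (expR_ge1Dx 1); lra.
rewrite /normal_prob.
apply: (@le_trans _ _ (\int[lebesgue_measure]_(x in `[(b - v)%R, (b + v)%R]) (normal_pdf 0 s x)%:E)%E).
  apply: ge0_le_integral => //.
    by apply/measurable_EFinP/measurable_funTS; exact: measurable_normal_pdf.
  move=> x; rewrite /= in_itv/= => /andP[x1 x2]; rewrite lee_fin normal_pdfE ?gt_eqF//.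
  apply: ler_pM => //; first by rewrite invr_ge0 mulr_ge0// ltW.
  rewrite /normal_fun ler_expR subr0 -mulr_natr.
  rewrite -opprD mulNr lerN2 ler_pdivrMr ?mulr_gt0//.
  have -> : (1 + b ^+ 2 / s ^+ 2) * (s ^+ 2 * 2) = 2 * s ^+ 2 + 2 * b ^+ 2.
    by field; rewrite gt_eqF.
  have : (x - b) ^+ 2 <= s ^+ 2.
    rewrite -real_normK ?num_real// ler_sqr ?nnegrE ?(ltW s0)//.
    by apply: le_trans vs; rewrite ler_distl; apply/andP; split; lra.
  have := sqr_ge0 (x - 2 * b).
  have -> : (x - 2 * b) ^+ 2 = 2 * (x - b) ^+ 2 + 2 * b ^+ 2 - x ^+ 2 by ring.
  by move=> ? ?; lra.
apply: ge0_subset_integral => //.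
- by apply/measurable_EFinP/measurable_funTS; exact: measurable_normal_pdf.
- by move=> x _; rewrite lee_fin normal_pdf_ge0.
- by move=> x; rewrite /= !in_itv/= => /andP[x1 x2]; apply/andP; split; lra.
Qed.

Variables dW DW : nat.
Local Notation I := ('I_dW * 'I_DW)%type.
Variable Pi : probability (@Coef R dW DW) R.

Lemma measurable_ccoord (k : I) : measurable_fun setT (fun c : Coef dW DW => ccoord c k : R).
Proof.
exact: (measurableT_comp (measurable_tnth k.2) (measurable_tnth k.1)).
Qed.

Hypothesis ind : mutual_indep Pi (fun k : I => preim_sys (fun c : Coef dW DW => Defs.coord c k.1 k.2)).
Variable sg : I -> R.
Hypothesis sg0 : forall k, 0 < sg k.
Hypothesis law : forall k (A : set R), measurable A ->
    Pi ((fun c : Coef dW DW => Defs.coord c k.1 k.2) @^-1` A) = normal_prob 0 (sg k) A.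

(** [T * a k] is the prior precision of coordinate [k], so every coordinate meets [normal_sqr_mgf]
    at its exact value 1/4 and contributes [sqrt 2] whatever its scale. *)
Lemma prior_exp_moment (T : R) (a : I -> R) : (forall k, T * a k * sg k ^+ 2 = 1) ->
  (\int[Pi]_c (expR (4^-1 * (T * wnorm2 a c)))%:E = (Num.sqrt 2 ^+ (dW * DW))%:E)%E.
Proof.
move=> aT.
transitivity (\int[Pi]_c (\prod_(k <- enum {: I}) expR (4^-1 * (T * a k) * ccoord c k ^+ 2))%:E)%E.
  apply: eq_integral => c _; rewrite big_enum/= -expR_sum; congr ((expR _)%:E).
  by rewrite /wnorm2 !mulr_sumr; apply: eq_bigr => k _; ring.
have mh k : measurable_fun setT (fun z : R => expR (4^-1 * (T * a k) * z ^+ 2)).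
  apply: measurableT_comp => //; apply: measurable_funM; first exact: measurable_cst.
  exact: measurable_funX.
rewrite (@indep_prod _ _ _ Pi _ (fun k : I => preim_sys (fun c : Coef dW DW => Defs.coord c k.1 k.2)))//.
- rewrite big_enum/=.
  have -> : (\prod_(k : I) \int[Pi]_w (expR (4^-1 * (T * a k) * ccoord w k ^+ 2))%:E =
    \prod_(k : I) (Num.sqrt 2)%:E)%E.
    apply: eq_bigr => k _.
    rewrite (@ge0_integral_law _ _ _ (measurableTypeR R) _ Pi (fun c => ccoord c k) (normal_prob 0 (sg k))
      (fun z => (expR (4^-1 * (T * a k) * z ^+ 2))%:E))//.
    + by apply: normal_sqr_mgf => //; rewrite -mulrA aT mulr1.
    + exact: measurable_ccoord.
    + by move=> A mA; exact: law.
    + by apply/measurable_EFinP; exact: mh.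
  by rewrite prodEFin prodr_const card_prod !card_ord.
- by move=> k; apply: preim_sys_measurable; exact: measurable_ccoord.
- by move=> k; exact: preim_sys_sigma.
- exact: enum_uniq.
- move=> k B mB; exists ((fun z : R => expR (4^-1 * (T * a k) * z ^+ 2)) @^-1` B) => //.
  by rewrite -[X in measurable X]setTI; exact: mh.
Qed.

Definition coef_box (b t : I -> R) : set (@Coef R dW DW) :=
  [set c | forall k, `|ccoord c k - b k| <= t k].

Lemma coef_boxE b t : coef_box b t =
  \bigcap_(k in [set i | i \in [set: I]%SET])
    ((fun c : Coef dW DW => Defs.coord c k.1 k.2) @^-1` `[(b k - t k)%R, (b k + t k)%R]).
Proof.
apply/seteqP; split => c /= h k.
  by move=> _ /=; rewrite in_itv/= -ler_distl; exact: h.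
by have := h k; rewrite /= inE => /(_ isT); rewrite in_itv/= -ler_distl.
Qed.

Lemma measurable_coef_box b t : measurable (coef_box b t).
Proof.
rewrite coef_boxE; apply: fin_bigcap_measurable; first exact: finite_finset.
move=> k _; rewrite -[X in measurable X]setTI.
by apply: (measurable_ccoord k) => //; exact: measurable_itv.
Qed.

Lemma prior_box_ge (b t : I -> R) : (forall k, 0 < t k) ->
  ((\prod_(k : I) (expR (- 2) * expR (- (b k ^+ 2 / sg k ^+ 2)) / (1 + sg k / t k)))%:E
   <= Pi (coef_box b t))%E.
Proof.
move=> t0; rewrite coef_boxE (ind (J := [set: I]%SET)); last first.
  by move=> k _; exists `[(b k - t k)%R, (b k + t k)%R]%classic.
rewrite lee_fin (eq_bigl xpredT); last by move=> k; rewrite inE.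
apply: ler_prod => k _; apply/andP; split.
  rewrite divr_ge0//.
  by rewrite addr_ge0// ltW// divr_gt0.
have h := normal_prob_ball_ge (b k) (sg0 k) (t0 k).
rewrite law; last exact: measurable_itv.
rewrite -lee_fin fineK//; apply: fin_num_measure; exact: measurable_itv.
Qed.

End GaussianPrior.

(** * Lower bound on the evidence *)

Section Posterior.
Context d (O : measurableType d) (R : realType) (P : probability O R)
  dX (X : measurableType dX) (lamX : probability X R) (N dV : nat)
  (Xs : 'I_N -> O -> X) (eps : 'I_N -> 'I_dV -> O -> R).
Hypothesis dm : data_model P lamX Xs eps.
Variables (dW DW : nat) (g : @Coef R dW DW -> X -> dV.-tuple R) (fs : X -> dV.-tuple R).
Variables (U del T : R).
Hypotheses (mfs : measurable_field fs) (bfs : bounded_field U fs).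
Hypotheses (mg : forall c, measurable_field (g c)) (bg : forall c, bounded_field U (g c)).
Hypothesis mg2 : forall j, measurable_fun setT (fun p : X * Coef dW DW => tnth (g p.2 p.1) j).
Hypothesis TE : T = N%:R * del ^+ 2.
Variable Pi : probability (@Coef R dW DW) R.

Notation risk c := (predrisk lamX (g c) fs).
Notation ll h := (loglik_at Xs eps fs h).

Lemma measurable_loglik_joint :
  measurable_fun setT (fun p : O * Coef dW DW => ll (g p.2) p.1).
Proof.
have [mXs meps _ _ _] := dm.
apply: measurable_funM; first exact: measurable_cst.
apply: measurable_sum => i; apply: measurable_sum => j.
apply: measurable_funX; apply: measurable_funB.
  apply: measurable_funD.
    exact: (measurableT_comp (mfs j) (measurableT_comp (mXs i) measurable_fst)).
  exact: (measurableT_comp (meps i j) measurable_fst).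
apply: (measurableT_comp (mg2 j) (g := fun p : O * Coef dW DW => (Xs i p.1, p.2))).
apply: measurable_fun_pair; last exact: measurable_snd.
exact: (measurableT_comp (mXs i) measurable_fst).
Qed.

Lemma measurable_loglik_fs : measurable_fun setT (ll fs).
Proof. exact: (measurable_loglik_at dm). Qed.

Lemma measurable_loglik_coef w : measurable_fun setT (fun c : Coef dW DW => ll (g c) w).
Proof.
apply: (measurableT_comp measurable_loglik_joint (g := fun c => (w, c))).
by apply: measurable_fun_pair => //; exact: measurable_cst.
Qed.

(** Joint measurability is what Tonelli needs to exchange data and prior; [sgn] covers the
    likelihood ratio and its inverse. *)
Lemma measurable_lrt_joint (sgn : R) :
  measurable_fun setT (fun p : O * Coef dW DW => expR (sgn * (ll (g p.2) p.1 - ll fs p.1))).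
Proof.
apply: measurableT_comp => //; apply: measurable_funM; first exact: measurable_cst.
apply: measurable_funB; first exact: measurable_loglik_joint.
exact: (measurableT_comp measurable_loglik_fs measurable_fst).
Qed.

Definition evidence w : \bar R := (\int[Pi]_c (expR (ll (g c) w - ll fs w))%:E)%E.

Lemma measurable_evidence : measurable_fun setT evidence.
Proof.
have := @measurable_fun_fubini_tonelli_F _ _ _ _ R Pi
  (fun p : O * Coef dW DW => (expR (1 * (ll (g p.2) p.1 - ll fs p.1)))%:E).
rewrite /fubini_F /evidence; under [in X in _ -> X]eq_fun do under eq_integral do rewrite -[X in expR X]mul1r.
apply; last by move=> x; rewrite lee_fin expR_ge0.
by apply/measurable_EFinP; exact: measurable_lrt_joint.
Qed.

Lemma evidence_ge0 w : (0 <= evidence w)%E.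
Proof. by apply: integral_ge0 => c _; rewrite lee_fin expR_ge0. Qed.

Variables (BN : set (@Coef R dW DW)) (K : R).
Hypotheses (mBN : measurable BN) (riskBN : forall c, BN c -> risk c <= del ^+ 2).

Definition low_evidence : set O := [set w | (evidence w < Pi BN * (expR (- (K * T)))%:E)%E].

Lemma measurable_low_evidence : measurable low_evidence.
Proof.
rewrite /low_evidence -[X in measurable X]setTI.
by apply: measurable_lte => //; exact: measurable_evidence.
Qed.

(* The inequality [x^-1 + k ^+ 2 * x >= 2 * k], integrated over [BN], reduces small evidence
   to a large value of [J w], the integral of the inverse likelihood ratio over [BN], to
   which Markov's inequality applies. *)
Lemma low_evidence_prob : (P low_evidence <= (expR (- ((K - expR (4 * U ^+ 2)) * T)))%:E)%E.
Proof.
have PBfin : Pi BN \is a fin_num by exact: fin_num_measure.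
(* A null [BN] makes the event empty; otherwise its mass is positive and cancels after Markov's
   inequality. *)
have [PB0|PB0] := eqVneq (Pi BN) 0%E.
  rewrite (_ : low_evidence = set0) ?measure0 ?lee_fin ?expR_ge0//.
  apply/seteqP; split => // w; rewrite /low_evidence/= PB0 mul0e.
  by rewrite ltNge evidence_ge0.
pose p := fine (Pi BN).
have pE : Pi BN = p%:E by rewrite fineK.
have p0 : 0 < p by rewrite -lte_fin -pE lt_neqAle eq_sym PB0 measure_ge0.
have intB : (\int[Pi]_c (\1_BN c)%:E = p%:E)%E.
  by rewrite integral_indic// setIT; exact: pE.
pose h (x : O * Coef dW DW) := (expR (-1 * (ll (g x.2) x.1 - ll fs x.1)) * \1_BN x.2)%:E.
have mind : measurable_fun setT (fun x : O * Coef dW DW => (\1_BN x.2 : R)).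
  by apply: (measurableT_comp _ measurable_snd); exact: measurable_indic.
have mh : measurable_fun setT h.
  apply/measurable_EFinP; apply: measurable_funM; first exact: measurable_lrt_joint.
  exact: mind.
have h0 x : (0 <= h x)%E by rewrite lee_fin mulr_ge0 ?expR_ge0.
pose J w := (\int[Pi]_c h (w, c))%E.
have mJ : measurable_fun setT J by exact: measurable_fun_fubini_tonelli_F.
have J0 w : (0 <= J w)%E by apply: integral_ge0.
have mhc w : measurable_fun setT (fun c => h (w, c)).
  by apply: measurableT_comp => //; apply: measurable_fun_pair => //; exact: measurable_cst.
pose y := expR (K * T) * p.
have y0 : 0 < y by rewrite mulr_gt0// expR_gt0.
have sub : low_evidence `<=` [set w | (y%:E <= J w)%E].
  move=> w; rewrite /low_evidence /= pE => hw.
  have me : measurable_fun setT (fun c => (expR (ll (g c) w - ll fs w))%:E).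
    apply/measurable_EFinP; apply: measurableT_comp => //; apply: measurable_funB.
      exact: measurable_loglik_coef.
    exact: measurable_cst.
  have mind' : measurable_fun setT (fun c : Coef dW DW => (\1_BN c : R)%:E).
    by apply/measurable_EFinP; exact: measurable_indic.
  have main : ((2 * y)%:E <= J w + (expR (K * T) ^+ 2)%:E * evidence w)%E.
    rewrite /J /evidence -ge0_integralZl_EFin//.
    rewrite -ge0_integralD//; last first.
      by apply: emeasurable_funM => //; exact: measurable_cst.
    have -> : (2 * y)%:E = (\int[Pi]_c ((2 * expR (K * T))%:E * (\1_BN c)%:E))%E.
      rewrite ge0_integralZl_EFin//.
      by rewrite intB -EFinM /y mulrA.
    apply: ge0_le_integral => //.
    - by apply: emeasurable_funM => //; exact: measurable_cst.
    - apply: emeasurable_funD => //.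
      by apply: emeasurable_funM => //; exact: measurable_cst.
    move=> c _; rewrite /h/= -!EFinM -EFinD lee_fin mulN1r expRN.
    set x := expR (_ - _); have x0 : 0 < x by exact: expR_gt0.
    set k := expR (K * T).
    have kx : 0 <= x^-1 + k ^+ 2 * x - 2 * k.
      have -> : x^-1 + k ^+ 2 * x - 2 * k = (1 - k * x) ^+ 2 / x by field; rewrite gt_eqF.
      by rewrite divr_ge0 ?sqr_ge0// ltW.
    rewrite indicE; case: (c \in BN); rewrite /= ?mulr1n ?mulr0n ?mulr1 ?mulr0 ?add0r; first by lra.
    by rewrite mulr_ge0// ?sqr_ge0// ltW.
  have small : ((expR (K * T) ^+ 2)%:E * evidence w <= y%:E)%E.
    apply: (@le_trans _ _ ((expR (K * T) ^+ 2)%:E * (p%:E * (expR (- (K * T)))%:E))%E).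
      by rewrite lee_pmul2l ?ltW// lte_fin exprn_gt0// expR_gt0.
    rewrite -!EFinM lee_fin expRN /y le_eqVlt; apply/orP; left; apply/eqP; field.
    by rewrite gt_eqF// expR_gt0.
  have : ((2 * y)%:E <= J w + y%:E)%E by apply: (le_trans main); rewrite leeD2l.
  rewrite -leeBlDr// -EFinB; congr (_%:E <= _)%E; ring.
have mA : measurable [set w | (y%:E <= J w)%E].
  rewrite -[X in measurable X]setTI; apply: measurable_lee => //; exact: measurable_cst.
have mkv : (y%:E * P [set w | (y%:E <= J w)%E] <= \int[P]_w J w)%E.
  rewrite -[X in P X]setIT -integral_indic// -ge0_integralZl_EFin ?(ltW y0)//; last first.
    by apply/measurable_EFinP; exact: measurable_indic.
  apply: ge0_le_integral => //.
  - by move=> w _; rewrite -EFinM lee_fin mulr_ge0// ltW.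
  - apply: emeasurable_funM; first exact: measurable_cst.
    by apply/measurable_EFinP; exact: measurable_indic.
  move=> w _; rewrite indicE; case: (boolP (w \in _)) => [|_].
    by rewrite inE/= mulr1n mule1.
  by rewrite mulr0n mule0.
have intJ : (\int[P]_w J w <= (expR (expR (4 * U ^+ 2) * T) * p)%:E)%E.
  rewrite /J (fubini_tonelli h)//.
  apply: (@le_trans _ _ (\int[Pi]_c ((expR (expR (4 * U ^+ 2) * T))%:E * (\1_BN c)%:E))%E).
    have mhw c : measurable_fun setT (fun w => h (w, c)).
      by apply: measurableT_comp => //; apply: measurable_fun_pair => //; exact: measurable_cst.
    apply: ge0_le_integral => //.
    - by move=> c _; apply: integral_ge0.
    - exact: measurable_fun_fubini_tonelli_G.
    - apply: emeasurable_funM; first exact: measurable_cst.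
      by apply/measurable_EFinP; exact: measurable_indic.
    move=> c _; rewrite /h/= indicE.
    case: (boolP (c \in BN)) => [|_]; last first.
      by under eq_integral do rewrite mulr0; rewrite integral0 mulr0n mule0.
    rewrite inE => cB; rewrite mulr1n mule1.
    under eq_integral do rewrite mulr1 mulN1r opprB.
    apply: (le_trans (mgf_loglik_loss dm mfs bfs (mg c) (bg c))).
    rewrite lee_fin ler_expR TE mulrCA ler_wpM2l// ?expR_ge0//.
    by rewrite ler_wpM2l// riskBN.
  rewrite ge0_integralZl_EFin ?expR_ge0//; last by apply/measurable_EFinP; exact: measurable_indic.
  by rewrite intB -EFinM.
apply: (@le_trans _ _ (P [set w | (y%:E <= J w)%E])).
  by apply: le_measure; rewrite ?inE//; exact: measurable_low_evidence.
rewrite -(@lee_pmul2l _ y%:E) ?lte_fin//.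
apply: (le_trans mkv); apply: (le_trans intJ).
rewrite -EFinM lee_fin /y mulrAC ler_pM2r// -expRD ler_expR.
by rewrite mulrBl; lra.
Qed.

End Posterior.

(** * Posterior mass for a fixed outcome *)

Section PosteriorTail.
Context {R : realType} (dW DW : nat).
Variable Pi : probability (@Coef R dW DW) R.
Variables (ell W risk : @Coef R dW DW -> R) (l0 : R).
Variables (T A1 C2 kapp del2 L2 M2 q K b : R) (n : R).
Hypotheses (mell : measurable_fun setT ell) (mW : measurable_fun setT W).
Hypotheses (ell0 : forall c, ell c <= 0) (W0 : forall c, 0 <= W c) (risk0 : forall c, 0 <= risk c).
Hypotheses (T0 : 0 <= T) (TE : T = n * del2) (n0 : 0 <= n) (kapp0 : 0 <= kapp).
Hypothesis upper : forall c, ell c - l0 <= - (kapp * (n * risk c)) + T * (C2 + 8^-1 * W c).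
Hypothesis Wmom : (\int[Pi]_c (expR (4^-1 * (T * W c)))%:E <= (expR (A1 * T))%:E)%E.
Hypothesis lower : ((expR (- (q * T)) * expR (- (K * T)))%:E <=
  \int[Pi]_c (expR (ell c - l0))%:E)%E.
Variable A : set (@Coef R dW DW).
Hypothesis mA : measurable A.
Hypothesis offA : forall c, ~ A c -> L2 * del2 <= risk c \/ M2 <= W c.
Hypothesis L2b : C2 + A1 + q + K + b <= kapp * L2.
Hypothesis M2b : C2 + A1 + q + K + b <= 8^-1 * M2.

(** Off [A], either the risk gain or an extra [T * W c / 8] absorbs [Q * T], and what remains is at
    most [T * W c / 4], whose exponential moment costs [A1 * T]. Dividing by the evidence costs
    [(q + K) * T]; [Q] is chosen so that exactly [- b * T] is left. *)
Lemma posterior_mass_ge : 1 - expR (- (b * T)) <= post Pi ell A.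
Proof.
pose Q := C2 + A1 + q + K + b.
have me : measurable_fun setT (fun c => expR (ell c)) by exact: measurableT_comp.
have meD D : measurable D -> measurable_fun D (fun c => (expR (ell c))%:E).
  by move=> mD; apply: measurable_funTS; exact/measurable_EFinP.
have fin D : measurable D -> (\int[Pi]_(c in D) (expR (ell c))%:E)%E \is a fin_num.
  move=> mD; rewrite ge0_fin_numE; last by apply: integral_ge0 => c _; rewrite lee_fin expR_ge0.
  apply: (@le_lt_trans _ _ (\int[Pi]_(c in D) 1%:E)%E).
    apply: ge0_le_integral => //.
    - exact: meD.
    - by move=> c _; rewrite lee_fin -expR0 ler_expR.
  by rewrite integral_cst// mul1e -ge0_fin_numE// fin_num_measure.
have mAC : measurable (~` A) by exact: measurableC.
pose IA := fine (\int[Pi]_(c in A) (expR (ell c))%:E)%E.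
pose IC := fine (\int[Pi]_(c in ~` A) (expR (ell c))%:E)%E.
have IE : fine (\int[Pi]_c (expR (ell c))%:E)%E = IA + IC.
  rewrite -(setUv A) ge0_integral_setU//; last 2 first.
  - by rewrite setUv; exact: meD.
  - by rewrite disj_set2E setICr.
  by rewrite fineD ?fin.
have IC0 : 0 <= IC by rewrite fine_ge0// integral_ge0// => c _; rewrite lee_fin expR_ge0.
have IA0 : 0 <= IA by rewrite fine_ge0// integral_ge0// => c _; rewrite lee_fin expR_ge0.
have Ilow : expR l0 * (expR (- (q * T)) * expR (- (K * T))) <= IA + IC.
  rewrite -lee_fin -IE fineK ?fin// EFinM.
  apply: (@le_trans _ _ ((expR l0)%:E * \int[Pi]_c (expR (ell c - l0))%:E)%E).
    by rewrite lee_pmul2l// lte_fin expR_gt0.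
  rewrite -ge0_integralZl_EFin ?expR_ge0//; last first.
    by apply/measurable_EFinP; apply: measurableT_comp => //; apply: measurable_funB.
  rewrite le_eqVlt; apply/orP; left; apply/eqP; apply: eq_integral => c _.
  by rewrite -EFinM -expRD addrC subrK.
have I0 : 0 < IA + IC.
  by apply: lt_le_trans Ilow; rewrite !mulr_gt0// expR_gt0.
have pw c : ~ A c -> ell c <= l0 + (C2 - Q) * T + 4^-1 * (T * W c).
  move=> /offA hc; have := upper c.
  have TW : 0 <= T * W c by rewrite mulr_ge0.
  have nr : 0 <= kapp * (n * risk c) by rewrite !mulr_ge0.
  case: hc => hc h.
    have h1 : Q * T <= kapp * (n * risk c).
      apply: (@le_trans _ _ (kapp * L2 * T)); first by rewrite ler_wpM2r.
      by rewrite -mulrA ler_wpM2l// TE mulrCA ler_wpM2l.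
    rewrite mulrDr in h; rewrite mulrBl; lra.
  have h1 : Q * T <= 8^-1 * (T * W c).
    apply: (@le_trans _ _ (8^-1 * M2 * T)); first by rewrite ler_wpM2r.
    by rewrite -mulrA ler_pM2l// mulrC ler_wpM2l.
  rewrite mulrDr in h; rewrite mulrBl; lra.
have ICup : IC <= expR (l0 + (C2 - Q) * T) * expR (A1 * T).
  rewrite -lee_fin fineK ?fin// EFinM.
  apply: (@le_trans _ _ ((expR (l0 + (C2 - Q) * T))%:E * \int[Pi]_c (expR (4^-1 * (T * W c)))%:E)%E); last first.
    by rewrite lee_pmul2l// lte_fin expR_gt0.
  have mWe : measurable_fun setT (fun c => (expR (4^-1 * (T * W c)))%:E).
    apply/measurable_EFinP; apply: measurableT_comp => //.
    by do 2 (apply: measurable_funM; first exact: measurable_cst).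
  rewrite -ge0_integralZl_EFin ?expR_ge0//.
  apply: (@le_trans _ _ (\int[Pi]_(c in ~` A) ((expR (l0 + (C2 - Q) * T))%:E * (expR (4^-1 * (T * W c)))%:E))%E).
    apply: ge0_le_integral => //.
    - exact: meD.
    - by apply: measurable_funTS; apply: emeasurable_funM => //; exact: measurable_cst.
    - by move=> c cA; rewrite -EFinM lee_fin -expRD ler_expR pw.
  apply: ge0_subset_integral => //.
  by apply: emeasurable_funM => //; exact: measurable_cst.
rewrite /post -/IA IE.
have -> : IA = (IA + IC) - IC by rewrite addrK.
rewrite [X in _ <= _ / (X + _)]addrK mulrBl mulfV ?gt_eqF// lerD2l lerN2.
rewrite ler_pdivrMr//; apply: (le_trans ICup).
apply: (@le_trans _ _ (expR (- (b * T)) * (expR l0 * (expR (- (q * T)) * expR (- (K * T)))))); last first.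
  by rewrite ler_wpM2l// expR_ge0.
rewrite -!expRD ler_expR /Q le_eqVlt; apply/orP; left; apply/eqP; ring.
Qed.

End PosteriorTail.

(** * Rates, eigenvalues and the entropy product *)

Section Numerics.
Context {R : realType}.

Lemma prod_ratio_le (T : R) m : 0 <= T -> \prod_(j < m) (T / j.+1%:R) <= expR T.
Proof.
move=> T0.
have -> : \prod_(j < m) (T / j.+1%:R) = T ^+ m / m`!%:R.
  elim: m => [|m IH]; first by rewrite big_ord0 expr0 divr1.
  rewrite big_ord_recr/= IH factS natrM exprSr; field.
  by rewrite nat1r !pnatr_eq0 -lt0n fact_gt0.
case: m => [|m]; first by rewrite expr0 divr1 -expR0 ler_expR.
by apply: le_trans (expR_ge1Dxn m T0); rewrite lerDr.
Qed.

Lemma powR_prod (J : Type) (r : seq J) (y : J -> R) p : (forall j, 0 <= y j) ->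
  \prod_(j <- r) (y j `^ p) = (\prod_(j <- r) y j) `^ p.
Proof.
move=> y0; elim: r => [|j r IH]; first by rewrite !big_nil powR1.
by rewrite !big_cons IH powRM// prodr_ge0.
Qed.

(* Relies on [\prod_(n < m) (T / n.+1) = T ^+ m / m`! <= expR T], so a product of [O(T)]
   factors which are individually unbounded in [T] costs only [expR (O(T))]. *)
Lemma entropy_prod_le (T A C p : R) (m : nat) (w : nat -> R) :
  1 <= T -> 1 <= A -> 0 <= C -> 0 <= p -> m%:R <= A * T ->
  (forall n, 0 <= w n) ->
  (forall n, w n <= C * (T / n.+1%:R) `^ p) ->
  \prod_(n < m) (1 + w n) <= expR (((A `^ p + C) * A + p) * T).
Proof.
move=> T1 A1 C0 p0 mA w0 wC.
have T0 : 0 < T by apply: lt_le_trans T1.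
have A0 : 0 < A by apply: lt_le_trans A1.
pose B := A `^ p + C.
have B0 : 0 <= B by rewrite addr_ge0// powR_ge0.
have y0 n : 0 <= T / n.+1%:R by rewrite divr_ge0// ltW.
apply: (@le_trans _ _ (\prod_(n < m) (B * (T / n.+1%:R) `^ p))).
  apply: ler_prod => n _; rewrite addr_ge0//= mulrDl lerD//.
  rewrite -powRM// ?(ltW A0)//; rewrite [leLHS](_ : 1 = 1 `^ p); last by rewrite powR1.
  apply: ge0_ler_powR => //; rewrite ?nnegrE//.
    by rewrite mulr_ge0// ltW.
  rewrite mulrA ler_pdivlMr// mul1r; apply: le_trans mA.
  by rewrite ler_nat.
rewrite big_split/= prodr_const card_ord powR_prod//.
have -> : expR ((B * A + p) * T) = expR (B * (A * T)) * expR T `^ p.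
  by rewrite /powR gt_eqF ?expR_gt0// expRK -expRD; congr expR; ring.
apply: ler_pM.
- by rewrite exprn_ge0.
- exact: powR_ge0.
- apply: (@le_trans _ _ (expR B ^+ m)).
    rewrite lerXn2r ?nnegrE ?expR_ge0//.
    by apply: le_trans (expR_ge1Dx B); rewrite lerDr.
  by rewrite -expRM_natl ler_expR mulrC ler_wpM2l.
- apply: ge0_ler_powR => //; rewrite ?nnegrE ?expR_ge0 ?prodr_ge0//.
  by apply: prod_ratio_le; exact: ltW.
Qed.

(** [T] is the admissible order of the dimension and [del^-1] is a power of it, so the entropy and
    sup-norm estimates can be carried out in terms of [T] alone. *)
Lemma deltaN_facts (alpha : R) (d N : nat) : 0 < alpha -> (0 < d)%N -> (0 < N)%N ->
  let del := deltaN alpha d N in let T := N%:R * del ^+ 2 in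
  [/\ 0 < del, T = N%:R `^ (d%:R / (2 * alpha + d%:R)), 1 <= T,
      del^-1 = T `^ (alpha / d%:R) & T <= N%:R].
Proof.
move=> a0 d0 N0 del T.
have d0' : 0 < d%:R :> R by rewrite ltr0n.
have N1 : 1 <= N%:R :> R by rewrite ler1n.
have N0' : 0 < N%:R :> R by rewrite ltr0n.
have q0 : 0 < 2 * alpha + d%:R by rewrite addr_gt0// mulr_gt0.
have del0 : 0 < del by rewrite /del /deltaN powR_gt0.
have TE : T = N%:R `^ (d%:R / (2 * alpha + d%:R)).
  rewrite /T /del /deltaN -powR_mulrn ?powR_ge0// -powRrM.
  rewrite -[X in X * _](powRr1 (ltW N0')) -powRD; last by rewrite (gt_eqF N0') implybT.
  by congr (_ `^ _); field; rewrite gt_eqF.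
split => //.
- rewrite TE -[leLHS](powRr0 N%:R); apply: ler_powR => //.
  by rewrite divr_ge0// ltW.
- rewrite TE -powRrM /del /deltaN powRN invrK.
  by congr (_ `^ _); field; rewrite !gt_eqF.
- rewrite TE; apply: ler1_powR => //.
  by rewrite ler_pdivrMr// mul1r lerDr mulr_ge0// ltW.
Qed.

(** The shift to [n.+1] brings the index 0 under the same power bound; for positive indices it costs
    the factor [(1/2)^(2/d)], since [n.+1 >= n.+2 / 2]. *)
Lemma eigen_lower (lam : nat -> R) (d : nat) (b1 : R) : 0 < b1 -> 0 < lam 0%N ->
  (forall n : nat, (0 < n)%N -> b1 * (n%:R) `^ (2 / d%:R) <= lam n) ->
  exists2 beta : R, 0 < beta & forall n, beta * (n.+1%:R) `^ (2 / d%:R) <= lam n.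
Proof.
move=> b0 l0 hl; pose h := 2^-1 `^ (2 / d%:R) : R.
have h0 : 0 < h by rewrite powR_gt0// invr_gt0.
have dp : 0 <= 2 / d%:R :> R by rewrite divr_ge0.
exists (Num.min (lam 0%N) (b1 * h)); first by rewrite lt_min l0 mulr_gt0.
case=> [|n]; first by rewrite powR1 mulr1 ge_min lexx.
apply: (@le_trans _ _ (b1 * h * n.+2%:R `^ (2 / d%:R))).
  by rewrite ler_wpM2r ?powR_ge0// ge_min lexx orbT.
apply: le_trans (hl n.+1 _) => //; rewrite -mulrA ler_pM2l//.
rewrite /h -powRM// ?invr_ge0//; apply: ge0_ler_powR => //; rewrite ?nnegrE// ?mulr_ge0// ?invr_ge0//.
rewrite -(natr1 n.+1) -(natr1 n) ler_pdivrMl//.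
by have : 0 <= n%:R :> R by []; lra.
Qed.

(** [D <= A * T] cancels [sqrt T] against the [sqrt D] of the mesh, and [del = T^(- alpha/d)] meets
    [lam n ^ (alpha/2)] of order at least [n^(alpha/d)]: the summand added to 1 is at most
    [C * (T / n.+1)^(alpha/d)], the form treated by [entropy_prod_le]. *)
Lemma mesh_entropy (lam : nat -> R) (d : nat) (beta alpha A s : R) (dW : nat) :
  0 < beta -> 0 < alpha -> (0 < d)%N -> 1 <= A -> 0 < s -> (0 < dW)%N ->
  (forall n, beta * (n.+1%:R) `^ (2 / d%:R) <= lam n) ->
  exists2 Ce : R, 0 <= Ce & forall (DW : nat) (T del : R), (0 < DW)%N -> 1 <= T ->
    0 < del -> del^-1 = T `^ (alpha / d%:R) -> (dW * DW)%:R <= A * T ->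
    \prod_(k : 'I_dW * 'I_DW)
      (1 + (Num.sqrt (s * T * (lam k.2 `^ alpha)) * mesh dW DW del)^-1) <= expR (Ce * T).
Proof.
move=> be0 a0 d0 A1 s0 dW0 hl.
have A0 : 0 < A by apply: lt_le_trans A1.
have d0' : 0 < d%:R :> R by rewrite ltr0n.
pose p := alpha / d%:R.
have p0 : 0 <= p by rewrite divr_ge0// ltW.
pose C := Num.sqrt A / (Num.sqrt s * beta `^ (alpha / 2)).
have sA0 : 0 < Num.sqrt A by rewrite sqrtr_gt0.
have ss0 : 0 < Num.sqrt s by rewrite sqrtr_gt0.
have bb0 : 0 < beta `^ (alpha / 2) by rewrite powR_gt0.
have C0 : 0 < C by rewrite divr_gt0// mulr_gt0.
pose B := (A `^ p + C) * A + p.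
have B0 : 0 <= B by rewrite addr_ge0// mulr_ge0 ?(ltW A0)// addr_ge0 ?powR_ge0// ltW.
exists (dW%:R * B); first by rewrite mulr_ge0.
move=> DW T del DW0 T1 del0 delE DA.
have T0 : 0 < T by apply: lt_le_trans T1.
have D0 : 0 < (dW * DW)%:R :> R by rewrite ltr0n muln_gt0 dW0.
have sD0 : 0 < Num.sqrt (dW * DW)%:R :> R by rewrite sqrtr_gt0.
pose w n := (Num.sqrt (s * T * (lam n `^ alpha)) * mesh dW DW del)^-1.
have lam0 n : 0 < lam n.
  by apply: lt_le_trans (hl n); rewrite mulr_gt0// powR_gt0.
have w0 n : 0 <= w n.
  by rewrite invr_ge0 mulr_ge0 ?sqrtr_ge0// divr_ge0 ?sqrtr_ge0// ltW.
have wC n : w n <= C * (T / n.+1%:R) `^ p.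
  have n0 : 0 < n.+1%:R :> R by [].
  have y0 : 0 < (T / n.+1%:R) `^ p by rewrite powR_gt0// divr_gt0.
  have -> : C * (T / n.+1%:R) `^ p = (C^-1 / (T / n.+1%:R) `^ p)^-1 by rewrite invfM !invrK.
  have Cy0 : 0 < C^-1 / (T / n.+1%:R) `^ p by rewrite divr_gt0// invr_gt0.
  have TT : T `^ p = (T / n.+1%:R) `^ p * n.+1%:R `^ p.
    rewrite -powRM//; last by rewrite divr_ge0// ltW.
    by rewrite divfK// gt_eqF.
  have np0 : 0 < n.+1%:R `^ p :> R by rewrite powR_gt0.
  have delE' : del = ((T / n.+1%:R) `^ p * n.+1%:R `^ p)^-1 by rewrite -TT -delE invrK.
  have h1 : beta `^ (alpha / 2) * n.+1%:R `^ p <= Num.sqrt (lam n `^ alpha).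
    rewrite -powR12_sqrt ?powR_ge0// -powRrM.
    have -> : n.+1%:R `^ p = (n.+1%:R `^ (2 / d%:R)) `^ (alpha / 2) :> R.
      by rewrite -powRrM; congr (_ `^ _); rewrite /p; field; rewrite gt_eqF.
    rewrite -powRM ?powR_ge0 ?(ltW be0)//; apply: ge0_ler_powR.
    - by rewrite divr_ge0// ltW.
    - by rewrite nnegrE mulr_ge0 ?powR_ge0// ltW.
    - by rewrite nnegrE ltW.
    - exact: hl.
  have h2 : Num.sqrt (dW * DW)%:R / Num.sqrt A <= Num.sqrt T.
    by rewrite ler_pdivrMr// mulrC -sqrtrM ?(ltW A0)// ler_sqrt// mulr_ge0// ltW.
  rewrite /w lef_pV2 ?posrE//; last first.
    by rewrite mulr_gt0 ?divr_gt0// sqrtr_gt0 !mulr_gt0// powR_gt0.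
  have -> : Num.sqrt (s * T * (lam n `^ alpha)) = Num.sqrt s * Num.sqrt T * Num.sqrt (lam n `^ alpha).
    by rewrite !sqrtrM// ?mulr_ge0// ltW.
  rewrite /mesh delE' /C.
  apply: (@le_trans _ _ (Num.sqrt s * (Num.sqrt (dW * DW)%:R / Num.sqrt A) *
     (beta `^ (alpha / 2) * n.+1%:R `^ p) *
     (((T / n.+1%:R) `^ p * n.+1%:R `^ p)^-1 / Num.sqrt (dW * DW)%:R))); last first.
    rewrite ler_wpM2r//.
      by rewrite divr_ge0 ?sqrtr_ge0// invr_ge0 mulr_ge0// ltW.
    apply: ler_pM => //.
    - by rewrite mulr_ge0 ?powR_ge0.
    - by rewrite ler_pM2l.
  rewrite le_eqVlt; apply/orP; left; apply/eqP; field.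
  by rewrite !gt_eqF.
rewrite -(pair_bigA _ (fun (i : 'I_dW) (n : 'I_DW) => 1 + w n))/=.
rewrite prodr_const card_ord -mulrA expRM_natl.
rewrite lerXn2r ?nnegrE ?expR_ge0//; first by apply: prodr_ge0 => n _; rewrite addr_ge0.
apply: entropy_prod_le => //; first exact: ltW.
apply: le_trans DA; rewrite ler_nat; exact: leq_pmull.
Qed.

End Numerics.

(** * Fields, coefficients and the two contraction rates *)

Section Translation.
Context {R : realType}.

Lemma sqrte_fin (x : R) : sqrte x%:E = (Num.sqrt x)%:E. Proof. by []. Qed.

Lemma loglik_dataOf d (O : measurableType d) dX (X : measurableType dX) (Z : Type) dW N dV (G : (Z -> dW.-tuple R) -> X -> dV.-tuple R) thstar
   (Xs : 'I_N -> O -> X) eps w th :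
  loglik G (dataOf G thstar Xs eps w) th = loglik_at Xs eps (G thstar) (G th) w.
Proof.
rewrite /loglik /loglik_at; congr (_ * _); apply: eq_bigr => i _.
by rewrite /dataOf !tnth_mktuple/= /sqdist; apply: eq_bigr => j _; rewrite tnth_mktuple.
Qed.

Lemma L2XdistE d (X : measurableType d) (lamX : probability X R) dV (U : R)
   (g h : X -> dV.-tuple R) : measurable_field g -> measurable_field h -> bounded_field U g -> bounded_field U h ->
  L2Xdist lamX g h = (Num.sqrt (predrisk lamX g h))%:E.
Proof. by move=> mg mh bg bh; rewrite /L2Xdist (predriskE lamX mg mh bg bh). Qed.

Lemma L2Xdist_le d (X : measurableType d) (lamX : probability X R) dV (U r : R)
   (g h : X -> dV.-tuple R) : measurable_field g -> measurable_field h -> bounded_field U g -> bounded_field U h -> 0 <= r ->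
  (L2Xdist lamX g h <= r%:E)%E = (predrisk lamX g h <= r ^+ 2).
Proof.
move=> mg mh bg bh r0; rewrite (L2XdistE lamX mg mh bg bh) lee_fin.
rewrite -[X in _ <= X](ger0_norm r0) -sqrtr_sqr ler_sqrt//.
exact: sqr_ge0.
Qed.

Lemma tnorm_bounded_field dX (X : measurableType dX) dV (U : R) (g : X -> dV.-tuple R) : 0 <= U ->
  (forall x, tnorm (g x) <= U) -> bounded_field U g.
Proof.
move=> U0 h x; have := h x; rewrite /tnorm.
rewrite -{1}(ger0_norm U0) -sqrtr_sqr ler_sqrt//; exact: sqr_ge0.
Qed.

Context {dZ : measure_display} {Z : measurableType dZ} (zeta : {measure set Z -> \bar R}).
Variables (e : nat -> Z -> R) (dW : nat).
Hypothesis me : forall n, measurable_fun setT (e n).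
Hypothesis orth : forall n m, (\int[zeta]_z (e n z * e m z)%:E)%E = (n == m)%:R%:E.

Lemma integrable_basis n m : zeta.-integrable setT (fun z => (e n z * e m z)%:E).
Proof.
apply/integrableP; split.
  by apply/measurable_EFinP; exact: measurable_funM.
have msq k : measurable_fun setT (fun z => (e k z * e k z)%:E).
  by apply/measurable_EFinP; exact: measurable_funM.
have sq0 k z : (0 <= (e k z * e k z)%:E)%E by rewrite lee_fin -expr2 sqr_ge0.
apply: (@le_lt_trans _ _ (\int[zeta]_z ((e n z * e n z)%:E + (e m z * e m z)%:E))%E).
  apply: ge0_le_integral => //.
  - by apply: measurableT_comp => //; apply/measurable_EFinP; exact: measurable_funM.
  - exact: emeasurable_funD.
  move=> z _; rewrite -EFinD abse_EFin lee_fin normrM.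
  have := sqr_ge0 (`|e n z| - `|e m z|); rewrite sqrrB !real_normK ?num_real//.
  have := sqr_ge0 (e n z); have := sqr_ge0 (e m z).
  by rewrite !expr2 mulr2n; lra.
by rewrite ge0_integralD// !orth !eqxx -EFinD ltry.
Qed.

Lemma integral_lincomb DW (a : 'I_DW -> R) n :
  (\int[zeta]_z ((\sum_(m < DW) a m * e m z) * e n z)%:E =
  (\sum_(m < DW) a m * (m == n :> nat)%:R)%:E)%E.
Proof.
transitivity (\int[zeta]_z (\sum_(m < DW) ((a m)%:E * (e m z * e n z)%:E)))%E.
  apply: eq_integral => z _; rewrite mulr_suml -sumEFin; apply: eq_bigr => m _.
  by rewrite -EFinM mulrA.
rewrite integral_sum//; last by move=> m; apply: integrableZl => //; exact: integrable_basis.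
rewrite -sumEFin; apply: eq_bigr => m _.
by rewrite integralZl// ?orth//; exact: integrable_basis.
Qed.

Lemma integral_sqr_lincomb DW (a : 'I_DW -> R) :
  (\int[zeta]_z ((\sum_(m < DW) a m * e m z) ^+ 2)%:E = (\sum_(m < DW) a m ^+ 2)%:E)%E.
Proof.
transitivity (\int[zeta]_z (\sum_(m < DW) \sum_(k < DW) ((a m * a k)%:E * (e m z * e k z)%:E)))%E.
  apply: eq_integral => z _; rewrite expr2 mulr_suml -sumEFin; apply: eq_bigr => m _.
  rewrite mulr_sumr -sumEFin; apply: eq_bigr => k _.
  by rewrite -EFinM; congr (_%:E); ring.
have intZ m k : zeta.-integrable setT (fun z => (a m * a k)%:E * (e m z * e k z)%:E)%E.
  by apply: integrableZl => //; exact: integrable_basis.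
rewrite integral_sum//; last by move=> m; apply: integrable_sum.
rewrite -sumEFin; apply: eq_bigr => m _; rewrite integral_sum//.
rewrite (bigD1 m)//= big1 ?adde0.
  by rewrite integralZl ?orth ?eqxx ?mule1 ?expr2//; exact: integrable_basis.
move=> k km; rewrite integralZl//; last exact: integrable_basis.
by rewrite orth (_ : (m == k :> nat) = false) ?mule0// eq_sym; apply/negbTE.
Qed.

Lemma L2distE DW (c c' : Coef dW DW) :
  L2dist zeta (fieldOf e c) (fieldOf e c') = (Num.sqrt (cdist c c'))%:E.
Proof.
rewrite /L2dist /L2sqdist -sqrte_fin; congr sqrte.
rewrite /cdist -(pair_bigA _ (fun (i : 'I_dW) (n : 'I_DW) =>
   (ccoord c (i, n) - ccoord c' (i, n)) ^+ 2))/= -sumEFin.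
apply: eq_bigr => i _; rewrite -integral_sqr_lincomb; apply: eq_integral => z _.
rewrite /fieldOf !tnth_mktuple; congr ((_ ^+ 2)%:E).
by rewrite -sumrB; apply: eq_bigr => m _; rewrite -mulrBl.
Qed.

Lemma ip_fieldOf DW (c : Coef dW DW) i n :
  ip zeta (fcoord (fieldOf e c) i) (e n) = \sum_(m < DW) ccoord c (i, m) * (m == n :> nat)%:R.
Proof.
rewrite /ip -[RHS]/(fine (_%:E)) -integral_lincomb.
by congr fine; apply: eq_integral => z _; rewrite /fcoord /fieldOf tnth_mktuple.
Qed.

Lemma ccoord_projCoef DW (f : Z -> dW.-tuple R) k :
  ccoord (projCoef zeta e DW f) k = ip zeta (fcoord f k.1) (e k.2).
Proof. by case: k => i n; rewrite /ccoord /Defs.coord /projCoef !tnth_mktuple. Qed.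

Variables (lam : nat -> R) (alpha : R).

Definition sobolev_weight DW (k : 'I_dW * 'I_DW) : R := lam k.2 `^ alpha.

Lemma HsqE DW (c : Coef dW DW) :
  Hsq zeta e lam alpha (fieldOf e c) = (wnorm2 (@sobolev_weight DW) c)%:E.
Proof.
rewrite /Hsq /wnorm2 -(pair_bigA _ (fun (i : 'I_dW) (n : 'I_DW) =>
   sobolev_weight (i, n) * ccoord c (i, n) ^+ 2))/= -sumEFin.
apply: eq_bigr => i _.
rewrite (nneseries_split 0 DW); last first.
  by move=> n _; rewrite lee_fin mulr_ge0 ?powR_ge0// sqr_ge0.
rewrite add0n eseries0 ?adde0; last first.
  move=> n Dn _; rewrite ip_fieldOf big1 ?expr0n ?mulr0// => m _.
  rewrite (_ : (m == n :> nat) = false) ?mulr0//.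
  by apply/negbTE; rewrite neq_ltn (leq_trans (ltn_ord m) Dn).
rewrite sumEFin big_mkord; congr (_%:E); apply: eq_bigr => n _.
rewrite ip_fieldOf (bigD1 n)//= eqxx mulr1 big1 ?addr0// => m mn.
by rewrite (_ : (m == n :> nat) = false) ?mulr0//; apply/negbTE.
Qed.

Lemma HnormE DW (c : Coef dW DW) :
  Hnorm zeta e lam alpha (fieldOf e c) = (Num.sqrt (wnorm2 (@sobolev_weight DW) c))%:E.
Proof. by rewrite /Hnorm HsqE. Qed.

Lemma wnorm2_projCoef DW (f : Z -> dW.-tuple R) :
  ((wnorm2 (@sobolev_weight DW) (projCoef zeta e DW f))%:E <= Hsq zeta e lam alpha f)%E.
Proof.
rewrite /Hsq /wnorm2 -(pair_bigA _ (fun (i : 'I_dW) (n : 'I_DW) =>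
   sobolev_weight (i, n) * ccoord (projCoef zeta e DW f) (i, n) ^+ 2))/= -sumEFin.
apply: lee_sum => i _.
rewrite (nneseries_split 0 DW); last first.
  by move=> n _; rewrite lee_fin mulr_ge0 ?powR_ge0// sqr_ge0.
rewrite add0n big_mkord sumEFin.
under eq_bigr do rewrite ccoord_projCoef.
rewrite leeDl//; apply: nneseries_ge0 => n _ _.
by rewrite lee_fin mulr_ge0 ?powR_ge0// sqr_ge0.
Qed.

(** Cauchy-Schwarz over the [DW] coefficients of each component, whence the additional square root
    of the dimension in the sup-norm constant. *)
Lemma supdist_fieldOf DW (c c' : Coef dW DW) (M : R) : 0 <= M ->
  (forall n z, (n < DW)%N -> `|e n z| <= M) ->
  (supdist (fieldOf e c) (fieldOf e c') <= (M * Num.sqrt (DW%:R * cdist c c'))%:E)%E.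
Proof.
move=> M0 eM; apply: ge_ereal_sup => _ [z _ <-]; rewrite lee_fin /tdist.
rewrite -{1}(ger0_norm M0) -sqrtr_sqr -sqrtrM ?sqr_ge0// ler_sqrt; last first.
  by rewrite !mulr_ge0 ?sqr_ge0// cdist_ge0.
rewrite /sqdist /cdist -(pair_bigA _ (fun (i : 'I_dW) (n : 'I_DW) =>
   (ccoord c (i, n) - ccoord c' (i, n)) ^+ 2))/= !mulr_sumr.
apply: ler_sum => i _; rewrite /fieldOf !tnth_mktuple -sumrB.
pose v n : R := ccoord c (i, n) - ccoord c' (i, n).
have -> : \sum_(n < DW) (Defs.coord c i n * e n z - Defs.coord c' i n * e n z) =
    \sum_(n < DW) v n * e n z.
  by apply: eq_bigr => n _; rewrite /v mulrBl.
apply: (@le_trans _ _ (DW%:R * \sum_(n < DW) (v n * e n z) ^+ 2)).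
  rewrite expr2 mulr_suml; under eq_bigr do rewrite mulr_sumr.
  (* Cauchy-Schwarz in elementary form: [x * y <= x^2 / 2 + y^2 / 2] on each pair of the double
     sum. *)
  apply: (@le_trans _ _ (\sum_(n < DW) \sum_(m < DW) (2^-1 * (v n * e n z) ^+ 2 + 2^-1 * (v m * e m z) ^+ 2))).
    apply: ler_sum => n _; apply: ler_sum => m _; rewrite -subr_ge0.
    rewrite (_ : _ - _ = 2^-1 * (v n * e n z - v m * e m z) ^+ 2); last by field.
    by rewrite mulr_ge0 ?sqr_ge0.
  rewrite le_eqVlt; apply/orP; left; apply/eqP.
  set S := \sum_(n < DW) (v n * e n z) ^+ 2.
  transitivity (\sum_(n < DW) (2^-1 * DW%:R * (v n * e n z) ^+ 2 + 2^-1 * S)).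
    apply: eq_bigr => n _; rewrite big_split/= sumr_const card_ord -mulr_sumr.
    by rewrite -[X in X + _]mulr_natl; congr (_ + _); ring.
  rewrite big_split/= sumr_const card_ord -mulr_sumr -/S -[X in _ + X]mulr_natl.
  by field.
rewrite [leRHS]mulrCA ler_wpM2l// mulr_sumr; apply: ler_sum => n _.
rewrite exprMn mulrC ler_wpM2r ?sqr_ge0// -real_normK ?num_real//.
by rewrite ler_sqr ?nnegrE// eM.
Qed.

End Translation.

Section ProbabilityComplement.
Context d (O : measurableType d) (R : realType) (P : probability O R).

Lemma probability_ge (E B : set O) (r : R) : measurable E -> measurable B ->
  ~` B `<=` E -> (P B <= r%:E)%E -> ((1 - r)%:E <= P E)%E.
Proof.
move=> mE mB BE Br.
apply: (@le_trans _ _ (P (~` B))); last first.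
  by apply: le_measure; rewrite ?inE//; exact: measurableC.
by rewrite probability_setC// EFinB leeB.
Qed.

End ProbabilityComplement.

(** * The regression model: MAP and posterior rates *)

Section Setting.
Context (R : realType) (dZ : measure_display) (Z : measurableType dZ)
  (zeta : {measure set Z -> \bar R}) (dW : nat) (e : nat -> Z -> R) (lam : nat -> R)
  (Theta : set (Z -> dW.-tuple R))
  (dX : measure_display) (X : measurableType dX) (lamX : probability X R)
  (dV : nat) (G : (Z -> dW.-tuple R) -> X -> dV.-tuple R)
  (tau : R) (d : nat) (b1 alpha UG CG gamma A1 : R) (thstar : Z -> dW.-tuple R).
Hypothesis dW0 : (0 < dW)%N.
Hypothesis me : forall n, measurable_fun setT (e n).
Hypothesis orth : forall n m, (\int[zeta]_z (e n z * e m z)%:E)%E = (n == m)%:R%:E.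
Hypothesis lam00 : 0 < lam 0%N.
Hypothesis tau0 : 0 <= tau.
Hypothesis d0 : (0 < d)%N.
Hypothesis b10 : 0 < b1.
Hypothesis sup_e : exists Ce : R, forall DW : nat, (0 < DW)%N -> forall n : nat, (n <= DW)%N ->
      forall z, `|e n z| <= Ce * ((dW * DW)%:R) `^ tau.
Hypothesis weyl : forall n : nat, (0 < n)%N -> b1 * (n%:R) `^ (2 / d%:R) <= lam n.
Hypothesis ThE : forall DW (c : Coef dW DW), Theta (fieldOf e c).
Hypothesis mG : forall th, Theta th -> forall j : 'I_dV, measurable_fun setT (fun x => tnth (G th x) j).
Hypothesis mG2 : forall DW (j : 'I_dV),
      measurable_fun setT (fun p : X * Coef dW DW => tnth (G (fieldOf e p.2) p.1) j).
Hypothesis alpha0 : 0 < alpha.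
Hypothesis alpha_tau : d%:R * (tau + 2^-1) <= alpha.
Hypothesis UG1 : 1 <= UG.
Hypothesis bG : forall th, Theta th -> forall x, tnorm (G th x) <= UG.
Hypothesis CG1 : 1 <= CG.
Hypothesis lipG : forall th th', Theta th -> Theta th' ->
      (L2Xdist lamX (G th) (G th') <= CG%:E * L2dist zeta th th')%E /\
      (supdist (G th) (G th') <= CG%:E * supdist th th')%E.
Hypothesis stab : forall M : R, exists L' : R, exists delta0 : R, 0 < delta0 /\
     forall DW : nat, (0 < DW)%N -> forall delta : R, 0 < delta -> delta <= delta0 ->
     forall c c' : Coef dW DW,
       (Hnorm zeta e lam alpha (fieldOf e c) + Hnorm zeta e lam alpha (fieldOf e c') <= M%:E)%E ->
       (L2Xdist lamX (G (fieldOf e c)) (G (fieldOf e c')) <= delta%:E)%E ->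
       (L2dist zeta (fieldOf e c) (fieldOf e c') <= (L' * delta `^ gamma)%:E)%E.
Hypothesis Thstar : Theta thstar.
Hypothesis Hstar : (Hsq zeta e lam alpha thstar < +oo)%E.

Notation gc c := (G (fieldOf e c)).
Notation fs := (G thstar).
Notation cs DW := (@projCoef R dZ Z zeta e dW DW thstar).
Notation W c := (wnorm2 (@sobolev_weight R dW lam alpha _) c).
Notation risk c := (predrisk lamX (gc c) fs).

Definition admissible (N DW : nat) : Prop :=
  [/\ (0 < N)%N, (0 < DW)%N,
    (dW * DW)%:R <= A1 * (N%:R) `^ (d%:R / (2 * alpha + d%:R)) &
    (L2Xdist lamX fs (gc (cs DW)) <= (deltaN alpha d N / (2 * (2 * (UG + 1))))%:E)%E].

(** Raised to at least 1, as [entropy_prod_le] requires. *)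
Definition dim_const : R := Num.max A1 1.
Definition star_norm2 : R := fine (Hsq zeta e lam alpha thstar).

Let UG0 : 0 <= UG. Proof. exact: le_trans UG1. Qed.
Let CG0 : 0 < CG. Proof. exact: lt_le_trans CG1. Qed.
Let mfs : measurable_field fs. Proof. exact: mG. Qed.
Let bfs : bounded_field UG fs. Proof. by apply: tnorm_bounded_field => //; exact: bG. Qed.
Let mgc DW (c : Coef dW DW) : measurable_field (gc c). Proof. exact: mG. Qed.
Let bgc DW (c : Coef dW DW) : bounded_field UG (gc c).
Proof. by apply: tnorm_bounded_field => //; exact: bG. Qed.
Let dimA1 : 1 <= dim_const. Proof. by rewrite le_max lexx orbT. Qed.

Lemma admissible_dim N DW : admissible N DW ->
  (dW * DW)%:R <= dim_const * (N%:R * deltaN alpha d N ^+ 2).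
Proof.
move=> [N0 DW0 DA _]; have [_ TE _ _ _] := deltaN_facts alpha0 d0 N0.
rewrite TE; apply: (le_trans DA); rewrite ler_wpM2r ?powR_ge0//.
by rewrite le_max lexx.
Qed.

Lemma wnorm2_proj DW : W (cs DW) <= star_norm2.
Proof.
rewrite -lee_fin /star_norm2 fineK; first exact: wnorm2_projCoef.
rewrite ge0_fin_numE//; apply: sume_ge0 => i _; apply: nneseries_ge0 => n _ _.
by rewrite lee_fin mulr_ge0 ?powR_ge0// sqr_ge0.
Qed.

Lemma sobolev_weight_gt0 DW (k : 'I_dW * 'I_DW) : 0 < sobolev_weight lam alpha k.
Proof.
have [be be0 hl] := eigen_lower b10 lam00 weyl.
by rewrite powR_gt0//; apply: lt_le_trans (hl _); rewrite mulr_gt0// powR_gt0.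
Qed.

Lemma sobolev_norm2_ge0 DW (c : Coef dW DW) : 0 <= W c.
Proof. by apply: sumr_ge0 => k _; rewrite mulr_ge0 ?sqr_ge0// ltW// sobolev_weight_gt0. Qed.

Lemma predrisk_lip DW (c c' : Coef dW DW) :
  predrisk lamX (gc c) (gc c') <= CG ^+ 2 * cdist c c'.
Proof.
have [h _] := lipG (ThE c) (ThE c').
rewrite (L2distE me orth) -EFinM in h.
rewrite (L2Xdist_le lamX (mgc c) (mgc c') (bgc c) (bgc c')) in h; last first.
  by rewrite mulr_ge0 ?(ltW CG0)// sqrtr_ge0.
by rewrite exprMn sqr_sqrtr// ?cdist_ge0 in h.
Qed.

(** The denominator in the hypothesis exceeds 2. The quarter leaves room for the factor 2 of the
    triangle inequality when neighbours of the projection are considered. *)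
Lemma risk_proj N DW : admissible N DW -> risk (cs DW) <= deltaN alpha d N ^+ 2 / 4.
Proof.
move=> [N0 _ _]; have [del0 _ _ _ _] := deltaN_facts alpha0 d0 N0.
have u0 : 0 < 2 * (2 * (UG + 1)) by rewrite !mulr_gt0// ltr_wpDl.
rewrite (L2Xdist_le lamX mfs (mgc _) bfs (bgc _)); last by rewrite divr_ge0// ltW.
rewrite predriskC => /le_trans; apply.
rewrite expr_div_n ler_wpM2l ?sqr_ge0// lef_pV2 ?posrE ?exprn_gt0//.
have -> : 4 = 2 ^+ 2 :> R by rewrite expr2; lra.
by rewrite ler_sqr ?nnegrE ?(ltW u0)//; have := UG0; lra.
Qed.

(* The condition [d * (tau + 1/2) <= alpha] enters only here: it makes the sup-norm constant
   [D ^ (tau + 1/2)] at most of order [delta_N^-1]. *)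
Lemma predrisk_sup : exists2 S : R, 0 <= S & forall N DW, admissible N DW ->
  forall (c c' : Coef dW DW) x,
  deltaN alpha d N ^+ 2 * sqdist (gc c x) (gc c' x) <= S ^+ 2 * cdist c c'.
Proof.
have [Ce0 hCe] := sup_e; pose Ce : R := `|Ce0|.
have CeP : 0 <= Ce by exact: normr_ge0.
exists (CG * Ce * dim_const `^ (tau + 2^-1)).
  by rewrite mulr_ge0 ?powR_ge0// mulr_ge0 ?(ltW CG0).
move=> N DW adm c c' x; have DA := admissible_dim adm; have [N0 DW0 _ _] := adm.
have [del0 TE T1 delE _] := deltaN_facts alpha0 d0 N0.
set T := N%:R * _ in TE T1 delE DA; set del := deltaN alpha d N in del0 TE T1 delE DA *.
have T0 : 0 < T by apply: lt_le_trans T1.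
have dA0 : 0 < dim_const by apply: lt_le_trans dimA1.
have D0 : 0 < (dW * DW)%:R :> R by rewrite ltr0n muln_gt0 dW0.
pose M := Ce * (dW * DW)%:R `^ tau.
have M0 : 0 <= M by rewrite mulr_ge0 ?powR_ge0.
have eM n z : (n < DW)%N -> `|e n z| <= M.
  move=> nD; apply: (le_trans (hCe DW DW0 n (ltnW nD) z)).
  by rewrite ler_wpM2r ?powR_ge0// ler_norm.
have [_ h] := lipG (ThE c) (ThE c').
have h2 := supdist_fieldOf c c' M0 eM.
have h3 : (supdist (gc c) (gc c') <= (CG * (M * Num.sqrt (DW%:R * cdist c c')))%:E)%E.
  by apply: (le_trans h); rewrite EFinM lee_pmul2l// lte_fin.
have h4 : tdist (gc c x) (gc c' x) <= CG * (M * Num.sqrt (DW%:R * cdist c c')).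
  by rewrite -lee_fin; apply: le_trans h3; apply: ereal_sup_ubound; exists x.
have r0 : 0 <= CG * (M * Num.sqrt (DW%:R * cdist c c')).
  by rewrite mulr_ge0 ?(ltW CG0)// mulr_ge0// sqrtr_ge0.
have h5 : sqdist (gc c x) (gc c' x) <= (CG * (M * Num.sqrt (DW%:R * cdist c c'))) ^+ 2.
  rewrite /tdist -(ger0_norm r0) -sqrtr_sqr ler_sqrt ?sqr_ge0// in h4.
have q0 := cdist_ge0 c c'.
rewrite !exprMn sqr_sqrtr in h5; last by rewrite mulr_ge0.
apply: (@le_trans _ _ (del ^+ 2 * (CG ^+ 2 * (Ce ^+ 2 * (dW * DW)%:R `^ tau ^+ 2 * (DW%:R * cdist c c'))))).
  by rewrite ler_wpM2l ?sqr_ge0.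
(* [D^(tau + 1/2)] is at most a constant times [T^(tau + 1/2)], hence times
   [T^(alpha/d) = del^-1]. *)
have k1 : (dW * DW)%:R `^ tau * Num.sqrt (DW%:R) <= dim_const `^ (tau + 2^-1) / del.
  apply: (@le_trans _ _ ((dW * DW)%:R `^ (tau + 2^-1))).
    rewrite powRD; last by rewrite (gt_eqF D0) implybT.
    rewrite ler_wpM2l ?powR_ge0// powR12_sqrt ?(ltW D0)// ler_sqrt ?(ltW D0)//.
    by rewrite ler_nat leq_pmull.
  apply: (@le_trans _ _ ((dim_const * T) `^ (tau + 2^-1))).
    apply: ge0_ler_powR => //; rewrite ?nnegrE ?(ltW D0)// ?addr_ge0// mulr_ge0//;
    by rewrite ltW.
  rewrite powRM ?(ltW dA0) ?(ltW T0)// ler_wpM2l ?powR_ge0// delE.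
  apply: ler_powR => //; rewrite ler_pdivlMr ?ltr0n//.
  by rewrite mulrC.
have k2 : (dW * DW)%:R `^ tau ^+ 2 * DW%:R <= dim_const `^ (tau + 2^-1) ^+ 2 / del ^+ 2.
  have -> : DW%:R = Num.sqrt DW%:R ^+ 2 :> R by rewrite sqr_sqrtr.
  rewrite -exprMn -expr_div_n ler_sqr ?nnegrE//.
  by rewrite divr_ge0 ?powR_ge0// ltW.
rewrite !exprMn.
apply: (@le_trans _ _ (del ^+ 2 * CG ^+ 2 * Ce ^+ 2 * cdist c c' *
   ((dW * DW)%:R `^ tau ^+ 2 * DW%:R))).
  by rewrite le_eqVlt; apply/orP; left; apply/eqP; ring.
apply: (@le_trans _ _ (del ^+ 2 * CG ^+ 2 * Ce ^+ 2 * cdist c c' *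
   (dim_const `^ (tau + 2^-1) ^+ 2 / del ^+ 2))).
  by rewrite ler_wpM2l// mulr_ge0// mulr_ge0 ?sqr_ge0// mulr_ge0 ?sqr_ge0.
by rewrite le_eqVlt; apply/orP; left; apply/eqP; field; rewrite gt_eqF.
Qed.

(** [uniform_loglik_bound] with [s = 1/32], so that [4 * s = 1/8]. [C2] is fixed before [N], [DW]
    and the probability space, which makes all later constants uniform. *)
Lemma loglik_control (K0 : R) : 0 <= K0 -> exists2 C2 : R, 0 <= C2 & forall N DW, admissible N DW ->
  let T := N%:R * deltaN alpha d N ^+ 2 in
  forall (dO : measure_display) (O : measurableType dO) (P : probability O R)
      (Xs : 'I_N -> O -> X) (eps : 'I_N -> 'I_dV -> O -> R),
    data_model P lamX Xs eps ->
  exists Bad : set O, [/\ measurable Bad, (P Bad <= (expR (- (K0 * T)))%:E)%E &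
   forall w, ~ Bad w -> forall c : Coef dW DW,
     loglik_at Xs eps fs (gc c) w - loglik_at Xs eps fs fs w <=
     - (gain_rate UG / 16 * (N%:R * risk c)) + T * (C2 + 8^-1 * W c)].
Proof.
move=> K00; have [S S0 hS] := predrisk_sup.
have [be be0 hl] := eigen_lower b10 lam00 weyl.
have s0 : 0 < 32^-1 :> R by rewrite invr_gt0.
have [Ce Ce0 hCe] := mesh_entropy be0 alpha0 d0 dimA1 s0 dW0 hl.
have k0 := gain_rate_gt0 UG.
have i0 : 0 < incr_balance UG S by rewrite /incr_balance divr_gt0// mulr_gt0// expR_gt0.
exists (unif_const UG S CG dim_const Ce K0).
  have A0 : 0 <= dim_const by exact: le_trans dimA1.
  have c0 : 0 <= chain_const dim_const Ce K0.
    by rewrite /chain_const addr_ge0// addr_ge0// addr_ge0// mulr_ge0.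
  have B0 : 0 <= incr_weight UG S by exact: expR_ge0.
  rewrite /unif_const addr_ge0// addr_ge0//.
    rewrite addr_ge0//; last exact: mulr_ge0.
    by rewrite mulr_ge0 ?sqr_ge0// divr_ge0// ltW.
  rewrite mulr_ge0 ?sqr_ge0// mulr_ge0//; first exact: mulr_ge0.
  by apply: ltW; rewrite addr_gt0 ?invr_gt0// divr_gt0// addr_gt0.
move=> N DW adm T dO O P Xs eps dm; have DA := admissible_dim adm.
have [N0 DW0 _ _] := adm.
have [del0 TE T1 delE _] := deltaN_facts alpha0 d0 N0.
have D0 : (0 < dW * DW)%N by rewrite muln_gt0 dW0.
have ent := hCe DW T _ DW0 T1 del0 delE DA.
pose gg (c : Coef dW DW) := gc c.
have mgg c : measurable_field (gg c) by exact: mgc.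
have bgg c : bounded_field UG (gg c) by exact: bgc.
exists (bad_event lamX Xs eps gg fs UG S (deltaN alpha d N) T dim_const Ce 32^-1 K0 (@sobolev_weight R dW lam alpha DW)).
split.
- by apply: (measurable_bad_event dm).
- apply: (bad_event_prob dm) => //.
  + exact: hS.
  + by move=> k; exact: sobolev_weight_gt0.
- move=> w nb c.
  have -> : 8^-1 * W c = 4 * 32^-1 * W c by field.
  move: nb; apply: (@uniform_loglik_bound _ _ _ _ _ _ _ _ _ _ _ _ gg fs UG S CG) => //.
  + exact: predrisk_lip.
  + exact: hS.
  + by move=> k; exact: sobolev_weight_gt0.
Qed.

(** The triangle inequality through the truth bounds the squared distance of [gc c] to the image of
    the projection by [(2 * L2 + 1) * del ^+ 2]; the stability hypothesis then applies at radius
    [C * del], which is admissible once [del <= delta0 / C]. *)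
Lemma stability_control (L2 M2 : R) : 0 <= L2 -> 0 <= M2 ->
  exists Cb del1 : R, 0 < del1 /\ forall N DW, admissible N DW ->
    deltaN alpha d N <= del1 -> forall c : Coef dW DW,
    risk c <= L2 * deltaN alpha d N ^+ 2 -> W c <= M2 ->
    (L2dist zeta (fieldOf e c) (fieldOf e (cs DW)) <= (Cb * deltaN alpha d N `^ gamma)%:E)%E /\
    (Hnorm zeta e lam alpha (fieldOf e c) <= Cb%:E)%E.
Proof.
move=> L20 M20.
have [L' [delta0 [delta00 hst]]] := stab (Num.sqrt M2 + Num.sqrt star_norm2).
pose C := Num.sqrt (2 * L2 + 1).
have C0 : 0 < C by rewrite sqrtr_gt0 ltr_wpDl// mulr_ge0.
(* [L'] may be negative, hence the absolute value; the maximum lets one constant serve both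
   conclusions. *)
pose Cb := Num.max (`|L'| * C `^ gamma) (Num.sqrt M2).
exists Cb, (delta0 / C); split; first by rewrite divr_gt0.
move=> N DW adm small c hr hW; have rcs := risk_proj adm.
have [N0 DW0 _ _] := adm.
have [del0 _ _ _ _] := deltaN_facts alpha0 d0 N0.
set del := deltaN alpha d N in small hr rcs del0 *.
have hc : Hnorm zeta e lam alpha (fieldOf e c) = (Num.sqrt (W c))%:E by exact: HnormE.
have hcs : Hnorm zeta e lam alpha (fieldOf e (cs DW)) = (Num.sqrt (W (cs DW)))%:E by exact: HnormE.
have sW : Num.sqrt (W c) <= Num.sqrt M2 by rewrite ler_sqrt.
split; last by rewrite hc lee_fin le_max sW orbT.
have Cd0 : 0 < C * del by rewrite mulr_gt0.
have pr : predrisk lamX (gc c) (gc (cs DW)) <= (C * del) ^+ 2.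
  apply: (le_trans (predrisk_tri lamX (mgc c) mfs (mgc _) (bgc c) bfs (bgc _))).
  rewrite exprMn sqr_sqrtr; last by rewrite addr_ge0// mulr_ge0.
  rewrite (predriskC lamX fs).
  have d2 : 0 <= del ^+ 2 by rewrite sqr_ge0.
  have -> : (2 * L2 + 1) * del ^+ 2 = 2 * (L2 * del ^+ 2) + del ^+ 2 by ring.
  apply: lerD; first by rewrite ler_pM2l.
  by move: rcs d2; set x := del ^+ 2; move=> ? ?; lra.
have := hst DW DW0 (C * del) Cd0 _ c (cs DW).
move=> /(_ _ _ _)/wrap[].
- by rewrite mulrC -ler_pdivlMr.
- rewrite hc hcs -EFinD lee_fin lerD// ler_sqrt; first exact: wnorm2_proj.
  exact: le_trans (sobolev_norm2_ge0 (cs DW)) (wnorm2_proj DW).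
- by rewrite (L2Xdist_le lamX (mgc c) (mgc _) (bgc c) (bgc _))// ltW.
move=> /le_trans; apply; rewrite lee_fin powRM ?(ltW C0) ?(ltW del0)// mulrA.
rewrite ler_wpM2r ?powR_ge0//; apply: (@le_trans _ _ (`|L'| * C `^ gamma)).
  by rewrite ler_wpM2r ?powR_ge0// ler_norm.
by rewrite le_max lexx.
Qed.

(* Disposes of the finitely many [N] for which [deltaN] is not small: their bound is made
   trivial by a large factor in front of the exponential. *)
Lemma large_delta (del1 : R) : 0 < del1 -> exists Tm : R, forall N, (0 < N)%N ->
  del1 < deltaN alpha d N -> N%:R * deltaN alpha d N ^+ 2 <= Tm.
Proof.
move=> del10.
have d0' : 0 < d%:R :> R by rewrite ltr0n.
pose p := alpha / d%:R.
have p0 : 0 < p by rewrite divr_gt0.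
exists (del1^-1 `^ p^-1) => N N0 hd.
have [del0 _ T1 delE _] := deltaN_facts alpha0 d0 N0.
set T := N%:R * _ in T1 delE *.
have T0 : 0 < T by apply: lt_le_trans T1.
rewrite -[leLHS](powRr1 (ltW T0)) -(mulfV (x := p)) ?gt_eqF// powRrM -delE.
apply: ge0_ler_powR; rewrite ?nnegrE ?invr_ge0 ?(ltW p0) ?(ltW del0) ?(ltW del10)//.
by rewrite lef_pV2 ?posrE// ltW.
Qed.

Lemma measurable_cdist DW (c' : @Coef R dW DW) : measurable_fun setT (fun c : @Coef R dW DW => cdist c c').
Proof.
apply: measurable_sum => k; apply: measurable_funX; apply: measurable_funB => //.
exact: measurable_ccoord.
Qed.

Lemma measurable_sobolev_norm2 DW : measurable_fun setT (fun c : @Coef R dW DW => W c).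
Proof.
apply: measurable_sum => k; apply: measurable_funM; first exact: measurable_cst.
by apply: measurable_funX; exact: measurable_ccoord.
Qed.

Definition target DW (x y : R) : set (@Coef R dW DW) :=
  [set c | (L2dist zeta (fieldOf e c) (fieldOf e (cs DW)) <= x%:E)%E /\
           (Hnorm zeta e lam alpha (fieldOf e c) <= y%:E)%E].

Lemma measurable_target DW x y : measurable (@target DW x y).
Proof.
have msqrt (h : @Coef R dW DW -> R) r : measurable_fun setT h ->
    measurable [set c | (Num.sqrt (h c) <= r)%R].
  move=> mh; have [r0|r0] := leP 0 r; last first.
    rewrite (_ : [set c | _] = set0)//; apply/seteqP; split => // c /= hc.
    by have := le_lt_trans hc r0; rewrite ltNge sqrtr_ge0.
  have E c : (Num.sqrt (h c) <= r) = (h c <= r ^+ 2).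
    by rewrite -[X in _ <= X](ger0_norm r0) -sqrtr_sqr ler_sqrt ?sqr_ge0.
  rewrite (_ : [set c | _] = setT `&` h @^-1` `]-oo, r ^+ 2]%classic); first exact: mh.
  by rewrite setTI; apply/seteqP; split => c /=; rewrite in_itv/= E.
have -> : @target DW x y = [set c | (Num.sqrt (cdist c (cs DW)) <= x)%R] `&`
    [set c | (Num.sqrt (W c) <= y)%R].
  by apply/seteqP; split => c; rewrite /target/= (L2distE me orth) (HnormE me orth) !lee_fin.
by apply: measurableI; apply: msqrt; [exact: measurable_cdist|exact: measurable_sobolev_norm2].
Qed.

Lemma measurable_dataOf N (dO : measure_display) (O : measurableType dO) (P : probability O R)
      (Xs : 'I_N -> O -> X) (eps : 'I_N -> 'I_dV -> O -> R) :
  data_model P lamX Xs eps -> measurable_fun setT (dataOf G thstar Xs eps).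
Proof.
move=> [mXs meps _ _ _]; apply/measurable_fun_tnthP => i.
rewrite (_ : _ \o _ = fun w =>
  ([tuple tnth (G thstar (Xs i w)) j + eps i j w | j < dV], Xs i w)); last first.
  by apply/funext => w; rewrite /= /dataOf tnth_mktuple.
apply: measurable_fun_pair; last exact: mXs.
apply/measurable_fun_tnthP => j.
rewrite (_ : _ \o _ = fun w => tnth (G thstar (Xs i w)) j + eps i j w); last first.
  by apply/funext => w; rewrite /= tnth_mktuple.
apply: measurable_funD; last exact: meps.
exact: (measurableT_comp (mfs j) (mXs i)).
Qed.

(** A lower bound on the likelihood is needed at one point only, the projection, so a single
    Chernoff bound (the event [Low]) complements the uniform upper bound. The penalty coefficient
    1/2 minus 1/8 leaves 3/8 of [T * W th] to bound the Sobolev norm. *)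
Theorem map_rate (c : R) : 0 < c -> exists Cb cb : R,
    forall N DW : nat, admissible N DW ->
    forall (dO : measure_display) (O : measurableType dO) (P : probability O R)
      (Xs : 'I_N -> O -> X) (eps : 'I_N -> 'I_dV -> O -> R),
    data_model P lamX Xs eps ->
    forall thMAP : N.-tuple (dV.-tuple R * X) -> @Coef R dW DW,
    measurable_fun setT thMAP ->
    (forall y (c' : @Coef R dW DW), (Jmap zeta e lam alpha d G y c' <= Jmap zeta e lam alpha d G y (thMAP y))%E) ->
    (P [set w | target (Cb * deltaN alpha d N `^ gamma) Cb (thMAP (dataOf G thstar Xs eps w))]
      >= (1 - cb * expR (- c * N%:R * deltaN alpha d N ^+ 2))%:E)%E.
Proof.
move=> c0.
have [C2 C20 hC2] := loglik_control (ltW c0).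
pose L := expR (4 * UG ^+ 2).
have L0 : 0 <= L by exact: expR_ge0.
have Hs0 : 0 <= star_norm2 by exact: le_trans (sobolev_norm2_ge0 (cs 0)) (wnorm2_proj 0).
(* The uniform constant, the penalty of the projection, and the likelihood loss at the projection
   with its deviation [c]. *)
pose Q := C2 + star_norm2 / 2 + (L + c).
have Q0 : 0 <= Q by rewrite !addr_ge0// ?divr_ge0// ltW.
have k0 := gain_rate_gt0 UG.
(* The two thresholds solve [gain_rate / 16 * risk <= Q * del ^+ 2] and [3 / 8 * W <= Q], the second
   with 8/3 rounded up to 3. *)
have L20 : 0 <= 16 * Q / gain_rate UG by rewrite divr_ge0 ?(ltW k0)// mulr_ge0.
have M20 : 0 <= 3 * Q by rewrite mulr_ge0.
have [Cb [del1 [del10 hst]]] := stability_control L20 M20.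
have [Tm hTm] := large_delta del10.
exists Cb, (2 + expR (c * Tm)) => N DW adm dO O P Xs eps dm thMAP mMAP hMAP.
have [N0 DW0 _ _] := adm.
have [del0 TE T1 delE _] := deltaN_facts alpha0 d0 N0.
set del := deltaN alpha d N in del0 TE T1 delE *.
pose T := N%:R * del ^+ 2.
have -> : - c * N%:R * del ^+ 2 = - (c * T) by rewrite /T; ring.
have eT := expR_gt0 (- (c * T)).
have [small|large] := leP del del1; last first.
  apply: (@le_trans _ _ 0%E) => //; rewrite lee_fin subr_le0 mulrDl.
  rewrite -expRD; apply: (@le_trans _ _ (expR (c * Tm + - (c * T)))).
    by rewrite -expR0 ler_expR subr_ge0 ler_pM2l// hTm.
  by rewrite lerDr mulr_ge0// ltW.
have [Bad [mBad PBad hBad]] := hC2 N DW adm dO O P Xs eps dm.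
pose Low := [set w | (N%:R * (L * risk (cs DW)) + c * T <=
   loglik_at Xs eps fs fs w - loglik_at Xs eps fs (gc (cs DW)) w)%R].
have mdiff : measurable_fun setT (fun w => loglik_at Xs eps fs fs w - loglik_at Xs eps fs (gc (cs DW)) w).
  by apply: measurable_funB; apply: (measurable_loglik_at dm).
have mLow : measurable Low.
  rewrite /Low; set f := (fun w => _) in mdiff; set x := _ + c * T.
  rewrite (_ : [set w | _] = setT `&` f @^-1` `[x, +oo[%classic); first exact: mdiff.
  by rewrite setTI; apply/seteqP; split => w /=; rewrite in_itv/= andbT.
have PLow : (P Low <= (expR (- (c * T)))%:E)%E.
  by apply: chernoff => //; apply: (mgf_loglik_loss dm).
apply: (@le_trans _ _ (1 - 2 * expR (- (c * T)))%:E).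
  by rewrite lee_fin lerD2l lerN2 ler_wpM2r ?(ltW eT)// lerDl expR_ge0.
apply: (@probability_ge _ _ _ P _ (Bad `|` Low)).
- rewrite (_ : [set w | _] = setT `&` (thMAP \o dataOf G thstar Xs eps) @^-1`
     (target (Cb * del `^ gamma) Cb)); last by rewrite setTI.
  apply: (measurableT_comp mMAP (measurable_dataOf dm)) => //.
  exact: measurable_target.
- exact: measurableU.
- move=> w /=; rewrite /setC/= => /not_orP[nBad nLow].
  set th := thMAP _.
  have up := hBad w nBad th.
  have lo : - (L + c) * T <= loglik_at Xs eps fs (gc (cs DW)) w - loglik_at Xs eps fs fs w.
    move/negP: nLow; rewrite -ltNge => h.
    have : N%:R * (L * risk (cs DW)) <= L * T.
      rewrite mulrCA ler_wpM2l// /T ler_wpM2l//.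
      apply: (le_trans (risk_proj adm)); rewrite ler_pdivrMr// ler_peMr ?sqr_ge0//.
      by rewrite ler1n.
    rewrite mulNr mulrDl; lra.
  have := hMAP (dataOf G thstar Xs eps w) (cs DW); rewrite -/th /Jmap.
  rewrite !(HsqE me orth) -!EFinM -!EFinB lee_fin => hJ.
  have n0 : 0 < N%:R :> R by rewrite ltr0n.
  have llE th' : - (N%:R * 2)^-1 * \sum_(i < N) sqdist (tnth (dataOf G thstar Xs eps w) i).1
      (G th' (tnth (dataOf G thstar Xs eps w) i).2) = N%:R^-1 * loglik_at Xs eps fs (G th') w.
    by rewrite -loglik_dataOf /loglik invfM !mulrA; congr (_ * _); field; rewrite gt_eqF.
  rewrite !llE -/del in hJ.
  have nE l v : N%:R * (N%:R^-1 * l - del ^+ 2 / 2 * v) = l - T / 2 * v.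
    by rewrite /T; field; rewrite gt_eqF.
  have hJ' : loglik_at Xs eps fs (gc (cs DW)) w - T / 2 * W (cs DW) <=
     loglik_at Xs eps fs (gc th) w - T / 2 * W th.
    by rewrite -!nE ler_pM2l.
  have T0 : 0 < T by apply: lt_le_trans T1.
  have W0 := sobolev_norm2_ge0 th; have r0 := predrisk_ge0 lamX (gc th) fs.
  have hcs : T / 2 * W (cs DW) <= T / 2 * star_norm2.
    by rewrite ler_wpM2l ?wnorm2_proj// divr_ge0// ltW.
  have key : gain_rate UG / 16 * (N%:R * risk th) + T * (3 / 8 * W th) <= T * Q.
    move: up lo hJ' hcs; rewrite -/del -/T.
    set l1 := loglik_at _ _ _ (gc th) w; set l2 := loglik_at _ _ _ (gc (cs DW)) w.
    set l3 := loglik_at _ _ _ fs w; set rr := gain_rate UG / 16 * _.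
    rewrite /Q !mulrDr !mulNr mulrDl; set a1 := T * C2; set a2 := T / 2 * W (cs DW).
    have -> : T / 2 * W th = 2^-1 * (T * W th) by ring.
    have -> : T * (8^-1 * W th) = 8^-1 * (T * W th) by ring.
    have -> : T * (3 / 8 * W th) = 3 / 8 * (T * W th) by ring.
    have -> : T / 2 * star_norm2 = T * (star_norm2 / 2) by ring.
    rewrite (mulrC L) (mulrC c); set a3 := T * (star_norm2 / 2); set a4 := T * L; set a5 := T * c.
    by move=> *; lra.
  apply: hst => //.
    have : gain_rate UG / 16 * (N%:R * risk th) <= T * Q.
      by apply: le_trans key; rewrite lerDl mulr_ge0 ?(ltW T0)// mulr_ge0.
    rewrite -/del /T => h; rewrite -(ler_pM2l n0).
    have k16 : 0 < gain_rate UG / 16 by rewrite divr_gt0.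
    rewrite -(ler_pM2l k16); apply: (le_trans h).
    by rewrite le_eqVlt; apply/orP; left; apply/eqP; field; rewrite gt_eqF.
  have : T * (3 / 8 * W th) <= T * Q.
    by apply: le_trans key; rewrite lerDr mulr_ge0 ?divr_ge0 ?(ltW k0)// mulr_ge0.
  by rewrite ler_pM2l// => ?; lra.
- apply: (le_trans (measureU2 _ mBad mLow)).
  have -> : 2 * expR (- (c * T)) = expR (- (c * T)) + expR (- (c * T)) by ring.
  by rewrite EFinD leeD.
Qed.

Lemma measurable_post N DW (dO : measure_display) (O : measurableType dO) (P : probability O R)
      (Xs : 'I_N -> O -> X) (eps : 'I_N -> 'I_dV -> O -> R) (Pi : probability (@Coef R dW DW) R) A :
  data_model P lamX Xs eps -> measurable A ->
  measurable_fun setT (fun w => post Pi (fun c => loglik_at Xs eps fs (gc c) w) A).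
Proof.
move=> dm mA.
have mint D : measurable D -> measurable_fun setT (fun w =>
    (\int[Pi]_(c in D) (expR (loglik_at Xs eps fs (gc c) w))%:E)%E).
  move=> mD.
  have -> : (fun w => \int[Pi]_(c in D) (expR (loglik_at Xs eps fs (gc c) w))%:E)%E =
     (fun w => \int[Pi]_c (expR (loglik_at Xs eps fs (gc c) w) * \1_D c)%:E)%E.
    apply/funext => w; rewrite integral_mkcond; apply: eq_integral => c _.
    by rewrite patchE indicE; case: (c \in D); rewrite ?mulr1 ?mulr0.
  apply: (@measurable_fun_fubini_tonelli_F _ _ _ _ R Pi
    (fun p : O * @Coef R dW DW => (expR (loglik_at Xs eps fs (gc p.2) p.1) * \1_D p.2)%:E)).
    apply/measurable_EFinP; apply: measurable_funM.
      apply: measurableT_comp => //.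
      exact: (measurable_loglik_joint dm (g := fun c : @Coef R dW DW => gc c) mfs (@mG2 DW)).
    by apply: (measurableT_comp _ measurable_snd); exact: measurable_indic.
  by move=> p; rewrite lee_fin mulr_ge0 ?expR_ge0.
rewrite /post; apply: measurable_funM; first exact: measurableT_comp (mint A mA).
(* Inversion is read as the power -1, which is a measurable function of the evidence. *)
have -> : (fun w => (fine (\int[Pi]_c (expR (loglik_at Xs eps fs (gc c) w))%:E)%E)^-1) =
    (fun w => fine (\int[Pi]_c (expR (loglik_at Xs eps fs (gc c) w))%:E)%E `^ (-1)).
  by apply/funext => w; rewrite powR_inv1// fine_ge0// integral_ge0.
apply: (measurableT_comp (measurable_powR (R := R) (-1))).
exact: measurableT_comp (mint setT measurableT).
Qed.

(** The evidence is bounded below twice: on a box around the projection, whose prior mass is at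
    least [expR (- (q * T))], to control the posterior; and on the given [BN], whose mass is
    arbitrary, for the second half of the event. *)
Theorem posterior_rate (b : R) : 0 < b -> exists Cb cb bb K : R, 0 < bb /\ 0 < K /\
    forall N DW : nat, admissible N DW ->
    forall (dO : measure_display) (O : measurableType dO) (P : probability O R)
      (Xs : 'I_N -> O -> X) (eps : 'I_N -> 'I_dV -> O -> R),
    data_model P lamX Xs eps ->
    forall Pi : probability (@Coef R dW DW) R,
    gauss_prior lam alpha d N Pi ->
    forall BN : set (@Coef R dW DW), measurable BN ->
    (forall c, BN c -> risk c <= deltaN alpha d N ^+ 2) ->
    (P [set w |
          (1 - expR (- (b * (N%:R * deltaN alpha d N ^+ 2))) <=
           post Pi (fun c => loglik_at Xs eps fs (gc c) w)
             (target (Cb * deltaN alpha d N `^ gamma) Cb))%R /\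
          (Pi BN * (expR (- (K * (N%:R * deltaN alpha d N ^+ 2))))%:E <=
           evidence Xs eps (fun c : @Coef R dW DW => gc c) fs Pi w)%E]
      >= (1 - cb * expR (- (bb * (N%:R * deltaN alpha d N ^+ 2))))%:E)%E.
Proof.
move=> b0.
have [C2 C20 hC2] := loglik_control ler01.
have [be be0 hl] := eigen_lower b10 lam00 weyl.
(* [CG ^+ 2 * rho ^+ 2 = 1/4], so a box of half-side [rho * mesh] keeps the risk below
   [del ^+ 2]. *)
pose rho := (2 * CG)^-1.
have rho0 : 0 < rho by rewrite invr_gt0 mulr_gt0.
have rho20 : 0 < rho ^+ 2 by rewrite exprn_gt0.
(* With [s = rho ^+ 2] the entropy product is exactly the product of the [1 + sg k / t k] in the
   small-ball bound. *)
have [Ce Ce0 hCe] := mesh_entropy be0 alpha0 d0 dimA1 rho20 dW0 hl.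
pose L := expR (4 * UG ^+ 2).
have L0 : 0 < L by exact: expR_gt0.
pose K := L + 1.
have K0 : 0 < K by rewrite addr_gt0.
have Hs0 : 0 <= star_norm2 by exact: le_trans (sobolev_norm2_ge0 (cs 0)) (wnorm2_proj 0).
have A0 : 0 <= dim_const by exact: le_trans dimA1.
(* One term for each factor of [prior_box_ge]: [expR (- 2)] per coordinate, the shift of the box to
   the projection, and the entropy product. *)
pose q := 2 * dim_const + star_norm2 + Ce.
have q0 : 0 <= q by rewrite !addr_ge0// mulr_ge0.
pose Q := C2 + dim_const + q + K + b.
have Q0 : 0 <= Q.
  by rewrite /Q addr_ge0 ?(ltW b0)// addr_ge0 ?(ltW K0)// addr_ge0// addr_ge0.
have k0 := gain_rate_gt0 UG.
have L20 : 0 <= 16 * Q / gain_rate UG by rewrite divr_ge0 ?(ltW k0)// mulr_ge0.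
have M20 : 0 <= 8 * Q by rewrite mulr_ge0.
have [Cb [del1 [del10 hst]]] := stability_control L20 M20.
have [Tm hTm] := large_delta del10.
(* The 3 counts [Bad], [LowB] and [LowN], each of probability at most [expR (- T)] since
   [K - L = 1]; [expR Tm] makes the bound trivial when [deltaN] is large. *)
exists Cb, (3 + expR Tm), 1, K; split => //; split => //.
move=> N DW adm dO O P Xs eps dm Pi [ind law] BN mBN hBN.
have [N0 DW0 _ _] := adm; have DA := admissible_dim adm.
have [del0 TE T1 delE _] := deltaN_facts alpha0 d0 N0.
set del := deltaN alpha d N in del0 TE T1 delE law hBN DA *.
set T := N%:R * del ^+ 2 in TE T1 delE DA *.
have T0 : 0 < T by apply: lt_le_trans T1.
rewrite mul1r.
have eT := expR_gt0 (- T).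
have [small|large] := leP del del1; last first.
  apply: (@le_trans _ _ 0%E) => //; rewrite lee_fin subr_le0 mulrDl.
  rewrite -expRD; apply: (@le_trans _ _ (expR (Tm + - T))).
    by rewrite -expR0 ler_expR subr_ge0 hTm.
  by rewrite lerDr mulr_ge0// ltW.
have [Bad [mBad PBad hBad]] := hC2 N DW adm dO O P Xs eps dm.
rewrite -/del -/T mul1r in PBad.
pose gg (c : @Coef R dW DW) := gc c.
have mg2 := @mG2 DW.
pose ev := evidence Xs eps gg fs Pi.
pose t (k : 'I_dW * 'I_DW) := rho * mesh dW DW del.
pose Box := coef_box (ccoord (cs DW)) t.
have D0 : (0 < dW * DW)%N by rewrite muln_gt0 dW0.
have m0 : 0 < mesh dW DW del by exact: mesh_gt0.
have t0 k : 0 < t k by rewrite mulr_gt0.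
have mBox : measurable Box by exact: measurable_coef_box.
have riskBox c : Box c -> risk c <= del ^+ 2.
  move=> hc; have cd : cdist c (cs DW) <= rho ^+ 2 * del ^+ 2.
    apply: (le_trans (cdist_le (ltW (t0 (Ordinal dW0, Ordinal DW0))) hc)).
    by rewrite /t exprMn mulrCA mesh_sqr.
  apply: (le_trans (predrisk_tri lamX (mgc c) (mgc (cs DW)) mfs (bgc c) (bgc _) bfs)).
  have h1 := predrisk_lip c (cs DW).
  have h2 : CG ^+ 2 * cdist c (cs DW) <= del ^+ 2 / 4.
    apply: (@le_trans _ _ (CG ^+ 2 * (rho ^+ 2 * del ^+ 2))).
      by rewrite ler_wpM2l ?sqr_ge0.
    by rewrite /rho le_eqVlt; apply/orP; left; apply/eqP; field; rewrite gt_eqF.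
  have h3 := risk_proj adm; rewrite -/del in h3.
  by move: h1 h2 h3; set x := del ^+ 2; move=> ? ? ?; lra.
pose LowB := low_evidence Xs eps gg fs T Pi Box K.
pose LowN := low_evidence Xs eps gg fs T Pi BN K.
have mgg c : measurable_field (gg c) by exact: mgc.
have bgg c : bounded_field UG (gg c) by exact: bgc.
have KL : (K - L) * T = T by rewrite /K; ring.
have mLowB : measurable LowB by apply: (measurable_low_evidence dm).
have mLowN : measurable LowN by apply: (measurable_low_evidence dm).
have PLowB : (P LowB <= (expR (- T))%:E)%E.
  by rewrite -[X in - X]KL; apply: (low_evidence_prob dm mfs bfs mgg bgg mg2 (del := del)).
have PLowN : (P LowN <= (expR (- T))%:E)%E.
  by rewrite -[X in - X]KL; apply: (low_evidence_prob dm mfs bfs mgg bgg mg2 (del := del)).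
apply: (@le_trans _ _ (1 - 3 * expR (- T))%:E).
  by rewrite lee_fin lerD2l lerN2 ler_wpM2r ?(ltW eT)// lerDl expR_ge0.
have mtar := @measurable_target DW (Cb * del `^ gamma) Cb.
apply: (@probability_ge _ _ _ P _ (Bad `|` (LowB `|` LowN))).
- rewrite (_ : [set w | _] = (setT `&` (fun w => post Pi (fun c => loglik_at Xs eps fs (gc c) w)
     (target (Cb * del `^ gamma) Cb)) @^-1` `[1 - expR (- (b * T)), +oo[%classic) `&` ~` LowN).
    apply: measurableI; last exact: measurableC.
    by apply: (measurable_post Pi dm mtar).
  rewrite setTI; apply/seteqP; split => w /=; rewrite in_itv/= andbT.
    by move=> [h1 h2]; split => //; rewrite /LowN /low_evidence/=; apply/negP; rewrite -leNgt.
  by move=> [h1 h2]; split => //; move/negP: h2; rewrite -leNgt.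
- by apply: measurableU => //; exact: measurableU.
- move=> w; rewrite /setC/= => /not_orP[nBad /not_orP[nLowB nLowN]].
  split; last by move/negP: nLowN; rewrite -leNgt.
  have evB : (Pi Box * (expR (- (K * T)))%:E <= ev w)%E by move/negP: nLowB; rewrite -leNgt.
  pose sg (k : 'I_dW * 'I_DW) := Num.sqrt (lam k.2 `^ (- alpha) / T).
  have lam0 n : 0 < lam n.
    by apply: lt_le_trans (hl n); rewrite mulr_gt0// powR_gt0.
  have sg0 k : 0 < sg k by rewrite sqrtr_gt0 divr_gt0// powR_gt0.
  have sg2 k : sg k ^+ 2 = (T * sobolev_weight lam alpha k)^-1.
    by rewrite sqr_sqrtr ?(ltW (divr_gt0 _ _)) ?powR_gt0// /sobolev_weight powRN -invfM mulrC.
  have law' k (A : set R) : measurable A ->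
      Pi ((fun c : @Coef R dW DW => Defs.coord c k.1 k.2) @^-1` A) = normal_prob 0 (sg k) A.
    exact: law.
  have Wmom := prior_exp_moment ind sg0 law' (T := T) (a := @sobolev_weight R dW lam alpha DW) _.
  have {}Wmom : (\int[Pi]_c (expR (4^-1 * (T * W c)))%:E <= (expR (dim_const * T))%:E)%E.
    rewrite Wmom; last first.
      by move=> k; rewrite sg2 mulfV// gt_eqF// mulr_gt0// sobolev_weight_gt0.
    rewrite lee_fin; apply: (@le_trans _ _ (2 ^+ (dW * DW))).
      rewrite lerXn2r ?nnegrE ?sqrtr_ge0//.
      by rewrite -[leRHS]ger0_norm// -sqrtr_sqr ler_sqrt ?sqr_ge0// expr2; lra.
    by apply: (le_trans (expr2_le_expR _)); rewrite ler_expR.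
  have PBox : ((expR (- (q * T)))%:E <= Pi Box)%E.
    apply: le_trans (prior_box_ge ind sg0 law' (ccoord (cs DW)) t0).
    rewrite lee_fin.
    rewrite big_split/= big_split/= prodr_const card_prod !card_ord -expR_sum prodfV.
    have ent := hCe DW T del DW0 T1 del0 delE DA.
    have prodE : \prod_(k : 'I_dW * 'I_DW) (1 + sg k / t k) <= expR (Ce * T).
      apply: le_trans ent; rewrite le_eqVlt; apply/orP; left; apply/eqP.
      apply: eq_bigr => k _; congr (1 + _).
      have -> : Num.sqrt (rho ^+ 2 * T * lam k.2 `^ alpha) = rho / sg k.
        have -> : sg k = (Num.sqrt (T * lam k.2 `^ alpha))^-1.
          by rewrite /sg powRN -invfM (mulrC _ T) sqrtrV// mulr_ge0 ?powR_ge0// ltW.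
        rewrite invrK -mulrA sqrtrM ?sqr_ge0// sqrtr_sqr ger0_norm//; exact: ltW.
      by rewrite /t; field; rewrite !gt_eqF.
    have pos : 0 < \prod_(k : 'I_dW * 'I_DW) (1 + sg k / t k).
      by apply: prodr_gt0 => k _; rewrite addr_gt0// divr_gt0.
    have e1 : expR (- (2 * dim_const * T)) <= expR (- 2) ^+ (dW * DW).
      rewrite -expRM_natl ler_expR mulrN lerN2 mulrC -mulrA ler_pM2l//.
    have e2 : expR (- (star_norm2 * T)) <= expR (\sum_(k : 'I_dW * 'I_DW) - (ccoord (cs DW) k ^+ 2 / sg k ^+ 2)).
      rewrite ler_expR sumrN lerN2.
      have -> : \sum_(k : 'I_dW * 'I_DW) ccoord (cs DW) k ^+ 2 / sg k ^+ 2 = T * W (cs DW).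
        rewrite /wnorm2 mulr_sumr; apply: eq_bigr => k _; rewrite sg2 invrK; ring.
      by rewrite mulrC ler_wpM2r ?(ltW T0)// wnorm2_proj.
    have e3 : expR (- (Ce * T)) <= (\prod_(k : 'I_dW * 'I_DW) (1 + sg k / t k))^-1.
      by rewrite expRN lef_pV2 ?posrE ?expR_gt0.
    have -> : expR (- (q * T)) = expR (- (2 * dim_const * T)) * expR (- (star_norm2 * T)) * expR (- (Ce * T)).
      by rewrite -!expRD /q; congr expR; ring.
    by apply: ler_pM; rewrite ?mulr_ge0 ?expR_ge0//; apply: ler_pM; rewrite ?expR_ge0.
  apply: (@posterior_mass_ge R dW DW Pi (fun c => loglik_at Xs eps fs (gc c) w)
    (fun c => W c) (fun c => risk c) (loglik_at Xs eps fs fs w) T dim_const C2 (gain_rate UG / 16) (del ^+ 2)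
    (16 * Q / gain_rate UG) (8 * Q) q K b N%:R) => //.
  + exact: (measurable_loglik_coef dm mfs mg2).
  + exact: measurable_sobolev_norm2.
  + move=> c; rewrite /loglik_at mulNr oppr_le0 mulr_ge0//.
    by apply: sumr_ge0 => i _; apply: sumr_ge0 => j _; exact: sqr_ge0.
  + by move=> c; exact: sobolev_norm2_ge0.
  + by move=> c; exact: predrisk_ge0.
  + exact: ltW.
  + by rewrite divr_ge0// ltW.
  + exact: hBad w nBad.
  + by apply: le_trans evB; rewrite EFinM lee_pmul.
  + move=> c nc; have [h1|h1] := leP (risk c) (16 * Q / gain_rate UG * del ^+ 2); last by left; exact: ltW.
    right; have [h2|h2] := leP (W c) (8 * Q); last exact: ltW.
    by exfalso; apply: nc; exact: hst.
  + by rewrite -/Q le_eqVlt; apply/orP; left; apply/eqP; field; rewrite gt_eqF.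
  + by rewrite -/Q le_eqVlt; apply/orP; left; apply/eqP; field.
- apply: (le_trans (measureU2 _ mBad (measurableU _ _ mLowB mLowN))).
  have -> : 3 * expR (- T) = expR (- T) + (expR (- T) + expR (- T)) by ring.
  rewrite 2!EFinD leeD//; apply: (le_trans (measureU2 _ mLowB mLowN)).
  by rewrite leeD.
Qed.

End Setting.

Theorem mainTheorem2
  (R : realType)
  (* the measure space (Z, zeta), W = R^dW (fixed basis), eigenpairs *)
  (dZ : measure_display) (Z : measurableType dZ) (zeta : {measure set Z -> \bar R})
  (dW : nat) (e : nat -> Z -> R) (lam : nat -> R)
  (Theta : set (Z -> dW.-tuple R))
  (* the probability space (X, lambda), V = R^dV (orthonormal basis), forward map *)
  (dX : measure_display) (X : measurableType dX) (lamX : probability X R)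
  (dV : nat) (G : (Z -> dW.-tuple R) -> X -> dV.-tuple R)
  (* constants *)
  (tau : R) (d : nat) (b1 b2 alpha UG CG gamma A1 : R)
  (thstar : Z -> dW.-tuple R) :
  (* standing assumptions on the basis and the eigenvalues *)
  (0 < dW)%N ->
  (forall n, measurable_fun setT (e n)) ->
  (forall n m, (\int[zeta]_z (e n z * e m z)%:E)%E = (n == m)%:R%:E) ->
  (forall n, exists M : R, forall z, `|e n z| <= M) ->
  0 < lam 0%N ->
  (forall n, lam n <= lam n.+1) ->
  lam @ \oo --> +oo ->
  (* Condition (L) *)
  0 <= tau -> (0 < d)%N -> 0 < b1 -> 0 < b2 ->
  (exists Ce : R, forall DW : nat, (0 < DW)%N -> forall n : nat, (n <= DW)%N ->
      forall z, `|e n z| <= Ce * ((dW * DW)%:R) `^ tau) ->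
  (forall n : nat, (0 < n)%N ->
      b1 * (n%:R) `^ (2 / d%:R) <= lam n /\ lam n <= b2 * (n%:R) `^ (2 / d%:R)) ->
  (forall f g, Theta f -> Theta g -> Theta (fadd f g)) ->
  (forall (a : R) f, Theta f -> Theta (fscale a f)) ->
  (forall DW (c : Coef dW DW), Theta (fieldOf e c)) ->
  (forall f, Theta f -> (forall i, measurable_fun setT (fcoord f i)) /\
                        exists M : R, forall z i, `|tnth (f z) i| <= M) ->
  (* measurability of the forward map *)
  (forall th, Theta th -> forall j : 'I_dV, measurable_fun setT (fun x => tnth (G th x) j)) ->
  (forall DW (j : 'I_dV),
      measurable_fun setT (fun p : X * Coef dW DW => tnth (G (fieldOf e p.2) p.1) j)) ->
  (* assumptions on alpha *)
  0 < alpha -> d%:R < alpha -> d%:R * (tau + 2^-1) <= alpha ->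
  (* Condition (G) a) *)
  1 <= UG -> (forall th, Theta th -> forall x, tnorm (G th x) <= UG) ->
  (* Condition (G) b) *)
  1 <= CG ->
  (forall th th', Theta th -> Theta th' ->
      (L2Xdist lamX (G th) (G th') <= CG%:E * L2dist zeta th th')%E /\
      (supdist (G th) (G th') <= CG%:E * supdist th th')%E) ->
  (* Condition (G) c) *)
  0 < gamma -> gamma <= 1 ->
  (forall M : R, exists L' : R, exists delta0 : R, 0 < delta0 /\
     forall DW : nat, (0 < DW)%N -> forall delta : R, 0 < delta -> delta <= delta0 ->
     forall c c' : Coef dW DW,
       (Hnorm zeta e lam alpha (fieldOf e c) + Hnorm zeta e lam alpha (fieldOf e c') <= M%:E)%E ->
       (L2Xdist lamX (G (fieldOf e c)) (G (fieldOf e c')) <= delta%:E)%E ->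
       (L2dist zeta (fieldOf e c) (fieldOf e c') <= (L' * delta `^ gamma)%:E)%E) ->
  (* the truth: thstar in tilde-H^alpha \cap Theta *)
  Theta thstar -> inL2 zeta thstar -> (Hsq zeta e lam alpha thstar < +oo)%E ->
  (* ---------- conclusion (i) ---------- *)
  (forall c : R, 0 < c -> exists Cb cb : R,
    forall N DW : nat, (0 < N)%N -> (0 < DW)%N ->
    (dW * DW)%:R <= A1 * (N%:R) `^ (d%:R / (2 * alpha + d%:R)) ->
    (L2Xdist lamX (G thstar) (G (fieldOf e (projCoef zeta e DW thstar)))
       <= (deltaN alpha d N / (2 * (2 * (UG + 1))))%:E)%E ->
    forall (dO : measure_display) (O : measurableType dO) (P : probability O R)
      (Xs : 'I_N -> O -> X) (eps : 'I_N -> 'I_dV -> O -> R),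
    data_model P lamX Xs eps ->
    forall thMAP : N.-tuple (dV.-tuple R * X) -> Coef dW DW,
    measurable_fun setT thMAP ->
    (forall y (c' : Coef dW DW), (Jmap zeta e lam alpha d G y c' <= Jmap zeta e lam alpha d G y (thMAP y))%E) ->
    (P [set w | let th := fieldOf e (thMAP (dataOf G thstar Xs eps w)) in
          (L2dist zeta th (fieldOf e (projCoef zeta e DW thstar))
             <= (Cb * deltaN alpha d N `^ gamma)%:E)%E /\
          (Hnorm zeta e lam alpha th <= Cb%:E)%E]
      >= (1 - cb * expR (- c * N%:R * deltaN alpha d N ^+ 2))%:E)%E)
  /\
  (* ---------- conclusion (ii) ---------- *)
  (forall b : R, 0 < b -> exists Cb cb bb K : R, 0 < bb /\ 0 < K /\
    forall N DW : nat, (0 < N)%N -> (0 < DW)%N ->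
    (dW * DW)%:R <= A1 * (N%:R) `^ (d%:R / (2 * alpha + d%:R)) ->
    (L2Xdist lamX (G thstar) (G (fieldOf e (projCoef zeta e DW thstar)))
       <= (deltaN alpha d N / (2 * (2 * (UG + 1))))%:E)%E ->
    forall (dO : measure_display) (O : measurableType dO) (P : probability O R)
      (Xs : 'I_N -> O -> X) (eps : 'I_N -> 'I_dV -> O -> R),
    data_model P lamX Xs eps ->
    forall Pi : probability (Coef dW DW) R,
    gauss_prior lam alpha d N Pi ->
    forall BN : set (Coef dW DW), measurable BN ->
    BN `<=` [set c | (L2Xdist lamX (G (fieldOf e c)) (G thstar)
                       <= (deltaN alpha d N / (2 * (UG ^+ 2 + 1)))%:E)%E] ->
    (P [set w | let y := dataOf G thstar Xs eps w in
          (post Pi (fun c => loglik G y (fieldOf e c))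
            [set c | (L2dist zeta (fieldOf e c) (fieldOf e (projCoef zeta e DW thstar))
                        <= (Cb * deltaN alpha d N `^ gamma)%:E)%E /\
                     (Hnorm zeta e lam alpha (fieldOf e c) <= Cb%:E)%E]
            >= 1 - expR (- b * N%:R * deltaN alpha d N ^+ 2))%R /\
          (\int[Pi]_c (expR (loglik G y (fieldOf e c) - loglik G y thstar))%:E
            >= Pi BN * (expR (- K * N%:R * deltaN alpha d N ^+ 2))%:E)%E]
      >= (1 - cb * expR (- bb * N%:R * deltaN alpha d N ^+ 2))%:E)%E).
Proof.
move=> dW0 me orth _ lam00 _ _ tau0 d0 b10 _ sup_e weyl _ _ ThE _ mG mG2 alpha0 _ alpha_tau
  UG1 bG CG1 lipG _ _ stab Thstar _ Hstar.
have weyl' n : (0 < n)%N -> b1 * n%:R `^ (2 / d%:R) <= lam n by move=> /weyl[].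
have expE x N : - x * N%:R * deltaN alpha d N ^+ 2 = - (x * (N%:R * deltaN alpha d N ^+ 2)).
  by ring.
split=> [c c0|b b0].
  have [Cb [cb h]] := map_rate A1 dW0 me orth lam00 tau0 d0 b10 sup_e weyl' ThE mG alpha0
    alpha_tau UG1 bG CG1 lipG stab Thstar Hstar c0.
  exists Cb, cb => N DW N0 DW0 DA close dO O P Xs eps dm thMAP mMAP hMAP.
  by apply: (h N DW) => //; split.
have [Cb [cb [bb [K [bb0 [K0 h]]]]]] := posterior_rate A1 dW0 me orth lam00 tau0 d0 b10 sup_e
  weyl' ThE mG mG2 alpha0 alpha_tau UG1 bG CG1 lipG stab Thstar Hstar b0.
exists Cb, cb, bb, K; split=> //; split=> // N DW N0 DW0 DA close dO O P Xs eps dm Pi prior BN mBN BNsub.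
rewrite !expE.
have UG0 : 0 <= UG by exact: le_trans UG1.
have [del0 _ _ _ _] := deltaN_facts alpha0 d0 N0.
(* The denominator [2 * (UG ^+ 2 + 1)] is at least 1, so the radius defining [BN] is at most
   [deltaN]. *)
have riskBN c : BN c -> predrisk lamX (G (fieldOf e c)) (G thstar) <= deltaN alpha d N ^+ 2.
  move=> /BNsub/=; have u1 : 1 <= 2 * (UG ^+ 2 + 1) by have := sqr_ge0 UG; lra.
  have u0 : 0 < 2 * (UG ^+ 2 + 1) by exact: lt_le_trans u1.
  rewrite (@L2Xdist_le _ _ _ _ _ UG).
  - move=> /le_trans; apply; rewrite ler_sqr ?nnegrE ?divr_ge0 ?(ltW del0) ?(ltW u0)//.
    by rewrite ler_pdivrMr// ler_peMr// (ltW del0).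
  - exact: mG.
  - exact: mG.
  - by apply: tnorm_bounded_field => //; exact: bG.
  - by apply: tnorm_bounded_field => //; exact: bG.
  - by rewrite divr_ge0// ltW.
have adm : admissible zeta e lamX G d alpha UG A1 thstar N DW by split.
apply: (le_trans (h N DW adm dO O P Xs eps dm Pi prior BN mBN riskBN)).
rewrite le_eqVlt; apply/orP; left; apply/eqP; apply: (congr1 P); apply: eq_set => w /=.
have -> : (fun c : Coef dW DW => loglik G (dataOf G thstar Xs eps w) (fieldOf e c)) =
    (fun c => loglik_at Xs eps (G thstar) (G (fieldOf e c)) w).
  by apply/funext => c; rewrite loglik_dataOf.
have -> : (\int[Pi]_c (expR (loglik G (dataOf G thstar Xs eps w) (fieldOf e c) -
    loglik G (dataOf G thstar Xs eps w) thstar))%:E)%E =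
    evidence Xs eps (fun c : Coef dW DW => G (fieldOf e c)) (G thstar) Pi w.
  by apply: eq_integral => c _; rewrite !loglik_dataOf.
by [].
Qed.
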